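(* For every $n\ge1$ and $\sigma\in S_n$, the graded character $\mathfrak{pfb}_{n,\sigma}(z)$ is given in terms of $\mathfrak{pfb}^!_{n,\sigma}(z)$ by the Koszul formula (as formal power series) $$\mathfrak{pfb}_{n,\sigma}(z)=\frac{1}{\mathfrak{pfb}_{n,\sigma}^!(-z)}.$$
   Context: $\mathfrak{pfb}_n$ is the graded associative unital $\mathbb{Q}$-algebra generated by degree-1 elements $r_{ij}$, $1\le i\ne j\le n$, with relations $r_{ij}+r_{ji}=0$, $[r_{ij},r_{ik}+r_{jk}]+[r_{ik},r_{jk}]=0$ and $[r_{ij},r_{kl}]=0$ for distinct $i,j,k,l$ (it is the associated graded of the rational group algebra of the pure flat braid group, filtered by powers of the augmentation ideal). Its quadratic dual $\mathfrak{pfb}_n^!$ is the exterior algebra over $\mathbb{Q}$ on degree-1 generators $r_{ij}$, $1\le i\ne j\le n$, with $r_{ij}=-r_{ji}$, modulo the relations $r_{ij}\wedge r_{ik}=r_{ij}\wedge r_{jk}$ and $r_{ik}\wedge r_{jk}=r_{ij}\wedge r_{jk}$ for all $i<j<k$. Both algebras are known to be Koszul. $S_n$ acts on both by $\sigma(r_{ij})=r_{\sigma(i)\sigma(j)}$. $\mathfrak{pfb}_{n,\sigma}(z)$ and $\mathfrak{pfb}_{n,\sigma}^!(z)$ are the generating series $\sum_{k\ge0}(\text{trace of }\sigma\text{ on the degree-}k\text{ component})\,z^k$ of the respective algebras. *)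

(* Defs.v *)
From HB Require Import structures.
From mathcomp Require Import all_boot all_order all_algebra perm.
From mathcomp Require Import finmap boolp classical_sets.
From mathcomp Require Import monalg.

Set Implicit Arguments.
Unset Strict Implicit.
Unset Printing Implicit Defensive.

Import GRing.Theory.

Local Open Scope ring_scope.
Local Open Scope quotient_scope.

Fact malg_scalerAr (K : comNzRingType) (M : monomType) (c : K)
  (x y : {malg K[M]}) : c *: (x * y) = x * (c *: y).
Proof.
apply/malgP => w; rewrite mcoeffZ mcoeffMr.
rewrite (@mcoeffMrw _ _ (msupp x) (msupp y)) ?msuppZ_le // mulr_sumr.
apply: eq_bigr => u _; rewrite mulr_sumr; apply: eq_bigr => v _.
by rewrite mcoeffZ mulrnAr mulrCA.
Qed.

Section FreeAlgebra.
Context (K : fieldType) (X : choiceType).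

(* Noncommutative polynomials: finitely supported functions on words in X. *)
Definition free_alg : Type := {malg K[{fmonom X}]}.

HB.instance Definition _ := GRing.Lalgebra.on free_alg.
HB.instance Definition _ :=
  GRing.Lalgebra_isAlgebra.Build K free_alg (@malg_scalerAr K {fmonom X}).

Definition free_gen (x : X) : free_alg := << FMonom [:: x] >>.

Definition homog (k : nat) : set free_alg :=
  [set v | forall w : {fmonom X}, w \in msupp v -> size (w : seq X) = k].

End FreeAlgebra.

Section FreeLift.
Context (K : fieldType) (X : choiceType) (B : algType K) (phi : X -> B).

Definition free_word (w : {fmonom X}) : B := \prod_(x <- (w : seq X)) phi x.

Fact free_word_mmorphism : mmorphism free_word.
Proof.
split => [u v|]; last by rewrite /free_word fm1 big_nil.
by rewrite /free_word -big_cat /= -fmM.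
Qed.

HB.instance Definition _ :=
  isMultiplicative.Build {fmonom X} B free_word free_word_mmorphism.

(* The algebra morphism with prescribed values phi on the generators. *)
Definition free_lift : free_alg K X -> B := mmap (in_alg B) free_word.

Fact free_lift_zmod_morphism : zmod_morphism free_lift.
Proof. exact: mmap_is_additive. Qed.

HB.instance Definition _ := GRing.isZmodMorphism.Build (free_alg K X) B free_lift
  free_lift_zmod_morphism.

Fact free_lift_monoid_morphism : monoid_morphism free_lift.
Proof.
suff [h1 h2] : multiplicative free_lift by split.
apply: commr_mmap_is_multiplicative => g m m' /=.
by rewrite /GRing.comm mulr_algl mulr_algr.
Qed.

HB.instance Definition _ := GRing.isMonoidMorphism.Build (free_alg K X) B free_lift
  free_lift_monoid_morphism.

Fact free_lift_scalable : scalable free_lift.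
Proof. by move=> c v; rewrite /free_lift mmapZ /= mulr_algl. Qed.

HB.instance Definition _ := GRing.isScalable.Build K (free_alg K X) B *:%R free_lift
  free_lift_scalable.

Lemma free_lift_gen x : free_lift (free_gen K x) = phi x.
Proof.
by rewrite /free_lift mmapU /= scale1r mul1r /free_word big_seq1.
Qed.

End FreeLift.

Section IdealQuotient.
Context (K : fieldType) (A : algType K) (S : set A).

Inductive ideal_gen : set A :=
| ideal_gen_mem x : S x -> ideal_gen x
| ideal_gen0 : ideal_gen 0
| ideal_genD x y : ideal_gen x -> ideal_gen y -> ideal_gen (x + y)
| ideal_genMl a x : ideal_gen x -> ideal_gen (a * x)
| ideal_genMr a x : ideal_gen x -> ideal_gen (x * a).

Definition ideal_pred : A -> bool := fun x => `[< ideal_gen x >].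

Fact ideal_pred_zmod_closed : zmod_closed ideal_pred.
Proof.
split=> [|x y /asboolP xI /asboolP yI]; apply/asboolP; first exact: ideal_gen0.
by apply: ideal_genD => //; rewrite -mulN1r; exact: ideal_genMl.
Qed.

HB.instance Definition _ :=
  GRing.isZmodClosed.Build A ideal_pred ideal_pred_zmod_closed.

Definition ideal_zmod : zmodClosed A := GRing.ZmodClosed.clone A ideal_pred _.

Definition ideal_quot : Type := Quotient.quot ideal_zmod.

HB.instance Definition _ := Choice.on ideal_quot.
HB.instance Definition _ := GRing.Zmodule.on ideal_quot.

Definition quot_pi (x : A) : ideal_quot := \pi_(Quotient.quot ideal_zmod) x.
Definition quot_repr (x : ideal_quot) : A := repr x.

Lemma quot_reprK : cancel quot_repr quot_pi.
Proof. by move=> x; rewrite /quot_pi /quot_repr reprK. Qed.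

Lemma quot_piW (P : ideal_quot -> Prop) :
  (forall x, P (quot_pi x)) -> forall x, P x.
Proof. by move=> h x; rewrite -[x]quot_reprK; exact: h. Qed.

Lemma quot_piP x y : quot_pi x = quot_pi y <-> ideal_gen (x - y).
Proof.
split=> [/eqP|h]; last apply/eqP.
  by rewrite -Quotient.idealrBE => /asboolP.
by rewrite -Quotient.idealrBE; apply/asboolP.
Qed.

Fact quot_pi_zmod_morphism : zmod_morphism quot_pi.
Proof. exact: pi_is_zmod_morphism. Qed.

HB.instance Definition _ :=
  GRing.isZmodMorphism.Build A ideal_quot quot_pi quot_pi_zmod_morphism.

Lemma ideal_gen_repr x : ideal_gen (quot_repr (quot_pi x) - x).
Proof. by apply/quot_piP; rewrite quot_reprK. Qed.

Definition quot_mul (x y : ideal_quot) := quot_pi (quot_repr x * quot_repr y).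
Definition quot_scale (c : K) (x : ideal_quot) := quot_pi (c *: quot_repr x).

Lemma quot_piM x y : quot_pi (x * y) = quot_mul (quot_pi x) (quot_pi y).
Proof.
apply/esym/quot_piP; set x' := quot_repr _; set y' := quot_repr _.
have -> : x' * y' - x * y = x' * (y' - y) + (x' - x) * y.
  by rewrite mulrBr mulrBl addrA subrK.
by apply: ideal_genD; [apply: ideal_genMl|apply: ideal_genMr];
  exact: ideal_gen_repr.
Qed.

Lemma quot_piZ c x : quot_pi (c *: x) = quot_scale c (quot_pi x).
Proof.
apply/esym/quot_piP; rewrite -scalerBr -mulr_algl.
by apply: ideal_genMl; exact: ideal_gen_repr.
Qed.

Fact quot_mulA : associative quot_mul.
Proof.
by elim/quot_piW=> x; elim/quot_piW=> y; elim/quot_piW=> z; rewrite -!quot_piM mulrA.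
Qed.
Fact quot_mul1l : left_id (quot_pi 1) quot_mul.
Proof. by elim/quot_piW=> x; rewrite -quot_piM mul1r. Qed.
Fact quot_mul1r : right_id (quot_pi 1) quot_mul.
Proof. by elim/quot_piW=> x; rewrite -quot_piM mulr1. Qed.
Fact quot_mulDl : left_distributive quot_mul +%R.
Proof.
elim/quot_piW=> x; elim/quot_piW=> y; elim/quot_piW=> z.
by rewrite -raddfD -!quot_piM -raddfD mulrDl.
Qed.
Fact quot_mulDr : right_distributive quot_mul +%R.
Proof.
elim/quot_piW=> x; elim/quot_piW=> y; elim/quot_piW=> z.
by rewrite -raddfD -!quot_piM -raddfD mulrDr.
Qed.

HB.instance Definition _ := GRing.Zmodule_isPzRing.Build ideal_quot
  quot_mulA quot_mul1l quot_mul1r quot_mulDl quot_mulDr.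

Fact quot_scaleA c d x : quot_scale c (quot_scale d x) = quot_scale (c * d) x.
Proof. by elim/quot_piW: x => x; rewrite -!quot_piZ scalerA. Qed.
Fact quot_scale1 : left_id 1 quot_scale.
Proof. by elim/quot_piW=> x; rewrite -quot_piZ scale1r. Qed.
Fact quot_scaleDr : right_distributive quot_scale +%R.
Proof.
move=> c; elim/quot_piW=> x; elim/quot_piW=> y.
by rewrite -raddfD -!quot_piZ -raddfD scalerDr.
Qed.
Fact quot_scaleDl x : {morph quot_scale^~ x : c d / c + d}.
Proof.
by elim/quot_piW: x => x c d; rewrite -!quot_piZ -raddfD scalerDl.
Qed.

HB.instance Definition _ := GRing.Zmodule_isLmodule.Build K ideal_quot
  quot_scaleA quot_scale1 quot_scaleDr quot_scaleDl.

Lemma quot_scalerAl (c : K) (x y : ideal_quot) : c *: (x * y) = (c *: x) * y.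
Proof.
elim/quot_piW: x => x; elim/quot_piW: y => y.
change (quot_scale c (quot_mul (quot_pi x) (quot_pi y)) =
        quot_mul (quot_scale c (quot_pi x)) (quot_pi y)).
by rewrite -!(quot_piM, quot_piZ) scalerAl.
Qed.

Lemma quot_scalerAr (c : K) (x y : ideal_quot) : c *: (x * y) = x * (c *: y).
Proof.
elim/quot_piW: x => x; elim/quot_piW: y => y.
change (quot_scale c (quot_mul (quot_pi x) (quot_pi y)) =
        quot_mul (quot_pi x) (quot_scale c (quot_pi y))).
by rewrite -!(quot_piM, quot_piZ) scalerAr.
Qed.

Fact quot_pi_monoid_morphism : monoid_morphism quot_pi.
Proof. by split=> // x y; rewrite quot_piM. Qed.

HB.instance Definition _ := GRing.isMonoidMorphism.Build A ideal_quot quot_pi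
  quot_pi_monoid_morphism.

Fact quot_pi_scalable : scalable quot_pi.
Proof. by move=> c x; rewrite quot_piZ. Qed.

HB.instance Definition _ := GRing.isScalable.Build K A ideal_quot *:%R quot_pi
  quot_pi_scalable.

(* The map induced on the quotient by a morphism f that kills S. *)
Definition quot_lift (B : pzRingType) (f : A -> B) (x : ideal_quot) : B :=
  f (quot_repr x).

Lemma quot_liftE (B : pzRingType) (f : {rmorphism A -> B}) x :
  (forall s, S s -> f s = 0) -> quot_lift f (quot_pi x) = f x.
Proof.
move=> fS; apply/eqP; rewrite -subr_eq0 -rmorphB; apply/eqP.
elim: (ideal_gen_repr x) => [y /fS//| | y z _ fy _ fz|a y _ fy|a y _ fy].
- exact: rmorph0.
- by rewrite rmorphD fy fz addr0.
- by rewrite rmorphM fy mulr0.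
- by rewrite rmorphM fy mul0r.
Qed.

Lemma quot_lift_morphism (B : algType K) (f : {lrmorphism A -> B}) :
  (forall s, S s -> f s = 0) ->
  [/\ zmod_morphism (quot_lift f), monoid_morphism (quot_lift f)
    & scalable (quot_lift f)].
Proof.
move=> fS; split.
- elim/quot_piW=> x; elim/quot_piW=> y.
  by rewrite -raddfB !quot_liftE // rmorphB.
- split; first by rewrite quot_liftE // rmorph1.
  elim/quot_piW=> x; elim/quot_piW=> y.
  by rewrite -rmorphM !quot_liftE // rmorphM.
- by move=> c; elim/quot_piW=> x; rewrite -linearZ !quot_liftE //= linearZ.
Qed.

Lemma ideal_quot_nontrivial (B : nzRingType) (f : {rmorphism A -> B}) :
  (forall s, S s -> f s = 0) -> 1 != 0 :> ideal_quot.
Proof.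
move=> fS; apply/eqP => /(congr1 (quot_lift f)).
rewrite -[1 in LHS](rmorph1 quot_pi) -(rmorph0 quot_pi) !quot_liftE //.
by rewrite rmorph1 rmorph0; apply/eqP; exact: oner_neq0.
Qed.

End IdealQuotient.

Section Homogeneous.
Context (K : fieldType).

Section Closure.
Context (X : choiceType).
Implicit Types u v : free_alg K X.

Lemma homogD k u v : homog k u -> homog k v -> homog k (u + v).
Proof.
move=> hu hv w /(fsubsetP (msuppD_le _ _)).
by rewrite in_fsetU => /orP[/hu|/hv].
Qed.

Lemma homogZ k c u : homog k u -> homog k (c *: u).
Proof. by move=> hu w /(fsubsetP (msuppZ_le _ _)) /hu. Qed.

Lemma homogM k l u v : homog k u -> homog l v -> homog (k + l) (u * v).
Proof.
move=> hu hv w /msuppM_le[w1 [w2 [/hu w1k /hv w2l ->]]].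
by rewrite fmM size_cat w1k w2l.
Qed.

Lemma homog_word (w : {fmonom X}) :
  homog (size (w : seq X)) (<< w >> : free_alg K X).
Proof. by move=> w'; rewrite msuppU oner_eq0 inE => /eqP ->. Qed.

Lemma homog0 k : homog k (0 : free_alg K X).
Proof. by move=> w; rewrite msupp0 inE. Qed.

Lemma homog_free_gen (x : X) : homog 1 (free_gen K x).
Proof. by move=> w; rewrite msuppU oner_eq0 inE => /eqP ->. Qed.

Lemma homog1 : homog 0 (1 : free_alg K X).
Proof. by move=> w; rewrite msuppU oner_eq0 inE => /eqP ->; rewrite fm1. Qed.
End Closure.

Lemma homog_free_lift (X Y : choiceType) (B : algType K)
    (f : {lrmorphism free_alg K Y -> B}) (phi : X -> B) k v :
  (forall x, (f @` homog 1)%classic (phi x)) -> homog k v ->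
  (f @` homog k)%classic (free_lift phi v).
Proof.
move=> hphi hv; rewrite /free_lift /mmap big_seq.
apply: big_ind => [|_ _ [u hu <-] [u' hu' <-]|w /hv <-].
- by exists 0; [exact: homog0|rewrite raddf0].
- by exists (u + u'); [exact: homogD|rewrite raddfD].
- suff [u hu <-] : (f @` homog (size (w : seq X)))%classic (free_word phi w).
    by exists (v@_w *: u); [exact: homogZ|rewrite mulr_algl linearZ].
  rewrite /free_word; elim: (w : seq X) => [|x s [u hu uE]] /=.
    by exists 1; [exact: homog1|rewrite big_nil rmorph1].
  have [u' hu' u'E] := hphi x.
  exists (u' * u); first exact: (homogM (k := 1)).
  by rewrite rmorphM big_cons -uE -u'E.
Qed.

Lemma homog_fin_span (X : finType) (B : algType K)
    (f : {lrmorphism free_alg K X -> B}) k :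
  exists d (e : 'I_d -> B), (forall i, (f @` homog k)%classic (e i)) /\
    forall u, (f @` homog k)%classic u ->
      exists c : 'I_d -> K, u = \sum_i c i *: e i.
Proof.
pose w (i : 'I_#|{: k.-tuple X}|) : {fmonom X} := FMonom (enum_val i).
exists _, (fun i => f << w i >>); split=> [i|_ [v hv <-]].
  by exists << w i >> => // w'; rewrite msuppU oner_eq0 inE => /eqP ->;
    rewrite size_tuple.
exists (fun i => v@_(w i)).
suff {1}-> : v = \sum_i v@_(w i) *: (<< w i >> : free_alg K X).
  by rewrite linear_sum; apply: eq_bigr => i _; rewrite linearZ.
apply/malgP => x; rewrite raddf_sum /=.
have coefE i : (v@_(w i) *: (<< w i >> : {malg K[{fmonom X}]}))@_x
    = v@_(w i) * (w i == x)%:R by rewrite mcoeffZ mcoeffU.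
under eq_bigr do rewrite coefE.
have [xk|xk] := eqVneq (size (x : seq X)) k; last first.
  rewrite mcoeff_outdom; last by apply/negP => /hv/eqP; exact/negP.
  rewrite big1 // => i _; case: eqP => [wx|_]; last by rewrite mulr0.
  by rewrite -wx /= size_tuple eqxx in xk.
have [i wi] : exists i, w i = x.
  exists (enum_rank (tcast xk (in_tuple x))); apply: val_inj.
  by rewrite /= enum_rankK val_tcast.
rewrite (bigD1 i) //= {2}wi eqxx mulr1 big1 ?addr0 ?wi // => j ji.
case: eqP => [wj|_]; last by rewrite mulr0.
case/eqP: ji; apply: enum_val_inj; apply: val_inj.
by have := congr1 val (etrans wj (esym wi)).
Qed.
End Homogeneous.

Section Trace.
Context (K : fieldType) (V : lmodType K).

Definition is_basis (U : set V) (d : nat) (b : 'I_d -> V) : Prop :=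
  [/\ forall i, U (b i),
      forall c : 'I_d -> K, \sum_i c i *: b i = 0 -> forall i, c i = 0
    & forall u, U u -> exists c : 'I_d -> K, u = \sum_i c i *: b i].

Definition is_trace_on (U : set V) (f : V -> V) (t : K) : Prop :=
  exists d (b : 'I_d -> V) (C : 'M[K]_d),
    [/\ is_basis U b, forall i, f (b i) = \sum_j C i j *: b j & t = \tr C].

(* The value 0 for U without a finite basis or not stable under f does not occur
   below, see pfb_charP and pfb_dual_charP. *)
Definition trace_on (U : set V) (f : V -> V) : K :=
  xget 0 [set t | is_trace_on U f t].

Lemma is_trace_on_uniq (U : set V) (f : V -> V) t t' : linear f ->
  is_trace_on U f t -> is_trace_on U f t' -> t = t'.
Proof.
move=> flin [d [b [C [[bU bfree bspan] fb ->]]]] [d' [b' [C' [[bU' bfree' bspan'] fb' ->]]]].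
have f_sum m (c : 'I_m -> K) (e : 'I_m -> V) :
    f (\sum_i c i *: e i) = \sum_i c i *: f (e i).
  have f0 : f 0 = 0 by have := flin (-1) 0 0; rewrite scaler0 addr0 scaleN1r addNr.
  apply: (big_ind2 (fun x y => f x = y)) => [//|x _ y _ <- <-|i _].
    by have := flin 1 x y; rewrite !scale1r.
  by have := flin (c i) (e i) 0; rewrite f0 !addr0.
have mat m m' (e : 'I_m -> V) (e' : 'I_m' -> V) :
    (forall i, exists c : 'I_m' -> K, e i = \sum_j c j *: e' j) ->
    exists M : 'M[K]_(m, m'), forall i, e i = \sum_j M i j *: e' j.
  move=> h; exists (\matrix_(i, j) projT1 (cid (h i)) j) => i.
  rewrite {1}(projT2 (cid (h i))); apply: eq_bigr => j _.
  by rewrite mxE.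
have [P bP] := mat _ _ _ _ (fun i => bspan' _ (bU i)).
have [Q b'Q] := mat _ _ _ _ (fun i => bspan _ (bU' i)).
have comb m m' m'' (M : 'M[K]_(m, m')) (N : 'M[K]_(m', m'')) (e : 'I_m'' -> V) i :
    \sum_j M i j *: \sum_l N j l *: e l = \sum_l (M *m N) i l *: e l.
  rewrite (eq_bigr (fun j => \sum_l (M i j * N j l) *: e l)); last first.
    by move=> j _; rewrite scaler_sumr; apply: eq_bigr => l _; rewrite scalerA.
  rewrite exchange_big; apply: eq_bigr => l _.
  by rewrite mxE scaler_suml.
have mxinj m m' (M N : 'M[K]_(m, m')) (e : 'I_m' -> V) :
    (forall c : 'I_m' -> K, \sum_i c i *: e i = 0 -> forall i, c i = 0) ->
    (forall i, \sum_j M i j *: e j = \sum_j N i j *: e j) -> M = N.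
  move=> efree MN; apply/matrixP => i j; apply/eqP; rewrite -subr_eq0; apply/eqP.
  apply: (efree (fun j => M i j - N i j)).
  under eq_bigr do rewrite scalerBl.
  by rewrite big_split /= sumrN MN subrr.
have PQ : P *m Q = 1%:M.
  apply: (mxinj _ _ _ _ b bfree) => i; rewrite -comb.
  under eq_bigr do rewrite -b'Q.
  rewrite -bP (bigD1 i) //= mxE eqxx scale1r big1 ?addr0 // => j ji.
  by rewrite mxE eq_sym (negPf ji) scale0r.
have CP : C *m P = P *m C'.
  apply: (mxinj _ _ _ _ b' bfree') => i; rewrite -!comb.
  under eq_bigr do rewrite -bP.
  under [in RHS]eq_bigr do rewrite -fb'.
  by rewrite -fb -f_sum -bP.
have QP : Q *m P = 1%:M.
  apply: (mxinj _ _ _ _ b' bfree') => i; rewrite -comb.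
  under eq_bigr do rewrite -bP.
  rewrite -b'Q (bigD1 i) //= mxE eqxx scale1r big1 ?addr0 // => j ji.
  by rewrite mxE eq_sym (negPf ji) scale0r.
by rewrite -[C]mulmx1 -PQ mulmxA CP mxtrace_mulC mulmxA QP mul1mx.
Qed.

Lemma is_basis_exists (U : set V) d (e : 'I_d -> V) : (forall i, U (e i)) ->
  (forall u, U u -> exists c : 'I_d -> K, u = \sum_i c i *: e i) ->
  exists d' (b : 'I_d' -> V), is_basis U b.
Proof.
elim: d e => [|d IHd] e eU espan.
  by exists 0, e; split=> // c _ [].
have [efree|] := pselect (forall c : 'I_d.+1 -> K,
    \sum_i c i *: e i = 0 -> forall i, c i = 0).
  by exists d.+1, e; split.
move/existsNP=> [c /not_implyP[c0 /existsNP[i0 /eqP ci0]]].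
have ei0 : e i0 = \sum_j (- (c i0)^-1 * c (lift i0 j)) *: e (lift i0 j).
  move: c0; rewrite (bigD1_ord i0) //= => /eqP; rewrite addr_eq0 => /eqP c0.
  apply: (scalerI ci0); rewrite c0 scaler_sumr -sumrN; apply: eq_bigr => j _.
  by rewrite scalerA mulrA mulrN mulfV // mulN1r scaleNr.
apply: (IHd (e \o lift i0)) => [i|u /espan[a ->]]; first exact: eU.
exists (fun j => a i0 * (- (c i0)^-1 * c (lift i0 j)) + a (lift i0 j)).
rewrite (bigD1_ord i0) //= {1}ei0 scaler_sumr -big_split; apply: eq_bigr => j _.
by rewrite /= scalerDl scalerA.
Qed.

Lemma trace_onP (U : set V) (f : V -> V) d (e : 'I_d -> V) :
  (forall i, U (e i)) ->
  (forall u, U u -> exists c : 'I_d -> K, u = \sum_i c i *: e i) ->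
  (forall u, U u -> U (f u)) ->
  is_trace_on U f (trace_on U f).
Proof.
move=> eU espan fU; have [d' [b bb]] := is_basis_exists eU espan.
have [bU _ bspan] := bb; rewrite /trace_on; apply: xgetPex.
pose C := \matrix_(i, j) projT1 (cid (bspan _ (fU _ (bU i)))) j.
exists (\tr C), d', b, C; split=> // i.
rewrite {1}(projT2 (cid (bspan _ (fU _ (bU i))))); apply: eq_bigr => j _.
by rewrite mxE.
Qed.

End Trace.

Section PowerSeries.
Context (K : fieldType).

(* A formal power series is given by its coefficients, nat -> K. *)
Definition fps_mul (f g : nat -> K) (k : nat) : K :=
  \sum_(i < k.+1) f i * g (k - i)%N.

Definition fps_one (k : nat) : K := (k == 0%N)%:R.

(* The series f(-z). *)
Definition fps_subN (f : nat -> K) (k : nat) : K := (-1) ^+ k * f k.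

(* The first k coefficients of 1/f: the coefficient of degree k > 0 is
   determined by sum_(i <= k) (1/f)_i f_(k-i) = 0. *)
Fixpoint fps_inv_seq (f : nat -> K) (k : nat) : seq K :=
  if k is k'.+1 then
    let s := fps_inv_seq f k' in
    rcons s ((fps_one k' - \sum_(i < k') s`_i * f (k' - i)%N) / f 0%N)
  else [::].

Definition fps_inv (f : nat -> K) (k : nat) : K := (fps_inv_seq f k.+1)`_k.

Lemma fps_mulVf (f : nat -> K) : f 0%N != 0 -> fps_mul (fps_inv f) f = fps_one.
Proof.
move=> f0; apply/funext => k.
have sz m : size (fps_inv_seq f m) = m.
  by elim: m => //= m IH; rewrite size_rcons IH.
have nthE m i : (i < m)%N -> (fps_inv_seq f m)`_i = fps_inv f i.
  elim: m => // m IH; rewrite ltnS leq_eqVlt => /orP[/eqP->//|im].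
  by rewrite /= nth_rcons sz im IH.
rewrite /fps_mul big_ord_recr /= subnn {2}/fps_inv /= nth_rcons sz ltnn eqxx.
rewrite divfK //; under [X in _ + (_ - X)]eq_bigr do rewrite nthE //.
by rewrite addrC subrK.
Qed.

End PowerSeries.

Section Relations.
Context (n : nat).

Section Definitions.
Context (A : pzRingType) (r : 'I_n -> 'I_n -> A).

Definition alg_comm (x y : A) : A := x * y - y * x.

Inductive pfb_rel : set A :=
| pfb_rel_antisym i j of i != j : pfb_rel (r i j + r j i)
| pfb_rel_triple i j k of uniq [:: i; j; k] :
    pfb_rel (alg_comm (r i j) (r i k + r j k) + alg_comm (r i k) (r j k))
| pfb_rel_far i j k l of uniq [:: i; j; k; l] :
    pfb_rel (alg_comm (r i j) (r k l)).

(* The relations v * v, v in D, with D the set of degree 1 elements, present the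
   exterior algebra as a quotient of the tensor algebra. *)
Inductive pfb_dual_rel (D : set A) : set A :=
| pfb_dual_rel_antisym i j of i != j : pfb_dual_rel D (r i j + r j i)
| pfb_dual_rel_ext v of D v : pfb_dual_rel D (v * v)
| pfb_dual_rel_ij (i j k : 'I_n) of (i < j)%N & (j < k)%N :
    pfb_dual_rel D (r i j * r i k - r i j * r j k)
| pfb_dual_rel_ik (i j k : 'I_n) of (i < j)%N & (j < k)%N :
    pfb_dual_rel D (r i k * r j k - r i j * r j k).

End Definitions.

Lemma pfb_rel_morph (A B : pzRingType) (f : {rmorphism A -> B}) r r' x :
  (forall i j : 'I_n, i != j -> f (r i j) = r' i j) ->
  pfb_rel r x -> pfb_rel r' (f x).
Proof.
move=> fr [i j ij|i j k U|i j k l U].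
- by rewrite rmorphD !fr // 1?eq_sym //; exact: pfb_rel_antisym.
- have := U; rewrite /= !inE negb_or => /andP[/andP[ij ik] /andP[jk _]].
  by rewrite rmorphD !rmorphB !rmorphM rmorphD !fr //; exact: pfb_rel_triple.
- have := U; rewrite /= !inE !negb_or => /andP[/and3P[ij _ _] /andP[_ /andP[kl _]]].
  by rewrite rmorphB !rmorphM !fr //; exact: pfb_rel_far.
Qed.

Lemma pfb_dual_rel_morph (A B : pzRingType) (f : {rmorphism A -> B}) r r' D D' x :
  (forall i j : 'I_n, i != j -> f (r i j) = r' i j) ->
  (forall v, D v -> D' (f v)) ->
  pfb_dual_rel r D x -> pfb_dual_rel r' D' (f x).
Proof.
have neq (i j : 'I_n) : (i < j)%N -> i != j by move/ltn_eqF; rewrite -val_eqE => ->.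
move=> fr fD [i j ij|v Dv|i j k ij jk|i j k ij jk].
- by rewrite rmorphD !fr // 1?eq_sym //; exact: pfb_dual_rel_antisym.
- by rewrite rmorphM; apply: pfb_dual_rel_ext; exact: fD.
- have ik := ltn_trans ij jk.
  by rewrite rmorphB !rmorphM !fr ?neq //; exact: pfb_dual_rel_ij.
- have ik := ltn_trans ij jk.
  by rewrite rmorphB !rmorphM !fr ?neq //; exact: pfb_dual_rel_ik.
Qed.

Lemma pfb_rel_lift (A B : pzRingType) (f : {rmorphism A -> B}) r y :
  pfb_rel (fun i j => f (r i j)) y -> exists2 x, pfb_rel r x & y = f x.
Proof.
case=> [i j ij|i j k U|i j k l U].
- by exists (r i j + r j i); [exact: pfb_rel_antisym|rewrite rmorphD].
- exists (alg_comm (r i j) (r i k + r j k) + alg_comm (r i k) (r j k)).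
    exact: pfb_rel_triple.
  by rewrite rmorphD !rmorphB !rmorphM rmorphD.
- exists (alg_comm (r i j) (r k l)); first exact: pfb_rel_far.
  by rewrite rmorphB !rmorphM.
Qed.

Lemma pfb_dual_rel_lift (A B : pzRingType) (f : {rmorphism A -> B}) r D y :
  pfb_dual_rel (fun i j => f (r i j)) [set f v | v in D] y ->
  exists2 x, pfb_dual_rel r D x & y = f x.
Proof.
case=> [i j ij|_ [v Dv <-]|i j k ij jk|i j k ij jk].
- by exists (r i j + r j i); [exact: pfb_dual_rel_antisym|rewrite rmorphD].
- by exists (v * v); [exact: pfb_dual_rel_ext|rewrite rmorphM].
- exists (r i j * r i k - r i j * r j k); first exact: pfb_dual_rel_ij.
  by rewrite rmorphB !rmorphM.
- exists (r i k * r j k - r i j * r j k); first exact: pfb_dual_rel_ik.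
  by rewrite rmorphB !rmorphM.
Qed.

Lemma pfb_rel_perm (A : pzRingType) (r : 'I_n -> 'I_n -> A) (s : 'S_n) x :
  pfb_rel (fun i j => r (s i) (s j)) x -> pfb_rel r x.
Proof.
case=> [i j ij|i j k U|i j k l U].
- by apply: pfb_rel_antisym; rewrite (inj_eq perm_inj).
- by apply: pfb_rel_triple; rewrite -(map_inj_uniq (@perm_inj _ s)) in U.
- by apply: pfb_rel_far; rewrite -(map_inj_uniq (@perm_inj _ s)) in U.
Qed.

Lemma pfb_dual_rel_perm (A : pzRingType) (r : 'I_n -> 'I_n -> A) D (s : 'S_n) x :
  (forall y, pfb_dual_rel r D y -> y = 0) ->
  (forall i j, i != j -> D (r i j)) ->
  (forall u v, D u -> D v -> D (u + v)) ->
  pfb_dual_rel (fun i j => r (s i) (s j)) D x -> x = 0.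
Proof.
move=> rel0 Dr DD.
have asym i j : i != j -> r j i = - r i j.
  move=> ij; apply/eqP; rewrite -addr_eq0 addrC; apply/eqP.
  by apply: rel0; exact: pfb_dual_rel_antisym.
have sq v : D v -> v * v = 0 by move=> Dv; apply: rel0; exact: pfb_dual_rel_ext.
have anti u v : D u -> D v -> v * u = - (u * v).
  move=> Du Dv; apply/eqP; rewrite -addr_eq0; apply/eqP.
  have := sq _ (DD _ _ Du Dv).
  by rewrite mulrDl !mulrDr !sq // add0r addr0 addrC.
pose T i j k := r i j * r i k = r i j * r j k /\ r i k * r j k = r i j * r j k.
have T_lt (i j k : 'I_n) : (i < j)%N -> (j < k)%N -> T i j k.
  by move=> ij jk; split; apply/eqP; rewrite -subr_eq0; apply/eqP; apply: rel0;
    [exact: pfb_dual_rel_ij|exact: pfb_dual_rel_ik].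
have neqP (i j k : 'I_n) : uniq [:: i; j; k] -> [/\ i != j, i != k & j != k].
  by rewrite /= !inE negb_or => /andP[/andP[-> ->] /andP[-> _]].
have T12 i j k : uniq [:: i; j; k] -> T i j k -> T j i k.
  move=> /neqP[ij ik jk] [e1 e2]; split.
    by rewrite (asym i j) // !mulNr e1.
  by rewrite (asym i j) // mulNr (anti _ _ (Dr _ _ ik) (Dr _ _ jk)) e1 e2.
have T23 i j k : uniq [:: i; j; k] -> T i j k -> T i k j.
  move=> /neqP[ij ik jk] [e1 e2]; split.
    by rewrite (asym j k) // mulrN (anti _ _ (Dr _ _ ij) (Dr _ _ ik)) e1 e2.
  by rewrite (asym j k) // !mulrN e2.
have TU i j k : uniq [:: i; j; k] -> T i j k.
  move=> U; have [ij ik jk] := neqP _ _ _ U.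
  have U' : forall a b c : 'I_n, perm_eq [:: i; j; k] [:: a; b; c] -> uniq [:: a; b; c].
    by move=> a b c /perm_uniq <-.
  have lt a b : a != b -> (a < b)%N \/ (b < a)%N.
    by move=> ab; apply/orP; rewrite -neq_ltn.
  have P1 : perm_eq [:: i; j; k] [:: j; i; k] by rewrite (perm_catCA [:: i] [:: j]).
  have P2 : perm_eq [:: i; j; k] [:: i; k; j] by rewrite perm_cons (perm_catC [:: j] [:: k]).
  have P3 : perm_eq [:: i; j; k] [:: k; i; j] by rewrite (perm_catC [:: i; j] [:: k]).
  have P4 : perm_eq [:: i; j; k] [:: j; k; i] by rewrite (perm_catC [:: i] [:: j; k]).
  have P5 : perm_eq [:: i; j; k] [:: k; j; i].
    by apply: (perm_trans P4); rewrite (perm_catCA [:: j] [:: k]).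
  case: (lt i j ij) => [lij|lji]; case: (lt j k jk) => [ljk|lkj];
    case: (lt i k ik) => [lik|lki].
  - exact: T_lt.
  - by have := ltn_trans lij ljk; rewrite ltnNge ltnW.
  - by apply: (T23); [exact: U' P2|exact: T_lt].
  - by apply: (T23); [exact: U' P2|apply: (T12); [exact: U' P3|exact: T_lt]].
  - by apply: (T12); [exact: U' P1|exact: T_lt].
  - by apply: (T12); [exact: U' P1|apply: (T23); [exact: U' P4|exact: T_lt]].
  - by have := ltn_trans lkj lji; rewrite ltnNge ltnW.
  - apply: (T12); first exact: U' P1.
    by apply: (T23); [exact: U' P4|apply: (T12); [exact: U' P5|exact: T_lt]].
have neq (i j : 'I_n) : (i < j)%N -> i != j by move/ltn_eqF; rewrite -val_eqE => ->.
have Us (i j k : 'I_n) : (i < j)%N -> (j < k)%N -> uniq [:: s i; s j; s k].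
  move=> ij jk; rewrite (map_inj_uniq (@perm_inj _ s) [:: i; j; k]) /= !inE.
  by rewrite negb_or !neq // (ltn_trans ij).
case=> [i j ij|v|i j k ij jk|i j k ij jk].
- by rewrite (asym (s i)) ?subrr // (inj_eq perm_inj).
- exact: sq.
- by have [-> _] := TU _ _ _ (Us _ _ _ ij jk); rewrite subrr.
- by have [_ ->] := TU _ _ _ (Us _ _ _ ij jk); rewrite subrr.
Qed.

End Relations.

Section FlatBraidAlgebras.
Context (n : nat).

Definition ord_pair : Type := {p : 'I_n * 'I_n | p.1 != p.2}.
HB.instance Definition _ := Finite.on ord_pair.

Notation F := (free_alg rat ord_pair).

(* The generator r_ij; the value 0 for i = j is never used. *)
Definition rgen (i j : 'I_n) : F :=
  if insub (i, j) is Some p then free_gen rat (p : ord_pair) else 0.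

Definition pfb : Type := ideal_quot (pfb_rel rgen).
Definition pfb_dual : Type := ideal_quot (pfb_dual_rel rgen (homog 1)).

HB.instance Definition _ := GRing.PzRing.on pfb.
HB.instance Definition _ := GRing.Lmodule.on pfb.
HB.instance Definition _ := GRing.PzRing.on pfb_dual.
HB.instance Definition _ := GRing.Lmodule.on pfb_dual.

Lemma free_lift_rgen (B : algType rat) (r : 'I_n -> 'I_n -> B) i j :
  i != j ->
  free_lift (fun p : ord_pair => r (val p).1 (val p).2) (rgen i j) = r i j.
Proof.
move=> ij; rewrite /rgen insubT /= free_lift_gen.
by [].
Qed.

Definition free_aug : F -> rat := @mcoeff {fmonom ord_pair} rat mone.

Fact free_aug_zmod_morphism : zmod_morphism free_aug.
Proof. exact: mcoeff_is_additive. Qed.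
HB.instance Definition _ :=
  GRing.isZmodMorphism.Build F rat free_aug free_aug_zmod_morphism.

Fact free_aug_monoid_morphism : monoid_morphism free_aug.
Proof. by have [] := @mcoeff1g_is_multiplicative {fmonom ord_pair} rat. Qed.
HB.instance Definition _ :=
  GRing.isMonoidMorphism.Build F rat free_aug free_aug_monoid_morphism.

Lemma free_aug_rgen i j : free_aug (rgen i j) = 0.
Proof.
rewrite /rgen; case: insubP => [p _ _|_]; last exact: raddf0.
by rewrite /free_aug mcoeffU -val_eqE /= fm1.
Qed.

Lemma free_aug_homog1 v : homog 1 v -> free_aug v = 0.
Proof. by rewrite /free_aug; case: msuppP => // h /(_ _ h); rewrite fm1. Qed.

Fact pfb_nontrivial : 1 != 0 :> pfb.
Proof.
apply: (@ideal_quot_nontrivial _ _ _ _ free_aug) => x xR.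
suff rel0 (y : rat) : pfb_rel (fun _ _ : 'I_n => 0) y -> y = 0.
  by apply/rel0/(pfb_rel_morph _ xR) => *; exact: free_aug_rgen.
by case=> *; rewrite /alg_comm !(mul0r, mulr0, subr0, addr0).
Qed.

Fact pfb_dual_nontrivial : 1 != 0 :> pfb_dual.
Proof.
apply: (@ideal_quot_nontrivial _ _ _ _ free_aug) => x xR.
suff rel0 (y : rat) : pfb_dual_rel (fun _ _ : 'I_n => 0) [set 0] y -> y = 0.
  apply/rel0/(pfb_dual_rel_morph _ _ xR) => *; first exact: free_aug_rgen.
  exact: free_aug_homog1.
by case=> [*|v ->|*|*]; rewrite !(mul0r, subr0, addr0).
Qed.

HB.instance Definition _ := GRing.PzSemiRing_isNonZero.Build pfb pfb_nontrivial.
HB.instance Definition _ :=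
  GRing.Lmodule_isLalgebra.Build rat pfb (@quot_scalerAl _ _ _).
HB.instance Definition _ :=
  GRing.Lalgebra_isAlgebra.Build rat pfb (@quot_scalerAr _ _ _).

HB.instance Definition _ := GRing.PzSemiRing_isNonZero.Build pfb_dual pfb_dual_nontrivial.
HB.instance Definition _ :=
  GRing.Lmodule_isLalgebra.Build rat pfb_dual (@quot_scalerAl _ _ _).
HB.instance Definition _ :=
  GRing.Lalgebra_isAlgebra.Build rat pfb_dual (@quot_scalerAr _ _ _).

Definition pfb_pi : F -> pfb := @quot_pi _ _ _.
Definition pfb_dual_pi : F -> pfb_dual := @quot_pi _ _ _.
HB.instance Definition _ := GRing.LRMorphism.on pfb_pi.
HB.instance Definition _ := GRing.LRMorphism.on pfb_dual_pi.

(* The action of s, that is, the algebra endomorphism r_ij |-> r_(s i)(s j). *)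
Definition pfb_act (s : 'S_n) : pfb -> pfb :=
  quot_lift
    (free_lift (fun p : ord_pair => pfb_pi (rgen (s (val p).1) (s (val p).2)))).
Definition pfb_dual_act (s : 'S_n) : pfb_dual -> pfb_dual :=
  quot_lift
    (free_lift (fun p : ord_pair => pfb_dual_pi (rgen (s (val p).1) (s (val p).2)))).

Definition pfb_component (k : nat) : set pfb := [set pfb_pi v | v in homog k].
Definition pfb_dual_component (k : nat) : set pfb_dual := [set pfb_dual_pi v | v in homog k].

Lemma quot_pi_rel (A : algType rat) (S : set A) x :
  S x -> quot_pi S x = 0.
Proof.
move=> Sx; rewrite -[RHS](raddf0 (quot_pi S)); apply/quot_piP.
by rewrite subr0; exact: ideal_gen_mem.
Qed.

Fact pfb_act_rel (s : 'S_n) x : pfb_rel rgen x ->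
  free_lift (fun p : ord_pair => pfb_pi (rgen (s (val p).1) (s (val p).2))) x = 0.
Proof.
set f := free_lift _ => xR.
suff rel0 y : pfb_rel (fun i j => pfb_pi (rgen (s i) (s j))) y -> y = 0.
  apply/rel0/(pfb_rel_morph _ xR) => i j ij.
  exact: (free_lift_rgen (fun i j => pfb_pi (rgen (s i) (s j)))).
move/(pfb_rel_perm (r := fun i j => pfb_pi (rgen i j))) => /pfb_rel_lift[z zR ->].
exact: quot_pi_rel.
Qed.

Lemma pfb_act_morphism (s : 'S_n) :
  [/\ zmod_morphism (pfb_act s), monoid_morphism (pfb_act s)
    & scalable (pfb_act s)].
Proof. by apply: quot_lift_morphism => x; exact: pfb_act_rel. Qed.

Lemma pfb_act_rgen (s : 'S_n) i j : i != j ->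
  pfb_act s (pfb_pi (rgen i j)) = pfb_pi (rgen (s i) (s j)).
Proof.
move=> ij; rewrite /pfb_act quot_liftE; last exact: pfb_act_rel.
exact: (free_lift_rgen (fun i j => pfb_pi (rgen (s i) (s j)))).
Qed.

Lemma homog_rgen i j : homog 1 (rgen i j).
Proof.
rewrite /rgen /homog /=; case: insubP => [p _ _|_] w.
  by rewrite msuppU oner_eq0 inE => /eqP ->.
by rewrite msupp0 inE.
Qed.

Fact pfb_dual_act_rel (s : 'S_n) x : pfb_dual_rel rgen (homog 1) x ->
  free_lift (fun p : ord_pair => pfb_dual_pi (rgen (s (val p).1) (s (val p).2))) x = 0.
Proof.
set f := free_lift _ => xR.
suff rel0 y : pfb_dual_rel (fun i j => pfb_dual_pi (rgen (s i) (s j)))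
    [set pfb_dual_pi v | v in homog 1] y -> y = 0.
  apply/rel0/(pfb_dual_rel_morph _ _ xR) => [i j ij|v hv].
    exact: (free_lift_rgen (fun i j => pfb_dual_pi (rgen (s i) (s j)))).
  apply: (homog_free_lift (f := pfb_dual_pi)) hv => p.
  by exists (rgen (s (val p).1) (s (val p).2)); first exact: homog_rgen.
apply: (pfb_dual_rel_perm (r := fun i j => pfb_dual_pi (rgen i j))) => [z|i j _|_ _ [u hu <-] [v hv <-]].
- by move=> /pfb_dual_rel_lift[{}z zR ->]; exact: quot_pi_rel.
- by exists (rgen i j); first exact: homog_rgen.
- by exists (u + v); [exact: homogD hu hv|exact: (raddfD pfb_dual_pi)].
Qed.

Lemma pfb_dual_act_morphism (s : 'S_n) :
  [/\ zmod_morphism (pfb_dual_act s), monoid_morphism (pfb_dual_act s)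
    & scalable (pfb_dual_act s)].
Proof. by apply: quot_lift_morphism => x; exact: pfb_dual_act_rel. Qed.

Lemma pfb_dual_act_rgen (s : 'S_n) i j : i != j ->
  pfb_dual_act s (pfb_dual_pi (rgen i j)) = pfb_dual_pi (rgen (s i) (s j)).
Proof.
move=> ij; rewrite /pfb_dual_act quot_liftE; last exact: pfb_dual_act_rel.
exact: (free_lift_rgen (fun i j => pfb_dual_pi (rgen (s i) (s j)))).
Qed.

(* The coefficient of degree k is the trace of s on the degree k component. *)
Definition pfb_char (s : 'S_n) (k : nat) : rat :=
  trace_on (pfb_component k) (pfb_act s).
Definition pfb_dual_char (s : 'S_n) (k : nat) : rat :=
  trace_on (pfb_dual_component k) (pfb_dual_act s).

Lemma pfb_charP (s : 'S_n) k :
  is_trace_on (pfb_component k) (pfb_act s) (pfb_char s k).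
Proof.
have [d [e [eU espan]]] := homog_fin_span pfb_pi k.
apply: (trace_onP eU espan) => _ [v hv <-].
rewrite /pfb_act quot_liftE; last exact: pfb_act_rel.
apply: (homog_free_lift (f := pfb_pi)) hv => p.
by exists (rgen (s (val p).1) (s (val p).2)); first exact: homog_rgen.
Qed.

Lemma pfb_dual_charP (s : 'S_n) k :
  is_trace_on (pfb_dual_component k) (pfb_dual_act s) (pfb_dual_char s k).
Proof.
have [d [e [eU espan]]] := homog_fin_span pfb_dual_pi k.
apply: (trace_onP eU espan) => _ [v hv <-].
rewrite /pfb_dual_act quot_liftE; last exact: pfb_dual_act_rel.
apply: (homog_free_lift (f := pfb_dual_pi)) hv => p.
by exists (rgen (s (val p).1) (s (val p).2)); first exact: homog_rgen.
Qed.

End FlatBraidAlgebras.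

(* Main.v *)
(* The dual algebra has a basis of monomials indexed by star forests, that is,
   by the cliques of a compatibility relation on the edges, and straightening a
   product of two basis monomials yields a basis monomial of larger weight, or
   0, unless the union of the two forests is again a star forest.  Hence the
   cobar complex of the dual is filtered with associated graded the cobar
   complex of a flag complex (a signed Stanley-Reisner exterior algebra), which
   has no cohomology off the diagonal by induction on vertices.  The diagonal
   cohomology in degree k is the degree k component of pfb, so the trace of a
   permutation there is its supertrace on the cochains of internal degree k.
   This supertrace is a sum over words in basis monomials, a geometric series
   which inverts the sign-twisted character of the dual. *)
Require Import Defs.
From HB Require Import structures.
From mathcomp Require Import finmap boolp classical_sets monalg.
From mathcomp Require Import all_boot all_order all_algebra perm.
From mathcomp Require Import ring zify.

Set Implicit Arguments.
Unset Strict Implicit.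
Unset Printing Implicit Defensive.

Import GRing.Theory.

Local Open Scope ring_scope.

(** * Cobar complexes *)

(** Every product of generators of the dual is 0 or, up to sign, a single star monomial, so
    permutations act on this basis monomially up to sign. Independence of the star monomials is not
    derived from confluence of the rewriting but from explicit functionals: one determinant per star
    forest, which together form a dual basis. In degree two, the coboundary of a forest with two
    edges is a nonzero multiple of a defining relation of [pfb]: two edges at a common vertex give
    the triple relation, two disjoint edges the commutator. This identifies a component of [pfb]
    with the words of single edges modulo coboundaries. Cochains carry the contragredient action, so
    the supertrace that computes the character of a permutation on [pfb] involves its inverse on the
    dual; the inverse disappears because a monomial matrix with entries 1 and -1 has the same
    diagonal as its inverse. Koszulness enters as acyclicity off the diagonal, which is proved here
    rather than assumed. *)

Section Cobar.
Context (K : comNzRingType) (L : finType).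
Implicit Types (c : L -> L -> L -> K) (f g : seq L -> K) (w : seq L).

(* L indexes a basis of the augmentation ideal of an algebra, c x y z is the
   coefficient of z in the product x * y, and a cochain is a function on words
   in L. *)
Fixpoint cobar c f w : K :=
  if w is x :: ((y :: w') as w1) then
    \sum_z c x y z * f (z :: w') - cobar c (fun v => f (x :: v)) w1
  else 0.

Lemma cobar_cons c f x y w :
  cobar c f (x :: y :: w) =
    \sum_z c x y z * f (z :: w) - cobar c (fun v => f (x :: v)) (y :: w).
Proof. by []. Qed.

(** The value at [w] involves only the words got from [w] by merging two adjacent letters.
    Congruence, vanishing and degree arguments for the differential all reduce to this locality. *)
Lemma cobar_eq_supp c c' f f' w :
  (forall u x y v z, w = u ++ x :: y :: v ->
     c x y z * f (u ++ z :: v) = c' x y z * f' (u ++ z :: v)) ->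
  cobar c f w = cobar c' f' w.
Proof.
elim: w f f' => [|x [|y w] IH] f f' h //.
rewrite !cobar_cons (IH _ (fun v => f' (x :: v))) => [|u x' y' v z' e].
  by congr (_ - _); apply: eq_bigr => z _; apply: (h [::]).
by apply: (h (x :: u)); rewrite e.
Qed.

Lemma eq_cobar c f g w : f =1 g -> cobar c f w = cobar c g w.
Proof. by move=> fg; apply: cobar_eq_supp => *; rewrite fg. Qed.

Lemma cobarD c f g w :
  cobar c (fun v => f v + g v) w = cobar c f w + cobar c g w.
Proof.
elim: w f g => [|x [|y w] IH] f g; rewrite ?cobar_cons ?addr0 //.
rewrite IH opprD addrACA -big_split /=.
by under eq_bigr do rewrite mulrDr.
Qed.

Lemma cobarZ c a f w : cobar c (fun v => a * f v) w = a * cobar c f w.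
Proof.
elim: w f => [|x [|y w] IH] f; rewrite ?cobar_cons ?mulr0 //.
rewrite IH mulrBr mulr_sumr.
by under eq_bigr do rewrite mulrCA.
Qed.

Lemma cobarB c f g w :
  cobar c (fun v => f v - g v) w = cobar c f w - cobar c g w.
Proof.
by rewrite -mulN1r -cobarZ -cobarD; apply: eq_cobar => v; rewrite mulN1r.
Qed.

Lemma cobar0 c w : cobar c (fun=> 0) w = 0.
Proof.
by rewrite -[RHS](mul0r (cobar c (fun=> 0) w)) -cobarZ; apply: eq_cobar => v; rewrite mul0r.
Qed.

Lemma cobar_sum (I : Type) (s : seq I) c (F : I -> seq L -> K) w :
  cobar c (fun v => \sum_(i <- s) F i v) w = \sum_(i <- s) cobar c (F i) w.
Proof.
elim: s => [|i s IH].
  by rewrite big_nil -[RHS](cobar0 c w); apply: eq_cobar => v; rewrite big_nil.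
by rewrite big_cons -IH -cobarD; apply: eq_cobar => v; rewrite big_cons.
Qed.

Lemma cobar_eq0 c f w :
  (forall u x y v z, w = u ++ x :: y :: v -> c x y z * f (u ++ z :: v) = 0) ->
  cobar c f w = 0.
Proof.
move=> h; rewrite -[RHS](cobar0 c w).
by apply: cobar_eq_supp => *; rewrite mulr0 h.
Qed.

(** Merging two disjoint pairs in either order gives opposite signs, and merging three consecutive
    letters cancels by associativity. Associativity is asked on [P] only: all sets of edges will be
    letters, but the good ones alone index a basis. *)
Lemma cobar_cobar (P : pred L) c f w :
  (forall x y z t, P x -> P y -> P z ->
     \sum_s c x y s * c s z t = \sum_s c y z s * c x s t) ->
  all P w -> cobar c (cobar c f) w = 0.
Proof.
move=> cA; elim: w f => [|x [|y [|z w]] IH] f //.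
  by move=> _; rewrite cobar_cons subr0 big1 // => t _; rewrite mulr0.
move=> /and4P[Px Py Pz Pw].
(* [m] merges the fixed first letter [x] with the next one; the rest of the differential of [f] at
   [x :: v] is the differential of [f (x :: _)], left to the induction. *)
pose m v := if v is y' :: v' then \sum_t c x y' t * f (t :: v') else 0.
rewrite cobar_cons.
have -> : cobar c (fun v => cobar c f (x :: v)) [:: y, z & w]
  = cobar c m [:: y, z & w].
  have IH0 : cobar c (cobar c (fun v => f (x :: v))) [:: y, z & w] = 0.
    by apply: IH; rewrite /= Py Pz.
  rewrite -[RHS]subr0 -IH0 -cobarB.
  by apply: eq_cobar => -[|y' v'] //=; rewrite subr0.
rewrite cobar_cons.
under eq_bigr do rewrite cobar_cons mulrBr.
rewrite sumrB opprB.
have -> : cobar c (fun v => m (y :: v)) (z :: w) =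
    \sum_t c x y t * cobar c (fun v => f (t :: v)) (z :: w).
  by rewrite /m cobar_sum; under eq_bigr do rewrite cobarZ.
rewrite addrA subrK; apply/eqP; rewrite subr_eq0; apply/eqP.
have -> : \sum_t c y z t * m (t :: w) = \sum_s (\sum_t c y z t * c x t s) * f (s :: w).
  rewrite /m /=; under eq_bigr do rewrite mulr_sumr.
  rewrite exchange_big; apply: eq_bigr => s _; rewrite mulr_suml.
  by apply: eq_bigr => t _; rewrite mulrA.
under [RHS]eq_bigr do rewrite -cA //.
under [LHS]eq_bigr do rewrite mulr_sumr.
rewrite exchange_big; apply: eq_bigr => s _; rewrite mulr_suml.
by apply: eq_bigr => t _; rewrite mulrA.
Qed.

(* The contragredient action on cochains of the endomorphism of the algebra
   with structure constants c and matrix q. *)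
Fixpoint cobar_act (q : L -> L -> K) f w : K :=
  if w is y :: w' then \sum_x q x y * cobar_act q (fun v => f (x :: v)) w'
  else f [::].

Lemma cobar_act_cons q f y w :
  cobar_act q f (y :: w) = \sum_x q x y * cobar_act q (fun v => f (x :: v)) w.
Proof. by []. Qed.

Lemma eq_cobar_act q f g w : f =1 g -> cobar_act q f w = cobar_act q g w.
Proof.
elim: w f g => [|y w IH] f g fg; first exact: fg.
by rewrite /=; apply: eq_bigr => x _; rewrite (IH _ (fun v => g (x :: v))).
Qed.

Lemma cobar_actD q f g w :
  cobar_act q (fun v => f v + g v) w = cobar_act q f w + cobar_act q g w.
Proof.
elim: w f g => [|x w IH] f g //=.
by rewrite -big_split; apply: eq_bigr => y _; rewrite IH mulrDr.
Qed.

Lemma cobar_actZ q a f w : cobar_act q (fun v => a * f v) w = a * cobar_act q f w.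
Proof.
elim: w f => [|x w IH] f //=.
by rewrite mulr_sumr; apply: eq_bigr => y _; rewrite IH mulrCA.
Qed.

Lemma cobar_act0 q w : cobar_act q (fun=> 0) w = 0.
Proof.
by rewrite -[RHS](mul0r (cobar_act q (fun=> 0) w)) -cobar_actZ; apply: eq_cobar_act => v; rewrite mul0r.
Qed.

Lemma cobar_act_sum (I : Type) (s : seq I) q (F : I -> seq L -> K) w :
  cobar_act q (fun v => \sum_(i <- s) F i v) w = \sum_(i <- s) cobar_act q (F i) w.
Proof.
elim: s => [|i s IH].
  by rewrite big_nil -[RHS](cobar_act0 q w); apply: eq_cobar_act => v; rewrite big_nil.
by rewrite big_cons -IH -cobar_actD; apply: eq_cobar_act => v; rewrite big_cons.
Qed.

Lemma cobar_act_eq_supp q f g w :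
  (forall v, all2 (fun x y => q x y != 0) v w -> f v = g v) ->
  cobar_act q f w = cobar_act q g w.
Proof.
elim: w f g => [|y w IH] f g fg; first exact: fg.
rewrite !cobar_act_cons; apply: eq_bigr => x _.
have [->|qn] := eqVneq (q x y) 0; first by rewrite !mul0r.
by congr (_ * _); apply: IH => v vw; apply: fg; rewrite /= qn.
Qed.

(** [cq] is multiplicativity of the endomorphism in coordinates, [q t z] being the coefficient of
    [t] in the image of [z]. *)
Lemma cobar_act_cobar (P : pred L) (q : L -> L -> K) c f w :
  (forall x y t, P x -> P y ->
    \sum_z c x y z * q t z = \sum_a \sum_b q a x * q b y * c a b t) ->
  all P w ->
  cobar c (cobar_act q f) w = cobar_act q (cobar c f) w.
Proof.
move=> cq; elim: w f => [|x [|y w] IH] f //.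
  by rewrite /= big1 // => z _; rewrite mulr0.
move=> /and3P[Px Py Pw]; rewrite cobar_cons.
have IH' g : cobar c (cobar_act q g) (y :: w) = cobar_act q (cobar c g) (y :: w).
  by apply: IH; rewrite /= Py.
have -> : cobar c (fun v => cobar_act q f (x :: v)) (y :: w) =
   \sum_a q a x * cobar_act q (cobar c (fun v => f (a :: v))) (y :: w).
  rewrite (eq_cobar c (g := fun v => \sum_a q a x * cobar_act q (fun u => f (a :: u)) v)) //.
  by rewrite cobar_sum; apply: eq_bigr => a _; rewrite cobarZ IH'.
have -> : cobar_act q (cobar c f) [:: x, y & w] =
   \sum_a q a x * \sum_b q b y * (\sum_z c a b z * cobar_act q (fun v => f (z :: v)) w
     - cobar_act q (fun v => cobar c (fun v => f (a :: v)) (b :: v)) w).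
  rewrite !cobar_act_cons; apply: eq_bigr => a _; congr (_ * _).
  rewrite cobar_act_cons; apply: eq_bigr => b _; congr (_ * _).
  under eq_cobar_act do rewrite cobar_cons -mulN1r.
  rewrite cobar_actD cobar_actZ cobar_act_sum mulN1r.
  by under eq_bigr do rewrite cobar_actZ.
under [RHS]eq_bigr => a _ do
  (under eq_bigr do rewrite mulrBr; rewrite sumrB mulrBr).
rewrite sumrB; congr (_ - _).
transitivity (\sum_z \sum_t (c x y z * q t z) * cobar_act q (fun v => f (t :: v)) w).
  apply: eq_bigr => z _ /=; rewrite mulr_sumr; apply: eq_bigr => t _.
  by rewrite mulrA.
rewrite exchange_big /=.
under eq_bigr do rewrite -mulr_suml cq // mulr_suml.
rewrite exchange_big /=; apply: eq_bigr => a _.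
under eq_bigr do rewrite mulr_suml.
rewrite exchange_big mulr_sumr /=; apply: eq_bigr => b _.
by rewrite !mulr_sumr; apply: eq_bigr => t _; rewrite !mulrA.
Qed.

End Cobar.

(** * Acyclicity off the diagonal for a flag complex and for its deformations *)

Section FlagComplex.
Context (K : fieldType) (E : finType) (r : rel E).
Implicit Types (A S T U : {set E}) (w v : seq {set E}) (f g : seq {set E} -> K).

(** The case [x = y] is included: an element not related to itself is not a vertex. *)
Definition clique S := [forall x in S, forall y in S, r x y].
Definition nclique S := clique S && (S != set0).
Definition rk w := sumn [seq #|X| | X : {set E} <- w].

Lemma cliqueP S : reflect {in S &, forall x y, r x y} (clique S).
Proof.
apply: (iffP forall_inP) => [h x y xS yS|h x xS].
  by have /forall_inP := h x xS; apply.
by apply/forall_inP => y yS; apply: h.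
Qed.

Lemma clique_sub S T : S \subset T -> clique T -> clique S.
Proof. by move=> /subsetP ST /cliqueP h; apply/cliqueP => x y /ST xT /ST; apply: h. Qed.

Lemma clique0 : clique set0.
Proof. by apply/cliqueP => x y; rewrite inE. Qed.

Lemma cliqueU1 a S :
  clique (a |: S) = [&& r a a, clique S & [forall x in S, r a x && r x a]].
Proof.
apply/idP/idP => [h|/and3P[raa cS /forall_inP h]].
  rewrite (clique_sub _ h) ?subsetUr //=; move/cliqueP: h => h.
  rewrite h ?inE ?eqxx //=; apply/forall_inP => x xS.
  by rewrite !h ?inE ?eqxx ?xS ?orbT.
apply/cliqueP => x y; rewrite !inE => /orP[/eqP->|xS] /orP[/eqP->|yS] //.
- by have /andP[] := h _ yS.
- by have /andP[] := h _ xS.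
- exact: (cliqueP _ cS).
Qed.

Context (eps : {set E} -> {set E} -> K).
Hypothesis eps0 : forall T, clique T -> eps set0 T = 1.
Hypothesis eps_neq0 : forall S T, clique (S :|: T) -> [disjoint S & T] -> eps S T != 0.
Hypothesis epsA : forall S T U, clique (S :|: T :|: U) ->
  [disjoint S & T] -> [disjoint S :|: T & U] ->
  eps S T * eps (S :|: T) U = eps T U * eps S (T :|: U).

Lemma disjoint_set0 S : [disjoint set0 & S].
Proof. by rewrite -setI_eq0 set0I. Qed.

(** Structure constants of the exterior Stanley-Reisner algebra of the flag complex, with the signs
    abstracted to a cocycle [eps]. *)
Definition flag_coef S T U : K :=
  if [&& U == S :|: T, [disjoint S & T] & clique U] then eps S T else 0.

Lemma flag_coef_sum S T (F : {set E} -> K) :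
  \sum_U flag_coef S T U * F U =
  if [disjoint S & T] && clique (S :|: T) then eps S T * F (S :|: T) else 0.
Proof.
rewrite (bigD1 (S :|: T)) //= /flag_coef eqxx /= big1 ?addr0.
  by case: ifP => //; rewrite mul0r.
by move=> U /negPf ->; rewrite mul0r.
Qed.

Lemma flag_coef_neq0 S T U : flag_coef S T U != 0 ->
  [/\ U = S :|: T, [disjoint S & T] & clique U].
Proof. by rewrite /flag_coef; case: ifP => [/and3P[/eqP]//|_]; rewrite eqxx. Qed.

Lemma flag_coefA S T U V :
  \sum_X flag_coef S T X * flag_coef X U V = \sum_X flag_coef T U X * flag_coef S X V.
Proof.
rewrite !flag_coef_sum /flag_coef setUA.
have [->|nV] := eqVneq V (S :|: T :|: U); last by rewrite !mulr0 !if_same.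
have [cV|ncV] := boolP (clique (S :|: T :|: U)); last by rewrite !andbF !mulr0 !if_same.
rewrite (clique_sub _ cV) ?subsetUl // (clique_sub _ cV) -?setUA ?subsetUr //=.
rewrite !andbT -!setI_eq0 setIUl setIUr !setU_eq0.
case ST: (S :&: T == set0); case TU: (T :&: U == set0); case SU: (S :&: U == set0);
  rewrite ?mulr0 //=.
by rewrite epsA // -setI_eq0 ?ST // setIUl setU_eq0 SU TU.
Qed.

(* Words whose first letter may be empty carry the coefficients of the module
   acted on by the algebra; the induction on vertices needs them. *)
Definition nice w := if w is X :: v then clique X && all nclique v else true.

Local Notation d0 := (cobar flag_coef).

Lemma d0_cons f S T w : d0 f (S :: T :: w) =
  (if [disjoint S & T] && clique (S :|: T) then eps S T * f ((S :|: T) :: w) else 0)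
  - d0 (fun v => f (S :: v)) (T :: w).
Proof. by rewrite cobar_cons flag_coef_sum. Qed.

Lemma rk_merge u S T v : [disjoint S & T] -> rk (u ++ S :|: T :: v) = rk (u ++ S :: T :: v).
Proof.
move=> ST; rewrite /rk !map_cat !sumn_cat /= cardsU disjoint_setI0 // cards0 subn0.
by rewrite !addnA.
Qed.

(** Cochains for the module with basis the cliques that avoid [A], in total degree [k]. The tail [v]
    carries the cohomological degree, and [m] measures the distance kept from the diagonal
    [size v = k]; each differential uses up one unit. *)
Definition supp_flag A k m f := forall S v, nice (S :: v) -> f (S :: v) != 0 ->
  [/\ [disjoint S & A], rk (S :: v) = k & (size v + m < k)%N].

Lemma supp_flag_d0 A k m f : supp_flag A k m.+1 f -> supp_flag A k m (d0 f).
Proof.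
move=> fs S w nw dn.
suff /and3P[? /eqP ? ?] : [&& [disjoint S & A], rk (S :: w) == k & (size w + m < k)%N].
  by [].
move: dn; apply: contraNT => h; apply/eqP.
apply: cobar_eq0 => u S' T v U e.
have [->|/flag_coef_neq0[eU S'T cU]] := eqVneq (flag_coef S' T U) 0.
  by rewrite mul0r.
apply/eqP; apply: contraNT h; rewrite mulf_eq0 negb_or => /andP[_].
case: u e => [|X u] e fn.
  case: e nw => -> -> /= /and3P[_ _ gv].
  have [|SA <- sv] := fs _ _ _ fn; first by rewrite /= cU.
  rewrite addSnnS sv andbT eU (rk_merge [::]) // eqxx andbT.
  by apply: disjointWl SA; rewrite eU subsetUl.
case: e nw => -> -> /andP[cX]; rewrite all_cat /= => /and4P[gu _ gT gv].
have gU : nclique U.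
  rewrite /nclique cU eU setU_eq0; case/andP: gT => _ /negPf ->.
  by rewrite andbF.
have [|-> <- sv] := fs _ _ _ fn; first by rewrite /= cX all_cat gu /= gU.
rewrite eU -(rk_merge (X :: u)) // eqxx -eU /=.
by move: sv; rewrite !size_cat /= !addnS addSn.
Qed.

(* If a vertex a is added to the vertices A avoided by the first letters, a
   primitive y exists for the smaller set.  Its values at first letters that
   contain a form a cocycle of degree one less on the link of a; subtracting the
   coboundary of z, built from a primitive z' of it, makes y vanish there. *)
Lemma flag_exact k A f :
  supp_flag A k 0 f -> (forall w, nice w -> d0 f w = 0) ->
  exists2 g, supp_flag A k 1 g &
    forall S w, nice (S :: w) -> d0 g (S :: w) = f (S :: w).
Proof.
elim: k A f => [|k IHk] A.
  move=> f fs _; exists (fun=> 0) => [S v _|S v nw]; first by rewrite eqxx.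
  rewrite cobar0; apply/esym/eqP; apply: contraT => /(fs _ _ nw)[_ _].
  by rewrite ltn0.
(* Passing to the link of a vertex lowers [k] but enlarges the set to avoid, hence an induction on
   the size of [A] nested in the one on [k]. *)
move mE : #|A| => m; elim: m A mE => [|m IHm] A mE f fs df.
  move/eqP: mE; rewrite cards_eq0 => /eqP A0.
  (* With nothing to avoid the module is free of rank one, and inserting an empty first letter
     contracts the complex. *)
  pose g w := if w is X :: v then if X == set0 then 0 else f (set0 :: w) else 0.
  have gE X v : X != set0 -> g (X :: v) = f [:: set0, X & v].
    by move=> /negPf X0; rewrite /g X0.
  exists g => [S v nw|S w nw].
    rewrite {1}/g; have [S0|S0] := eqVneq S set0; first by rewrite eqxx.
    move=> fn; have nw' : nice [:: set0, S & v].
      by move: nw => /= /andP[cS ->]; rewrite /nclique clique0 cS S0.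
    have [_] := fs _ _ nw' fn; rewrite /rk /= cards0 add0n addn0 addn1 => -> sv.
    by rewrite A0 disjoint_sym disjoint_set0.
  have [S0|S0] := eqVneq S set0.
    rewrite {S}S0 in nw *; case: w nw => [|T w] nw.
      apply/esym/eqP; apply: contraT => /(fs _ _ nw)[_].
      by rewrite /rk /= cards0.
    have e0 : d0 (fun v => g (set0 :: v)) (T :: w) = 0.
      by apply: cobar_eq0 => *; rewrite /g eqxx mulr0.
    have /and3P[_ /andP[cT T0] _] := nw; rewrite d0_cons e0 subr0.
    by rewrite disjoint_set0 set0U cT eps0 // mul1r gE.
  have nw' : nice [:: set0, S & w].
    by move: nw => /= /andP[cS ->]; rewrite /nclique clique0 cS S0.
  have := df _ nw'; have /andP[cS gw] := nw.
  rewrite d0_cons disjoint_set0 set0U cS eps0 // mul1r.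
  move/eqP; rewrite subr_eq0 => /eqP ->.
  apply: cobar_eq_supp => -[|X u] T T' v U [e1 e2].
    have [->|/flag_coef_neq0[eU _ _]] := eqVneq (flag_coef T T' U) 0.
      by rewrite !mul0r.
    by rewrite !cat0s gE // eU -e1 setU_eq0 (negPf S0).
  by rewrite -e1 !cat_cons gE.
have [a aA] : exists a, a \in A.
  by apply/set0Pn; rewrite -cards_eq0 mE.
have mE' : #|A :\ a| = m.
  by move: mE; rewrite (cardsD1 a) aA => -[].
have fs' : supp_flag (A :\ a) k.+1 0 f.
  move=> S v nw /(fs _ _ nw)[SA -> ->]; split=> //.
  exact: disjointWr (subsetDl _ _) SA.
have [y ys dy] := IHm _ mE' _ fs' df.
(* If [a] is not a vertex, no clique contains it and avoiding it is automatic. *)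
have [raa|nraa] := boolP (r a a); last first.
  exists y => // S v nw /(ys _ _ nw)[SA -> ->]; split=> //.
  move: SA; rewrite -!setI_eq0; have aS : a \notin S.
    apply: contra nraa => aS; case/andP: nw => /cliqueP h _; exact: h.
  move/eqP/setP => h; apply/eqP/setP => x; rewrite !inE; have := h x.
  by rewrite !inE; case: eqVneq => [->|//]; rewrite (negPf aS).
(* A clique [X] avoids [A'] exactly when [a] can be added to it as a new vertex and [a |: X] is a
   clique that avoids the rest of [A]: these are the first letters on the link of [a]. *)
pose A' := a |: A :|: [set x | ~~ (r a x && r x a)].
have A'P X : clique X -> [disjoint X & A'] =
    [&& clique (a |: X), a \notin X & [disjoint a |: X & A :\ a]].
  move=> cX; rewrite cliqueU1 raa cX /=; apply/idP/and3P.
    rewrite -setI_eq0 !setIUr !setU_eq0 => /andP[/andP[h1 h2] h3]; split.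
    - apply/forall_inP => x xX.
      by move/eqP/setP: h3 => /(_ x); rewrite !inE xX /= => /negbFE.
    - by move/eqP/setP: h1 => /(_ a); rewrite !inE eqxx andbT => ->.
    - rewrite -setI_eq0; apply/eqP/setP => x; rewrite !inE.
      by case: eqVneq => //= _; move/eqP/setP: h2 => /(_ x); rewrite !inE.
  move=> [/forall_inP h1 h2 h3]; rewrite -setI_eq0; apply/eqP/setP => x.
  rewrite !inE; case xX: (x \in X) => //=; rewrite (h1 _ xX) orbF.
  have xa : x != a by apply: contraNneq h2 => <-.
  rewrite (negPf xa) /=; apply/negP => xA; move: h3; rewrite -setI_eq0.
  by move=> /eqP/setP/(_ x); rewrite !inE xX xa xA orbT.
pose y' w := if w is X :: v then
   if [disjoint X & A'] then eps [set a] X * y ((a |: X) :: v) else 0 else 0.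
have y'E (X : {set E}) v : [disjoint X & A'] -> y' (X :: v) = eps [set a] X * y ((a |: X) :: v).
  by move=> XA; rewrite /y' XA.
have y'0 (X : {set E}) v : ~~ [disjoint X & A'] -> y' (X :: v) = 0 by move=> /negPf XA; rewrite /y' XA.
have aX (X : {set E}) : a \notin X -> [disjoint [set a] & X].
  by move=> aX; rewrite disjoints1.
have [||z' zs' dz'] := IHk A' y'.
- move=> S v nw; have [SA|nSA] := boolP [disjoint S & A']; last first.
    by rewrite y'0 ?eqxx.
  rewrite y'E // mulf_eq0 negb_or => /andP[_ yn].
  have [cS gv] := andP nw; have := SA; rewrite A'P // => /and3P[caS aS SA'].
  have [|_] := ys _ _ _ yn; first by rewrite /= caS.
  rewrite /rk /= cardsU1 aS add1n addSn => -[->].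
  by rewrite addn1 addn0 ltnS.
- case=> [|S [|T w]] nw //.
  have /and3P[cS gT gw] := nw.
  have [SA|nSA] := boolP [disjoint S & A']; last first.
    apply: cobar_eq0 => -[|X u] S' T' v U [e1 e2].
      have [->|/flag_coef_neq0[eU _ _]] := eqVneq (flag_coef S' T' U) 0.
        by rewrite !mul0r.
      rewrite cat0s y'0 ?mulr0 // eU -e1; apply: contra nSA.
      by apply: disjointWl; rewrite subsetUl.
    by rewrite -e1 cat_cons y'0 ?mulr0.
  have := SA; rewrite A'P // => /and3P[caS aS SA'].
  (* The cocycle condition for [y']: [f] avoids [a], so the coboundary of [y] vanishes at the first
     letter [a |: S], and [epsA] transports this equation to the link. *)
  have : d0 y [:: a |: S, T & w] = 0.
    rewrite dy; last by rewrite /= caS gT.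
    apply/eqP; apply: contraT => fn.
    have [|] := fs (a |: S) (T :: w) _ fn; first by rewrite /= caS gT.
    by move=> /disjointFr/(_ (setU11 _ _)); rewrite aA.
  rewrite !d0_cons => /eqP; rewrite subr_eq0 => /eqP e.
  rewrite (eq_cobar _ (g := fun v => eps [set a] S * y ((a |: S) :: v))); last first.
    by move=> v; rewrite y'E.
  rewrite cobarZ -e; apply/eqP; rewrite subr_eq0; apply/eqP.
  have [/andP[ST cST]|nST] := ifP; last first.
    have [/andP[ST cST]|_] := ifP; last by rewrite mulr0.
    move: nST; rewrite (disjointWl _ ST) ?subsetUr // (clique_sub _ cST) //.
    by rewrite -setUA subsetUr.
  have [STA|nSTA] := boolP [disjoint S :|: T & A']; last first.
    rewrite y'0 // mulr0; have [/andP[aST acST]|_] := ifP; last by rewrite mulr0.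
    apply/esym/eqP; apply: contraT; rewrite !mulf_eq0 !negb_or => /and3P[_ _ yn].
    case/negP: nSTA; rewrite A'P // !setUA acST /= inE negb_or aS /=.
    rewrite (disjointFr aST) ?setU11 //=.
    by have [|] := ys _ _ _ yn; first by rewrite /= acST.
  have := STA; rewrite A'P // => /and3P[acST aST aSTA].
  rewrite y'E // setUA in acST *; rewrite acST andbT.
  have aST' : [disjoint a |: S & T].
    by rewrite -setI_eq0 setIUl setU_eq0 !setI_eq0 ST aX //; move: aST; rewrite inE negb_or => /andP[].
  by rewrite aST' !mulrA epsA // aX.
pose z w := if w is X :: v then
   if a \in X then (eps [set a] (X :\ a))^-1 * z' ((X :\ a) :: v) else 0 else 0.
have zE (X : {set E}) v : a \in X -> z (X :: v) = (eps [set a] (X :\ a))^-1 * z' ((X :\ a) :: v).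
  by move=> aX0; rewrite /z aX0.
have zs : supp_flag (A :\ a) k.+1 2 z.
  move=> S v /andP[cS gv]; rewrite /z; case: ifP => [aS|_]; last by rewrite eqxx.
  rewrite mulf_eq0 negb_or => /andP[_ zn].
  have cS' : clique (S :\ a) by apply: clique_sub cS; exact: subsetDl.
  have [|SA rS sv] := zs' _ _ _ zn; first by rewrite /= cS'.
  move: SA; rewrite A'P // => /and3P[_ _]; rewrite setD1K // => ->; split=> //.
  - by move: rS; rewrite /rk /= (cardsD1 a S) aS add1n addSn => ->.
  - by rewrite addnS ltnS.
have dzE S v : a \in S -> nice (S :: v) -> d0 z (S :: v) = y (S :: v).
  move=> aS /andP[cS gv]; pose S0 := S :\ a.
  have eS : S = a |: S0 by rewrite setD1K.
  have cS0 : clique S0 by apply: clique_sub cS; exact: subsetDl.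
  have nS0 : nice (S0 :: v) by rewrite /= cS0.
  have aS0 : a \notin S0 by rewrite !inE eqxx.
  have en : eps [set a] S0 != 0 by rewrite eps_neq0 ?aX // -eS.
  suff -> : d0 z (S :: v) = (eps [set a] S0)^-1 * d0 z' (S0 :: v).
    rewrite dz' //; have [SA|nSA] := boolP [disjoint S0 & A'].
      by rewrite y'E // mulKf // -eS.
    rewrite y'0 // mulr0; apply/esym/eqP; apply: contraNT nSA => yn.
    rewrite A'P // -eS cS aS0 /=.
    by have [|] := ys _ _ _ yn; first by rewrite /= cS.
  case: v gv nS0 => [|T w] gv nS0; first by rewrite /= mulr0.
  have /andP[gT gw] := gv.
  rewrite !d0_cons mulrBr; congr (_ - _); last first.
    by rewrite -cobarZ; apply: eq_cobar => u; rewrite zE.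
  have [/andP[ST cST]|nST] := ifP.
    have aT : a \notin T by rewrite (disjointFr ST).
    have ST0 : [disjoint S0 & T] by apply: disjointWl ST; exact: subsetDl.
    have cST0 : clique (S0 :|: T).
      by apply: clique_sub cST; apply: setSU; exact: subsetDl.
    rewrite ST0 cST0 zE ?inE ?aS //.
    have -> : (S :|: T) :\ a = S0 :|: T.
      by rewrite setDUl; congr (_ :|: _); apply/setDidPl; rewrite disjoint_sym aX.
    have en' : eps [set a] (S0 :|: T) != 0.
      by rewrite eps_neq0 ?setUA -?eS // aX // inE negb_or aS0.
    have := epsA (S := [set a]) (T := S0) (U := T); rewrite -eS aX // => /(_ cST isT ST) ee.
    by rewrite !mulrA; congr (_ * _); apply: (mulfI en); rewrite mulrA ee mulfK // mulVKf.
  have [/andP[ST0 cST0]|_] := ifP; last by rewrite mulr0.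
  apply/esym/eqP; apply: contraFT nST; rewrite !mulf_eq0 !negb_or => /and3P[_ _ zn].
  have [|SA _ _] := zs' _ _ _ zn; first by rewrite /= cST0.
  move: SA; rewrite A'P // setUA -eS => /and3P[-> + _].
  by rewrite inE negb_or eS andbT -setI_eq0 setIUl setU_eq0 !setI_eq0 ST0 => /andP[_ /aX ->].
exists (fun v => y v - d0 z v) => [S v nw|S w nw]; last first.
  rewrite cobarB (@cobar_cobar _ _ predT) ?all_predT ?subr0 ?dy //.
  by move=> *; exact: flag_coefA.
case aS: (a \in S); first by rewrite dzE // subrr eqxx.
move=> yn; suff [SA -> sv] : [/\ [disjoint S & A :\ a], rk (S :: v) = k.+1 & (size v + 1 < k.+1)%N].
  split=> //; move: SA; rewrite -!setI_eq0 => /eqP/setP h; apply/eqP/setP => x.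
  by have := h x; rewrite !inE; case: eqVneq => [->|//]; rewrite aS.
have [y0|yn0] := eqVneq (y (S :: v)) 0; last exact: ys.
by move: yn; rewrite y0 sub0r oppr_eq0; exact: supp_flag_d0.
Qed.

Definition supp_good k m f := forall w, all nclique w -> f w != 0 ->
  rk w = k /\ (size w + m < k)%N.

(** Avoiding all vertices leaves only the empty first letter, so trivial coefficients are the case
    [setT] of [flag_exact]. Stepping over the empty letter costs the sign in the primitive. *)
Lemma flag_cobar_exact k f :
  supp_good k 0 f -> (forall w, all nclique w -> d0 f w = 0) ->
  exists2 g, supp_good k 1 g & forall w, all nclique w -> d0 g w = f w.
Proof.
move=> fs df.
pose F w := if w is X :: v then if X == set0 then f v else 0 else 0.
have F0 v : F (set0 :: v) = f v by rewrite /F eqxx.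
have Fn X v : X != set0 -> F (X :: v) = 0 by move=> /negPf X0; rewrite /F X0.
have [||g gs dg] := @flag_exact k setT F.
- move=> S v /andP[cS gv]; have [->|S0] := eqVneq S set0; last by rewrite Fn ?eqxx.
  rewrite F0 => /fs[] // <-; rewrite /rk /= cards0 add0n => sv.
  by rewrite disjoint_set0.
- case=> [|S [|T w]] nw //; have /and3P[cS gT gw] := nw.
  have [S0|S0] := eqVneq S set0; last first.
    apply: cobar_eq0 => -[|X u] S' T' v U [e1 e2].
      have [->|/flag_coef_neq0[eU _ _]] := eqVneq (flag_coef S' T' U) 0.
        by rewrite mul0r.
      by rewrite cat0s Fn ?mulr0 // eU -e1 setU_eq0 (negPf S0).
    by rewrite -e1 cat_cons Fn ?mulr0.
  rewrite d0_cons S0 (eq_cobar _ _ F0) df ?subr0 //; last by rewrite /= gT.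
  by rewrite set0U Fn ?mulr0 ?if_same //; case/andP: gT.
exists (fun v => - g (set0 :: v)) => [w gw|w gw].
  rewrite oppr_eq0 => gn; have [|_ <- sw] := gs _ _ _ gn; first by rewrite /= clique0.
  by move: sw; rewrite /rk /= cards0 add0n; split.
have nw : nice (set0 :: w) by rewrite /= clique0.
rewrite -F0 -dg //.
rewrite (eq_cobar _ (g := fun v => -1 * g (set0 :: v))) => [|v]; last by rewrite mulN1r.
rewrite cobarZ mulN1r; case: w gw nw => [|T w] gw nw; first by rewrite /= oppr0.
rewrite [RHS]d0_cons set0U; have -> : g (T :: w) = 0.
  apply/eqP; apply: contraT => gn; case/andP: (gw) => /andP[cT T0] gw'.
  have [|] := gs _ _ _ gn; first by rewrite /= cT.
  by rewrite -setI_eq0 setIT (negPf T0).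
by rewrite mulr0 if_same sub0r.
Qed.

Context (h : E -> nat) (c : {set E} -> {set E} -> {set E} -> K).
Definition wt S := (\sum_(e in S) h e)%N.
Hypothesis c_flag : forall S T U, nclique S -> nclique T -> c S T U != flag_coef S T U ->
  [/\ nclique U, #|U| = (#|S| + #|T|)%N & (wt S + wt T < wt U)%N].
Hypothesis cA : forall S T U V, nclique S -> nclique T -> nclique U ->
  \sum_X c S T X * c X U V = \sum_X c T U X * c S X V.

Definition wwt w := sumn [seq wt X | X : {set E} <- w].

Lemma wt_disjointU S T : [disjoint S & T] -> wt (S :|: T) = (wt S + wt T)%N.
Proof. by move=> ST; rewrite /wt -bigU //; apply: eq_bigl => x; rewrite !inE. Qed.

Lemma c_graded S T U : nclique S -> nclique T -> c S T U != 0 ->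
  nclique U /\ #|U| = (#|S| + #|T|)%N.
Proof.
move=> gS gT; have [->|/c_flag[]//] := eqVneq (c S T U) (flag_coef S T U).
move=> /flag_coef_neq0[-> ST cU]; rewrite cardsU disjoint_setI0 // cards0 subn0.
split=> //; rewrite /nclique cU setU_eq0; case/andP: gT => _ /negPf->.
by rewrite andbF.
Qed.

(* The weight is bounded in each degree, so the lowest weight part of a cocycle,
   a cocycle of the flag complex, can be removed finitely often. *)
Lemma cobar_exact k f :
  supp_good k 0 f -> (forall w, all nclique w -> cobar c f w = 0) ->
  exists2 g, supp_good k 1 g & forall w, all nclique w -> cobar c g w = f w.
Proof.
move=> fs df.
have [W fW] : exists W, forall w, all nclique w -> (W <= wwt w)%N -> f w = 0.
  pose M := \max_e h e; have wM w : (wwt w <= rk w * M)%N.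
    elim: w => //= S w IHw; rewrite [rk _]/(#|S| + rk w)%N mulnDl leq_add //.
    by rewrite /wt -sum_nat_const leq_sum // => e _; exact: leq_bigmax.
  exists (k * M).+1 => w gw; apply: contraTeq => /(fs _ gw)[<- _].
  by rewrite -leqNgt.
elim: W f fs df fW => [|W IH] f fs df fW.
  exists (fun=> 0) => [w gw|w gw]; first by rewrite eqxx.
  by rewrite cobar0 fW.
have mergeE u S T v : all nclique (u ++ S :: T :: v) ->
    [/\ nclique S, nclique T & forall U, nclique U -> all nclique (u ++ U :: v)].
  rewrite all_cat /= => /and4P[gu -> -> gv]; split=> // U gU.
  by rewrite all_cat /= gu gU.
have c_split F w : cobar c F w = d0 F w + cobar (fun S T U => c S T U - flag_coef S T U) F w.
  elim: w F => [|S [|T w] IHw] F; rewrite ?addr0 //.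
  rewrite !cobar_cons IHw opprD [RHS]addrACA -big_split; congr (_ + _).
  by apply: eq_bigr => U _; rewrite /= -mulrDl addrC subrK.
have low F w : all nclique w -> (forall v, all nclique v -> (wwt w < wwt v)%N -> F v = 0) ->
    cobar (fun S T U => c S T U - flag_coef S T U) F w = 0.
  move=> gw F0; apply: cobar_eq0 => u S T v U e.
  have [gS gT gU] := mergeE u S T v (ltac:(by rewrite -e)).
  have [->|/c_flag[]// {}/gU gU _ wU] := eqVneq (c S T U) (flag_coef S T U).
    by rewrite subrr mul0r.
  rewrite F0 ?mulr0 // e /wwt !map_cat !sumn_cat /= ltn_add2l addnA.
  by rewrite ltn_add2r.
have same F G w : all nclique w -> (forall v, all nclique v -> wwt v = wwt w -> F v = G v) ->
    d0 F w = d0 G w.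
  move=> gw FG; apply: cobar_eq_supp => u S T v U e.
  have [gS gT gU] := mergeE u S T v (ltac:(by rewrite -e)).
  have [->|/flag_coef_neq0[eU ST cU]] := eqVneq (flag_coef S T U) 0.
    by rewrite !mul0r.
  rewrite FG //.
    by apply: gU; rewrite /nclique cU eU setU_eq0; case/andP: gT => _ /negPf->; rewrite andbF.
  by rewrite e eU /wwt !map_cat !sumn_cat /= wt_disjointU // !addnA.
(* On words, the part to remove sits at weight [W], the largest at which [f] can be nonzero. The
   terms in which [c] differs from [flag_coef] evaluate [f] at strictly larger weight, where it
   vanishes; so this part is a cocycle for [d0], which preserves weight. *)
pose cut F w : K := if wwt w == W then F w else 0.
have cutE F w : wwt w = W -> cut F w = F w by rewrite /cut => ->; rewrite eqxx.
have cutN F w : wwt w <> W -> cut F w = 0 by rewrite /cut => /eqP/negPf->.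
have d0_cut F w : all nclique w -> d0 (cut F) w = cut (d0 F) w.
  move=> gw; have [wW|wW] := eqVneq (wwt w) W.
    by rewrite cutE //; apply: same => // v _ vw; rewrite cutE // vw.
  rewrite cutN; last exact/eqP.
  rewrite -[RHS](cobar0 flag_coef w); apply: same => // v _ vw.
  by rewrite cutN // vw; exact/eqP.
have [||g gs dg] := @flag_cobar_exact k (cut f).
- move=> w gw; rewrite /cut; case: ifP => _; [exact: fs|by rewrite eqxx].
- move=> w gw; rewrite d0_cut // /cut; case: eqP => // wW.
  have := df _ gw; rewrite c_split low ?addr0 // => v gv; rewrite wW => ?.
  exact: fW.
have gs' : supp_good k 1 (cut g).
  move=> w gw; rewrite /cut; case: ifP => _; [exact: gs|by rewrite eqxx].
have dg' w : all nclique w -> d0 (cut g) w = cut f w.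
  by move=> gw; rewrite d0_cut // /cut; case: eqP => // wW; rewrite dg // cutE.
(* The difference between the full coboundary of [cut g] and its flag coboundary lives at weight
   below [W], so the remainder vanishes from [W] on. *)
have [||| y ys dy] := IH (fun w => f w - cobar c (cut g) w).
- move=> w gw fn; have [f0|/fs[]//] := eqVneq (f w) 0.
  move: fn; rewrite f0 sub0r oppr_eq0.
  move=> cn; suff /andP[/eqP-> ->] : (rk w == k) && (size w + 0 < k)%N by [].
  apply: contraNT cn => nn; apply/eqP; apply: cobar_eq0 => u S T v U e.
  have [gS gT gU] := mergeE u S T v (ltac:(by rewrite -e)).
  have [->|cn] := eqVneq (c S T U) 0; first by rewrite mul0r.
  have [{}/gU gU cU] := c_graded gS gT cn.
  apply/eqP; apply: contraNT nn; rewrite mulf_eq0 negb_or => /andP[_ /(gs' _ gU)[<- sw]].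
  have -> : rk w = rk (u ++ U :: v) by rewrite e /rk !map_cat !sumn_cat /= cU !addnA.
  by move: sw; rewrite eqxx e !size_cat /= addn1 addn0 !addnS.
- move=> w gw; rewrite cobarB df // (cobar_cobar (P := nclique)) ?subr0 //.
- move=> w gw wW; rewrite c_split low // => [|v gv vw]; last first.
    by rewrite cutN // => vW; rewrite vW ltnNge wW in vw.
  rewrite addr0 dg' // /cut; case: eqP => [_|/eqP nW]; first by rewrite subrr.
  by rewrite subr0 fW // ltn_neqAle eq_sym nW.
exists (fun w => cut g w + y w) => [w gw|w gw].
  have [->|cn] := eqVneq (cut g w) 0; first by rewrite add0r; exact: ys.
  by move=> _; exact: gs'.
by rewrite cobarD dy // addrC subrK.
Qed.

End FlagComplex.

(** * Supertraces *)

Section Supertrace.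
Context (K : fieldType) (N d : nat).
Context (D Q e P : 'M[K]_N) (p : 'M[K]_(N, d)) (q : 'M[K]_(d, N)) (C : 'M[K]_d).

(* Row vectors are cochains, D is the differential, Q the action, e the sign, P
   the projection on the top cochains, and p the projection on the top
   cohomology, on which the action is C.  A generalised inverse G of D splits
   the trace of e *m Q into three parts, two of which cancel. *)
Lemma supertrace :
  D *m D = 0 -> Q *m D = D *m Q -> e *m D = - (D *m e) ->
  P *m P = P -> P *m D = 0 -> P *m p = p -> q *m P = q -> e *m p = p ->
  D *m p = 0 -> q *m p = 1%:M -> Q *m p = p *m C ->
  (forall x : 'rV_N, x *m P = 0 -> x *m D = 0 -> exists y, x = y *m D) ->
  (forall x : 'rV_N, x *m P = x -> x *m p = 0 -> exists y, x = y *m D) ->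
  \tr (e *m Q) = \tr C.
Proof.
move=> DD QD eD PP PD Pp qP ep Dp qp Qp ex1 ex0.
have [G DGD] : exists G, D *m G *m D = D.
  by exists (pinvmx D); rewrite mulmxKpV ?submx_refl.
(* The identity is [X + (1 - D G) p q + D G]. The rows of [X] are cocycles whose top part has no
   cohomology class, hence coboundaries, which is [XGD]. *)
pose X := (1%:M - D *m G) *m (1%:M - p *m q).
have qD : q *m D = 0 by rewrite -qP -mulmxA PD mulmx0.
have ZD : (1%:M - p *m q) *m D = D.
  by rewrite mulmxBl mul1mx -mulmxA qD mulmx0 subr0.
have Zp : (1%:M - p *m q) *m p = 0.
  by rewrite mulmxBl mul1mx -mulmxA qp mulmx1 subrr.
have YD : (1%:M - D *m G) *m D = 0 by rewrite mulmxBl mul1mx DGD subrr.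
have XGD : X *m (G *m D) = X.
  apply/row_matrixP => i; rewrite row_mul.
  have XD : X *m D = 0 by rewrite /X -mulmxA ZD YD.
  have Xp : X *m p = 0 by rewrite /X -mulmxA Zp mulmx0.
  set x := row i X.
  have xD : x *m D = 0 by rewrite -row_mul XD row0.
  have xp : x *m p = 0 by rewrite -row_mul Xp row0.
  have [|| y yE] := ex0 (x *m P); rewrite -?mulmxA ?PP ?Pp //.
  have [|| z zE] := ex1 (x - x *m P).
  - by rewrite mulmxBl -mulmxA PP subrr.
  - by rewrite mulmxBl -mulmxA PD mulmx0 subr0.
  have -> : x = (y + z) *m D by rewrite mulmxDl -yE -zE addrC subrK.
  by rewrite -mulmxA (mulmxA D G D) DGD.
have DX : D *m X = D.
  have DY : D *m (1%:M - D *m G) = D by rewrite mulmxBr mulmx1 mulmxA DD mul0mx subr0.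
  by rewrite /X mulmxA DY mulmxBr mulmx1 mulmxA Dp mul0mx subr0.
have eQD : e *m Q *m D = - (D *m (e *m Q)).
  by rewrite -mulmxA QD mulmxA eD mulNmx mulmxA.
(* As [e *m Q] anticommutes with [D], cyclicity of the trace moves [D] past [G] at the price of a
   sign; this part will cancel the contribution of [X]. *)
have t1 : \tr (e *m Q *m (D *m G)) = - \tr (e *m Q *m (G *m D)).
  by rewrite mulmxA eQD mulNmx linearN /= mxtrace_mulC (mulmxA G D) mxtrace_mulC.
have t2 : \tr (e *m Q *m X) = \tr (e *m Q *m (G *m D)).
  transitivity (\tr (e *m Q *m X *m (G *m D))).
    by rewrite -(mulmxA (e *m Q)) XGD.
  rewrite mxtrace_mulC -(mulmxA G D).
  have -> : D *m (e *m Q *m X) = D *m (e *m Q).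
    by rewrite mulmxA -[D *m (e *m Q)]opprK -eQD mulNmx -(mulmxA (e *m Q)) DX.
  by rewrite (mulmxA G D) mxtrace_mulC.
have t3 : \tr (e *m Q *m (1%:M - D *m G) *m (p *m q)) = \tr C.
  rewrite mulmxBr mulmx1 mulmxBl linearB /=.
  have -> : \tr (e *m Q *m (D *m G) *m (p *m q)) = 0.
    rewrite mxtrace_mulC !mulmxA -(mulmxA _ e) -(mulmxA _ _ D) eQD.
    by rewrite mulmxN !mulmxA -(mulmxA p) qD mulmx0 !mul0mx oppr0 !mul0mx linear0.
  rewrite subr0 -mulmxA (mulmxA Q) Qp !mulmxA ep mxtrace_mulC mulmxA qp.
  by rewrite mul1mx.
have -> : e *m Q = e *m Q *m X + e *m Q *m (1%:M - D *m G) *m (p *m q) + e *m Q *m (D *m G).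
  have BX (R Y t : 'M[K]_N) : R *m (Y *m (1%:M - t)) = R *m Y - R *m Y *m t.
    by rewrite mulmxA mulmxBr mulmx1.
  by rewrite BX subrK mulmxBr mulmx1 subrK.
by rewrite !mxtraceD t1 t2 t3 addrAC subrr add0r.
Qed.

End Supertrace.

(** * Supertraces on words as geometric series *)

Section Words.
Context (K : fieldType) (L : finType) (good : pred L) (deg : L -> nat).
Implicit Types (w v : seq L) (f g : seq L -> K).
Hypothesis deg_gt0 : forall x, good x -> (0 < deg x)%N.

Definition degw w := sumn [seq deg x | x <- w].

(** [n] is fuel that bounds the length; any [n >= k] gives all good words of degree [k], because
    good letters have positive degree. *)
Fixpoint words n k : seq (seq L) :=
  if k == 0%N then [:: [::]] else
  if n is n'.+1 then
    [seq x :: w | x <- [seq x <- enum L | good x && (deg x <= k)%N], w <- words n' (k - deg x)%N]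
  else [::].

Lemma mem_words n k w : (k <= n)%N -> (w \in words n k) = all good w && (degw w == k).
Proof.
elim: n k w => [|n IH] k w.
  rewrite leqn0 => /eqP -> /=; rewrite inE; case: w => [|x w] //=.
  apply/esym/negP => /andP[/andP[/deg_gt0 gx _]].
  by rewrite /degw /= addn_eq0 => /andP[/eqP x0]; rewrite x0 in gx.
move=> kn /=; case: eqP => [->|/eqP k0].
  rewrite inE; case: w => [|x w] //=.
  apply/esym/negP => /andP[/andP[/deg_gt0 gx _]].
  by rewrite /degw /= addn_eq0 => /andP[/eqP x0]; rewrite x0 in gx.
case: w => [|x w].
  by rewrite /degw /= eq_sym (negPf k0); apply/allpairsPdep => -[? [? []]].
have IHx : good x -> (w \in words n (k - deg x)%N) = all good w && (degw w == k - deg x)%N.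
  by move=> gx; apply: IH; have := deg_gt0 gx; lia.
apply/allpairsPdep/idP => [[y [v [+ + [ex ev]]]]|].
  rewrite -{y}ex -{v}ev mem_filter => /andP[/andP[gx dx] _].
  rewrite IHx // => /andP[gw /eqP e].
  by rewrite /= gx gw /degw /= -/(degw w) e subnKC /=.
rewrite /= /degw /= -/(degw w) => /andP[/andP[gx gw] /eqP e]; exists x, w; split=> //.
  by rewrite mem_filter gx mem_enum andbT; lia.
by rewrite IHx // gw; apply/eqP; lia.
Qed.

Lemma uniq_words n k : uniq (words n k).
Proof.
elim: n k => [|n IH] k /=; case: ifP => // _.
apply: allpairs_uniq_dep => [|x _|]; [exact/filter_uniq/enum_uniq|exact: IH|].
by move=> [x w] [y v] /= _ _ [-> ->].
Qed.

Lemma big_words n k (F : seq L -> K) : k != 0%N ->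
  \sum_(w <- words n.+1 k) F w =
  \sum_(x | good x && (deg x <= k)%N) \sum_(w <- words n (k - deg x)%N) F (x :: w).
Proof.
move=> /negPf k0 /=; rewrite k0 big_allpairs_dep big_filter.
by rewrite big_enum_cond.
Qed.

(* The sign (-1) ^+ (degw w - size w) of the homological degree of w. *)
Definition sgw w : K := \prod_(x <- w) - (-1) ^+ deg x.

(** The supertrace in internal degree [k] of an endomorphism acting letter by letter through a
    matrix with diagonal [F]. *)
Definition supertr (F : L -> K) k : K := \sum_(w <- words k k) sgw w * \prod_(x <- w) F x.

Lemma supertr_fuel F n k : (k <= n)%N ->
  \sum_(w <- words n k) sgw w * \prod_(x <- w) F x = supertr F k.
Proof.
move=> kn; apply: perm_big; apply: uniq_perm; rewrite ?uniq_words // => w.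
by rewrite !mem_words.
Qed.

Lemma supertr0 F : supertr F 0 = 1.
Proof. by rewrite /supertr /= big_seq1 /sgw !big_nil mulr1. Qed.

Lemma supertr_rec F k :
  supertr F k.+1 = - \sum_(x | good x && (deg x <= k.+1)%N) (-1) ^+ deg x * F x * supertr F (k.+1 - deg x)%N.
Proof.
rewrite [LHS]/supertr big_words // -sumrN; apply: eq_bigr => x /andP[gx dx].
rewrite -(@supertr_fuel F k); last by have := deg_gt0 gx; lia.
rewrite mulr_sumr -sumrN; apply: eq_bigr => w _.
by rewrite /sgw !big_cons; ring.
Qed.

(** With its sign, a single letter contributes [- (-1)^(deg x) F x], so the series of one-letter
    words is [1 - a(-z)]. The sum over all words is the geometric series in it, that is,
    [1 / a(-z)]. *)
Lemma supertr_inv F (a : nat -> K) k :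
  a 0%N = 1 -> (forall j, (0 < j)%N -> a j = \sum_(x | good x && (deg x == j)) F x) ->
  \sum_(i < k.+1) supertr F i * ((-1) ^+ (k - i) * a (k - i)%N) = (k == 0%N)%:R.
Proof.
move=> a0 aE; rewrite big_ord_recr /= subnn a0 !mulr1.
case: k => [|k]; first by rewrite big_ord0 add0r supertr0.
rewrite supertr_rec; apply/eqP; rewrite subr_eq0; apply/eqP.
transitivity (\sum_(i < k.+1) \sum_(x | good x && (deg x == k.+1 - i)%N)
    (-1) ^+ deg x * F x * supertr F (k.+1 - deg x)%N).
  apply: eq_bigr => i _; rewrite aE; last by rewrite subn_gt0.
  rewrite !mulr_sumr; apply: eq_bigr => x /andP[_ /eqP ->].
  rewrite subKn; last exact: ltnW.
  by ring.
rewrite (exchange_big_dep good) /=; last by move=> i x _ /andP[].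
rewrite [RHS]big_mkcondr /=; apply: eq_bigr => x gx.
rewrite gx; case: ifP => dx.
  have dk : (k.+1 - deg x < k.+1)%N by have := deg_gt0 gx; lia.
  rewrite (big_pred1 (Ordinal dk)) // => i /=; apply/eqP/eqP => [e|->/=]; last by lia.
  by apply: val_inj => /=; have := ltn_ord i; lia.
rewrite big_pred0 // => i; apply/eqP; have := ltn_ord i; lia.
Qed.

End Words.

(** * Traces on the diagonal cohomology of a cobar complex *)

Section CobarTrace.
Context (K : fieldType) (L : finType) (good : pred L) (deg : L -> nat).
Context (c : L -> L -> L -> K) (q : L -> L -> K) (k : nat).
Implicit Types (w v : seq L) (f g : seq L -> K).
Hypothesis deg_gt0 : forall x, good x -> (0 < deg x)%N.
Hypothesis c_graded : forall x y z, good x -> good y -> c x y z != 0 ->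
  good z /\ deg z = (deg x + deg y)%N.
Hypothesis cA : forall x y z t, good x -> good y -> good z ->
  \sum_s c x y s * c s z t = \sum_s c y z s * c x s t.
Hypothesis q_graded : forall x y, good y -> q x y != 0 -> good x /\ deg x = deg y.
Hypothesis cq : forall x y t, good x -> good y ->
  \sum_z c x y z * q t z = \sum_a \sum_b q a x * q b y * c a b t.
Hypothesis exact : forall f,
  (forall w, all good w -> f w != 0 -> degw deg w = k /\ (size w < k)%N) ->
  (forall w, all good w -> cobar c f w = 0) ->
  exists g, forall w, all good w -> cobar c g w = f w.

Local Notation W := (words good deg k k).
Local Notation N := (size W).
Local Notation wi i := (nth [::] W i).

Let delta w v : K := (v == w)%:R.
Let vec f : 'rV[K]_N := \row_i f (wi i).

Context (V : lmodType K) (R : seq L -> V) (U : set V) (act : V -> V) (t : K).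
Hypothesis act_linear : linear act.
Hypothesis R_U : forall w, w \in W -> size w = k -> U (R w).
Hypothesis R_span : forall u, U u -> exists x : seq L -> K,
  u = \sum_(w <- W | size w == k) x w *: R w.
Hypothesis R_act : forall w, w \in W -> size w = k ->
  act (R w) = \sum_(v <- W | size v == k) cobar_act q (delta w) v *: R v.
Hypothesis R_rel : forall w, w \in W -> (size w).+1 = k ->
  \sum_(v <- W | size v == k) cobar c (delta w) v *: R v = 0.
Hypothesis R_ker : forall phi : seq L -> K,
  (forall w, w \in W -> (size w).+1 = k ->
    \sum_(v <- W | size v == k) cobar c (delta w) v * phi v = 0) ->
  exists F : V -> K, [/\ forall u v : V, F (u + v) = F u + F v, forall a (u : V), F (a *: u) = a * F u
    & forall w, w \in W -> size w = k -> F (R w) = phi w].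
Hypothesis t_trace : is_trace_on U act t.

Lemma memW w : (w \in W) = all good w && (degw deg w == k).
Proof. by rewrite mem_words. Qed.

Lemma wiW (i : 'I_N) : wi i \in W.
Proof. exact: mem_nth. Qed.

Lemma wi_eq (i j : 'I_N) : (wi i == wi j) = (i == j).
Proof. by rewrite nth_uniq ?ltn_ord ?uniq_words. Qed.

Lemma big_W (M : nmodType) (P : pred (seq L)) (F : seq L -> M) :
  \sum_(w <- W | P w) F w = \sum_(i < N | P (wi i)) F (wi i).
Proof. by rewrite (big_nth [::]) big_mkord. Qed.

(** A finite combination of indicator functions that agrees with [f] on [W]; it lets linearity turn
    the operators on cochains into matrices. *)
Let trunc f v : K := \sum_(i < N) f (wi i) * delta (wi i) v.

Lemma truncE f v : v \in W -> trunc f v = f v.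
Proof.
move=> vW; rewrite /trunc -(nth_index [::] vW).
have iN : (index v W < N)%N by rewrite index_mem.
rewrite (bigD1 (Ordinal iN)) //= /delta eqxx mulr1 big1 ?addr0 // => j ji.
by rewrite (wi_eq (Ordinal iN)) eq_sym (negPf ji) mulr0.
Qed.

Lemma merge_W u x y z v : u ++ x :: y :: v \in W -> c x y z != 0 -> u ++ z :: v \in W.
Proof.
rewrite !memW !all_cat /= => /andP[/and4P[gu gx gy gv] dk] cn.
have [gz dz] := c_graded gx gy cn.
rewrite gu gz gv /=; move: dk.
by rewrite /degw !map_cat !sumn_cat /= dz !addnA.
Qed.

Lemma eq_cobarW f g w : w \in W -> {in W, f =1 g} -> cobar c f w = cobar c g w.
Proof.
move=> wW fg; apply: cobar_eq_supp => u x y v z e.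
have [->|cn] := eqVneq (c x y z) 0; first by rewrite !mul0r.
by rewrite fg // (merge_W _ cn) // -e.
Qed.

Lemma all2_W v w : w \in W -> all2 (fun x y => q x y != 0) v w -> v \in W /\ size v = size w.
Proof.
rewrite !memW /degw; move: {1 2}k => m; elim: w v m => [|y w IH] [|x v] //= m.
move=> /andP[/andP[gy gw] /eqP<-] /andP[/(q_graded gy)[-> ->] /(IH _ (degw deg w))].
by rewrite gw eqxx => /(_ isT)[/andP[-> /eqP->] ->]; rewrite eqxx.
Qed.

Lemma eq_cobar_actW f g w : w \in W -> {in W, f =1 g} -> cobar_act q f w = cobar_act q g w.
Proof.
move=> wW fg; apply: cobar_act_eq_supp => v /(all2_W wW)[vW _].
exact: fg.
Qed.

Let D : 'M[K]_N := \matrix_(i, j) cobar c (delta (wi i)) (wi j).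
Let Q : 'M[K]_N := \matrix_(i, j) cobar_act q (delta (wi i)) (wi j).
Let e : 'M[K]_N := diag_mx (vec (sgw K deg)).
Let P : 'M[K]_N := diag_mx (\row_i (size (wi i) == k)%:R).

Lemma vecD f : vec f *m D = vec (cobar c f).
Proof.
apply/rowP => j; rewrite !mxE.
rewrite (eq_cobarW (g := trunc f)) ?wiW // => [|v vW]; last by rewrite truncE.
rewrite /trunc cobar_sum; apply: eq_bigr => i _.
by rewrite !mxE cobarZ.
Qed.

Lemma vecQ f : vec f *m Q = vec (cobar_act q f).
Proof.
apply/rowP => j; rewrite !mxE.
rewrite (eq_cobar_actW (g := trunc f)) ?wiW // => [|v vW]; last by rewrite truncE.
rewrite /trunc cobar_act_sum; apply: eq_bigr => i _.
by rewrite !mxE cobar_actZ.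
Qed.

Lemma vec_diag f g : vec f *m diag_mx (vec g) = vec (fun w => g w * f w).
Proof.
apply/rowP => j; rewrite !mxE (bigD1 j) //= !mxE eqxx mulr1n big1 ?addr0 1?mulrC // => i ij.
by rewrite !mxE (negPf ij) mulr0n mulr0.
Qed.

Lemma vec_onto (x : 'rV[K]_N) : exists f, x = vec f.
Proof.
exists (fun w => \sum_(i < N) x 0 i * delta (wi i) w).
apply/rowP => j; rewrite !mxE (bigD1 j) //= /delta eqxx mulr1 big1 ?addr0 // => i ij.
by rewrite wi_eq eq_sym (negPf ij) mulr0.
Qed.

Lemma vec_inj m (A B : 'M[K]_(N, m)) : (forall f, vec f *m A = vec f *m B) -> A = B.
Proof.
move=> AB; apply/row_matrixP => i; rewrite !rowE.
by have [f ->] := vec_onto (delta_mx 0 i).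
Qed.

Lemma eq_vec f g : {in W, f =1 g} -> vec f = vec g.
Proof. by move=> fg; apply/rowP => i; rewrite !mxE fg // wiW. Qed.

Lemma size_degw w : all good w -> (size w <= degw deg w)%N.
Proof.
elim: w => //= x w IH /andP[/deg_gt0 gx /IH]; rewrite /degw /= -/(degw deg w).
lia.
Qed.

Lemma sizeW w : w \in W -> (size w <= k)%N.
Proof. by rewrite memW => /andP[/size_degw + /eqP <-]. Qed.

Lemma sgw_k w : w \in W -> size w = k -> sgw K deg w = 1.
Proof.
rewrite memW => /andP[+ /eqP <-]; rewrite /sgw.
elim: w => [|x w IH] /=; first by rewrite big_nil.
move=> /andP[gx gw]; rewrite /degw /= -/(degw deg w) big_cons => e0.
have := size_degw gw; have := deg_gt0 gx => dx sw.
have -> : deg x = 1%N by lia.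
by rewrite IH ?opprK ?mulr1 //; lia.
Qed.

(** [R_span], [R_rel] and [R_ker] present [U] as the cochains on words of [k] letters modulo
    coboundaries, injectivity being stated dually: a functional that kills coboundaries factors
    through [R]. The lemma [supertrace] then applies to the matrices of all operators on the words
    of degree [k]. *)
Lemma cobar_trace : t = supertr good deg (fun x => q x x) k.
Proof.
have [d [b [C [[bU bfree bspan] actb ->]]]] := t_trace.
have -> : supertr good deg (fun x => q x x) k = \tr (e *m Q).
  rewrite /supertr big_W; apply: eq_bigr => i _.
  transitivity (e i i * Q i i); last first.
    rewrite [RHS]mxE [RHS](bigD1 i) //= [X in _ = _ + X]big1 ?addr0 // => j ij.
    by rewrite !mxE eq_sym (negPf ij) mulr0n mul0r.
  rewrite !mxE eqxx mulr1n.
  congr (_ * _); elim: (wi i) => [|x w IH]; first by rewrite big_nil /= /delta eqxx.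
  rewrite big_cons IH cobar_act_cons (bigD1 x) //= [X in _ + X]big1 ?addr0.
    by congr (_ * _); apply: eq_cobar_act => v; rewrite /delta eqseq_cons eqxx.
  move=> y yx; rewrite (eq_cobar_act _ (g := fun=> 0)) ?cobar_act0 ?mulr0 // => v.
  by rewrite /delta eqseq_cons (negPf yx).
pose R' w := if size w == k then R w else 0.
have R'U w : w \in W -> exists x : 'rV[K]_d, R' w = \sum_j x 0 j *: b j.
  move=> wW; rewrite /R'; case: eqP => [wk|_]; last first.
    by exists 0; rewrite big1 // => j _; rewrite mxE scale0r.
  have [x ->] := bspan _ (R_U wW wk); exists (\row_j x j).
  by apply: eq_bigr => j _; rewrite mxE.
have [p pE] : exists p : 'M[K]_(N, d), forall i : 'I_N, R' (wi i) = \sum_j p i j *: b j.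
  exists (\matrix_(i < N, j < d) projT1 (cid (R'U _ (wiW i))) 0 j) => i.
  by rewrite {1}(projT2 (cid (R'U _ (wiW i)))); apply: eq_bigr => j _; rewrite mxE.
have [x xE] : exists x : 'I_d -> seq L -> K,
    forall i, b i = \sum_(w <- W | size w == k) x i w *: R w.
  exists (fun i => projT1 (cid (R_span (bU i)))) => i.
  exact: projT2 (cid (R_span (bU i))).
pose ind w : K := (size w == k)%:R.
have PE : P = diag_mx (vec ind) by [].
(* [p] sends a word to its class in the basis [b], and [sec] lifts [b] to combinations of words of
   length [k]; hence [sec *m p = 1]. *)
pose sec : 'M[K]_(d, N) := \matrix_(i, j) (x i (wi j) * ind (wi j)).
have evP m (A B : 'M[K]_(m, d)) :
    (forall i, \sum_j A i j *: b j = \sum_j B i j *: b j) -> A = B.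
  move=> AB; apply/matrixP => i j; apply/eqP; rewrite -subr_eq0; apply/eqP.
  apply: (bfree (fun j => A i j - B i j)).
  under eq_bigr do rewrite scalerBl.
  by rewrite sumrB AB subrr.
have ev_p m (A : 'M[K]_(m, N)) i :
    \sum_j (A *m p) i j *: b j = \sum_l A i l *: R' (wi l).
  under eq_bigr do rewrite mxE scaler_suml.
  rewrite exchange_big; apply: eq_bigr => l _; rewrite pE scaler_sumr.
  by apply: eq_bigr => j _; rewrite scalerA.
have R'_sum (a : seq L -> K) : \sum_(l < N) a (wi l) *: R' (wi l) =
    \sum_(w <- W | size w == k) a w *: R w.
  rewrite big_W [RHS]big_mkcond; apply: eq_bigr => l _.
  by rewrite /R'; case: ifP => // _; rewrite scaler0.
have D_size w v : cobar c (delta w) v != 0 -> size v = (size w).+1.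
  move=> Dn; apply/eqP; apply: contraNT Dn => sv; apply/eqP; apply: cobar_eq0.
  move=> u y y' v' z e'; rewrite /delta; case: eqP => [e''|_]; last by rewrite mulr0.
  by case/eqP: sv; rewrite e' -e'' !size_cat /= !addnS.
have act0 : act 0 = 0.
  by have := act_linear (-1) 0 0; rewrite scaler0 addr0 scaleN1r addNr.
have act_sum I (r : seq I) (a : I -> K) (u : I -> V) :
    act (\sum_(i <- r) a i *: u i) = \sum_(i <- r) a i *: act (u i).
  elim: r => [|i r IH]; first by rewrite !big_nil.
  by rewrite !big_cons act_linear IH.
apply/esym/(@supertrace K N d D Q e P p sec C).
- apply: vec_inj => f; rewrite mulmxA !vecD mulmx0; apply/rowP => i; rewrite !mxE.
  by rewrite (cobar_cobar (P := good)) //; have := wiW i; rewrite memW => /andP[].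
- apply: vec_inj => f; rewrite !mulmxA !(vecD, vecQ); apply: eq_vec => w.
  by rewrite memW => /andP[gw _]; rewrite (cobar_act_cobar (P := good)).
- apply: vec_inj => f; rewrite mulmxN !mulmxA !(vecD, vec_diag).
  apply/rowP => i; rewrite !mxE -mulNr -cobarZ.
  apply: cobar_eq_supp => u y y' v z e'.
  have [->|cn] := eqVneq (c y y' z) 0; first by rewrite !mul0r.
  congr (_ * (_ * _)); have := wiW i; rewrite e' memW all_cat /=.
  move=> /andP[/and4P[_ gy gy' _] _]; have [_ dz] := c_graded gy gy' cn.
  by rewrite /sgw !big_cat !big_cons dz exprD /=; ring.
- apply: vec_inj => f; rewrite PE mulmxA !vec_diag; apply: eq_vec => w _.
  by rewrite /ind; case: eqP; rewrite ?mul1r ?mul0r.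
- apply: vec_inj => f; rewrite PE mulmxA vec_diag vecD mulmx0.
  apply/rowP => i; rewrite !mxE; apply: cobar_eq0 => u y y' v z e'.
  rewrite /ind; case: eqP => [sk|]; last by rewrite mul0r mulr0.
  have := sizeW (wiW i); rewrite e' -sk !size_cat /= !addnS; lia.
- apply: evP => i; rewrite ev_p (bigD1 i) //= !mxE eqxx mulr1n big1 ?addr0; last first.
    by move=> j ij; rewrite !mxE [i == j]eq_sym (negPf ij) mulr0n scale0r.
  rewrite -pE /R'; case: eqP => _; by rewrite ?scale1r ?scaler0.
- apply/matrixP => i j; rewrite mul_mx_diag !mxE /ind.
  by case: eqP; rewrite ?mulr1 ?mulr0.
- apply: evP => i; rewrite ev_p (bigD1 i) //= !mxE eqxx mulr1n big1 ?addr0; last first.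
    by move=> j ij; rewrite !mxE [i == j]eq_sym (negPf ij) mulr0n scale0r.
  rewrite -pE /R'; case: eqP => [sk|_]; last by rewrite scaler0.
  by rewrite sgw_k ?wiW // scale1r.
- apply: evP => i; rewrite ev_p [RHS]big1 => [|j _]; last by rewrite mxE scale0r.
  under eq_bigr do rewrite mxE.
  rewrite (R'_sum (cobar c (delta (wi i)))).
  have [sk|sk] := eqVneq (size (wi i)).+1 k; first exact: R_rel (wiW i) sk.
  rewrite big1 // => w /eqP wk; have [->|/D_size e'] := eqVneq (cobar c (delta (wi i)) w) 0.
    by rewrite scale0r.
  by rewrite -e' wk eqxx in sk.
- apply: evP => i; rewrite ev_p.
  under eq_bigr do rewrite mxE.
  rewrite (R'_sum (fun w => x i w * ind w)).
  rewrite [RHS](bigD1 i) //= mxE eqxx scale1r [X in _ = _ + X]big1 ?addr0 => [|j ij].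
    rewrite [RHS]xE; apply: eq_bigr => w wk; by rewrite /ind wk mulr1.
  by rewrite mxE eq_sym (negPf ij) scale0r.
- apply: evP => i; rewrite ev_p.
  under eq_bigr do rewrite mxE.
  rewrite (R'_sum (cobar_act q (delta (wi i)))).
  transitivity (act (R' (wi i))); last first.
    rewrite pE act_sum.
    under [RHS]eq_bigr do rewrite mxE scaler_suml.
    rewrite [RHS]exchange_big; apply: eq_bigr => l _.
    by rewrite actb scaler_sumr; apply: eq_bigr => j _; rewrite scalerA.
  rewrite /R'; case: eqP => [sk|sk]; first by rewrite R_act ?wiW.
  rewrite act0 big1_seq // => w /andP[/eqP wk wW].
  rewrite (cobar_act_eq_supp (g := fun=> 0)) ?cobar_act0 ?scale0r // => v /(all2_W wW)[_ vw].
  by rewrite /delta; case: eqP => // e'; case: sk; rewrite -e' vw.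
- move=> y; have [f ->] := vec_onto y; rewrite PE vec_diag vecD => fk Df.
  have f0 w : w \in W -> size w = k -> f w = 0.
    move=> wW wk; have /rowP/(_ (Ordinal (etrans (index_mem w W) wW))) := fk.
    by rewrite !mxE nth_index // /ind wk eqxx mul1r.
  (* [exact] concerns cochains on all good words, so [f] is extended by 0; merging preserves the
     degree, which keeps the extension a cocycle. *)
  pose f' w := if w \in W then f w else 0.
  have f'E w : w \in W -> f' w = f w by rewrite /f' => ->.
  have f'0 w : w \notin W -> f' w = 0 by rewrite /f' => /negPf->.
  have [||g dg] := exact (f := f').
  - move=> w gw; case wW: (w \in W); last by rewrite f'0 ?wW ?eqxx.
    rewrite f'E // => fn; have := wW; rewrite memW => /andP[_ /eqP wk]; split=> //.
    rewrite ltn_neqAle sizeW // andbT; apply: contraNneq fn => /(f0 _ wW) ->.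
    by [].
  - move=> w gw; case wW: (w \in W).
      rewrite (eq_cobarW _ f'E) // -(nth_index [::] wW).
      by have /rowP/(_ (Ordinal (etrans (index_mem w W) wW))) := Df; rewrite !mxE.
    apply: cobar_eq0 => u y1 y2 v z e'; have [->|cn] := eqVneq (c y1 y2 z) 0.
      by rewrite mul0r.
    rewrite f'0 ?mulr0 //; move: wW; rewrite !memW gw e' /= => /negbT dn.
    move: gw; rewrite e' all_cat /= => /and4P[_ g1 g2 _].
    have [_ dz] := c_graded g1 g2 cn; rewrite negb_and; apply/orP; right.
    by move: dn; rewrite /degw !map_cat !sumn_cat /= dz !addnA.
  exists (vec g); rewrite vecD; apply: eq_vec => w wW.
  by rewrite dg ?f'E //; move: wW; rewrite memW => /andP[].
- move=> y yP yp; have [/submxP //|yD] := boolP (y <= D)%MS.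
  (* If [y] is not a coboundary, a column [h] killed by [D] detects it. Read as a functional on
     words, [h] factors through [R] by [R_ker], yet the class of [y] is 0. *)
  have [h [Dh yh]] : exists h : 'cV[K]_N, D *m h = 0 /\ (y *m h) 0 0 != 0.
    have /rV0Pn[j yj] : y *m cokermx D != 0 by rewrite -submxE.
    exists (col j (cokermx D)); split.
      by rewrite colE mulmxA mulmx_coker mul0mx.
    by rewrite colE mulmxA -colE mxE.
  pose phi w := \sum_(i < N) h i 0 * delta (wi i) w.
  have phiE (i : 'I_N) : phi (wi i) = h i 0.
    rewrite /phi (bigD1 i) //= /delta eqxx mulr1 big1 ?addr0 // => l li.
    by rewrite wi_eq eq_sym (negPf li) mulr0.
  have [|F [FD FZ FR]] := R_ker (phi := phi).
    move=> w wW wk; have /matrixP/(_ (Ordinal (etrans (index_mem w W) wW)) 0) := Dh.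
    rewrite !mxE => {2}<-; rewrite big_W big_mkcond; apply: eq_bigr => i _.
    rewrite phiE mxE /= nth_index //; case: eqP => // ik.
    have [->|/D_size e'] := eqVneq (cobar c (delta w) (wi i)) 0; first by rewrite mul0r.
    by case: ik; rewrite e'.
  have F0 : F 0 = 0 by rewrite -(scale0r 0) FZ mul0r.
  have F_sum I (r : seq I) (a : I -> K) (u : I -> V) :
      F (\sum_(i <- r) a i *: u i) = \sum_(i <- r) a i * F (u i).
    elim: r => [|i r IH]; first by rewrite !big_nil.
    by rewrite !big_cons FD FZ IH.
  move/eqP: yh => []; rewrite mxE; transitivity (F (\sum_i y 0 i *: R' (wi i))).
    rewrite F_sum; apply: eq_bigr => i _; rewrite -phiE /R'.
    have := congr1 (fun z : 'rV__ => z 0 i) yP; rewrite mul_mx_diag !mxE.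
    case: eqP => [sk _|_ <-]; first by rewrite FR ?wiW.
    by rewrite mulr0 !mul0r.
  by rewrite -ev_p yp big1 // => l _; rewrite mxE scale0r.
Qed.

End CobarTrace.

(** * Functionals on free algebras *)

Section FreeFunctional.
Context (K : fieldType) (X : choiceType).
Implicit Types (s t : seq X) (x y v : free_alg K X).

Definition fword s : free_alg K X := << FMonom s >>.

Lemma fwordM s t : fword s * fword t = fword (s ++ t).
Proof.
rewrite /fword malgM_def fgmulUU mulr1; congr << _ >>.
by apply: val_inj; rewrite /= fmM.
Qed.

Lemma fword_sum v : v = \sum_(w <- msupp v) v@_w *: fword w.
Proof.
rewrite {1}[v]monalgE; apply: eq_bigr => w _.
by apply/malgP => u; rewrite mcoeffZ !mcoeffU fmK mulr_natr.
Qed.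

Lemma fword_ind (P : free_alg K X -> Prop) : P 0 ->
  (forall x y, P x -> P y -> P (x + y)) -> (forall c s, P (c *: fword s)) ->
  forall v, P v.
Proof. by move=> P0 PD Pw v; rewrite (fword_sum v); apply: (big_ind P) => // w _; exact: Pw. Qed.

Lemma fword_prod s : \prod_(i <- s) free_gen K i = fword s.
Proof.
elim: s => [|i s IH]; last first.
  by rewrite big_cons IH; exact: (fwordM [:: i]).
rewrite big_nil /fword (_ : FMonom [::] = mone) //.
by apply: val_inj; rewrite /= fm1.
Qed.

Lemma homog_ind k (P : free_alg K X -> Prop) : P 0 ->
  (forall x y, P x -> P y -> P (x + y)) ->
  (forall c s, size s = k -> P (c *: fword s)) ->
  forall v, homog k v -> P v.
Proof.
move=> P0 PD Pw v hv; rewrite (fword_sum v) big_seq.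
by apply: (big_ind P) => // w /hv wk; exact: Pw.
Qed.

Context (h : seq X -> K).

Definition flin v : K := mmap idfun (fun w : {fmonom X} => h w) v.

Lemma flinD x y : flin (x + y) = flin x + flin y.
Proof. exact: mmapD. Qed.

Lemma flinB x y : flin (x - y) = flin x - flin y.
Proof. exact: mmapB. Qed.

Lemma flin0 : flin 0 = 0.
Proof. exact: mmap0. Qed.

Lemma flin_word s : flin (fword s) = h s.
Proof. by rewrite /flin mmapU mul1r. Qed.

Lemma flinZ c x : flin (c *: x) = c * flin x.
Proof.
rewrite /flin (mmapEw (msuppZ_le _ _)) mmapE mulr_sumr.
by apply: eq_bigr => w _; rewrite mcoeffZ mulrA.
Qed.

Lemma flin_mid x : (forall s t, flin (fword s * x * fword t) = 0) ->
  forall a b : free_alg K X, flin (a * x * b) = 0.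
Proof.
move=> hx a b; pose P1 b := forall s, flin (fword s * x * b) = 0.
have h1 : P1 b.
  elim/fword_ind: b => [s|y z hy hz s|d t s]; first by rewrite mulr0 flin0.
    by rewrite mulrDr flinD [X in X + _]hy [X in _ + X]hz addr0.
  by rewrite -scalerAr flinZ hx mulr0.
elim/fword_ind: a => [|y z hy hz|d t]; first by rewrite !mul0r flin0.
  by rewrite !mulrDl flinD [X in X + _]hy [X in _ + X]hz addr0.
by rewrite -!scalerAl flinZ h1 mulr0.
Qed.

(** Ideal elements are sums of relations multiplied on both sides, and the multipliers expand in
    words; so it is enough to test a relation between two words. *)
Lemma flin_ideal (S : set (free_alg K X)) :
  (forall x s t, S x -> flin (fword s * x * fword t) = 0) ->
  forall x, ideal_gen S x -> flin x = 0.
Proof.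
move=> hS x Ix; suff : forall a b : free_alg K X, flin (a * x * b) = 0.
  by move/(_ 1 1); rewrite mul1r mulr1.
elim: Ix => {x} [x Sx||x y _ IHx _ IHy a b|c x _ IHx a b|c x _ IHx a b].
- by apply: flin_mid => s t; exact: hS.
- by move=> a b; rewrite mulr0 mul0r flin0.
- by rewrite mulrDr mulrDl flinD [X in X + _]IHx [X in _ + X]IHy addr0.
- by rewrite mulrA.
- by rewrite -!mulrA mulrA IHx.
Qed.

End FreeFunctional.

(** * Determinants of lists of rows *)

Section RowDet.
Context (K : fieldType) (k : nat).
Implicit Types (x y : 'rV[K]_k) (u v : seq 'rV[K]_k).

(** The top coefficient of a product of vectors in the exterior algebra in [k] variables; other
    lengths get 0, so one functional serves words of every length. *)
Definition rowdet (s : seq 'rV[K]_k) : K :=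
  if size s == k then \det (\matrix_(i < k) nth 0 s i) else 0.

Lemma rowdet_linear u v c x y :
  rowdet (u ++ (c *: x + y) :: v) = c * rowdet (u ++ x :: v) + rowdet (u ++ y :: v).
Proof.
rewrite /rowdet !size_cat /=; case: eqP => [sk|]; last by rewrite mulr0 addr0.
have uk : (size u < k)%N by lia.
rewrite (determinant_multilinear (i0 := Ordinal uk) (b := c) (c := 1)
  (B := \matrix_(i < k) nth 0 (u ++ x :: v) i) (C := \matrix_(i < k) nth 0 (u ++ y :: v) i)).
- by rewrite mul1r.
- by rewrite !rowK !nth_cat /= ltnn subnn scale1r.
- apply/row_matrixP => i; rewrite !row'Esub !row_rowsub !rowK !nth_cat.
  have := neq_lift (Ordinal uk) i; rewrite -val_eqE /=.
  by case: ltngtP => // ui _; rewrite -(subnSK ui).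
- apply/row_matrixP => i; rewrite !row'Esub !row_rowsub !rowK !nth_cat.
  have := neq_lift (Ordinal uk) i; rewrite -val_eqE /=.
  by case: ltngtP => // ui _; rewrite -(subnSK ui).
Qed.

Lemma rowdet_alt u v x : rowdet (u ++ x :: x :: v) = 0.
Proof.
rewrite /rowdet !size_cat /=; case: eqP => // sk.
have u1 : (size u < k)%N by lia.
have u2 : ((size u).+1 < k)%N by lia.
apply: (determinant_alternate (i1 := Ordinal u1) (i2 := Ordinal u2)).
  by rewrite -val_eqE /= neq_ltn ltnSn.
by move=> j; rewrite !mxE !nth_cat /= ltnn subnn ltnNge leqnSn /= subSnn.
Qed.

Lemma rowdetD u v x y :
  rowdet (u ++ (x + y) :: v) = rowdet (u ++ x :: v) + rowdet (u ++ y :: v).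
Proof. by have := rowdet_linear u v 1 x y; rewrite scale1r mul1r. Qed.

Lemma rowdet0 u v : rowdet (u ++ 0 :: v) = 0.
Proof.
by have := rowdet_linear u v (-1) 0 0; rewrite scaler0 addr0 mulN1r addNr.
Qed.

Lemma rowdetN u v x : rowdet (u ++ (- x) :: v) = - rowdet (u ++ x :: v).
Proof.
by have := rowdet_linear u v (-1) x 0; rewrite addr0 scaleN1r rowdet0 addr0 mulN1r.
Qed.

Lemma rowdet_anti u v x y :
  rowdet (u ++ y :: x :: v) = - rowdet (u ++ x :: y :: v).
Proof.
have := rowdet_alt u v (x + y).
have split2 z a b : rowdet (u ++ z :: (a + b) :: v) =
    rowdet (u ++ z :: a :: v) + rowdet (u ++ z :: b :: v).
  by have := rowdetD (u ++ [:: z]) v a b; rewrite -!catA.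
rewrite rowdetD !split2 !rowdet_alt add0r addr0 => /eqP.
by rewrite addr_eq0 => /eqP ->; rewrite opprK.
Qed.

End RowDet.

(** * Functionals on the free algebra that vanish on the relations of the dual *)

Section FlatBraid.
Context (n : nat).
Local Notation E := ('I_n * 'I_n)%type.
Implicit Types (e f : E) (s t : seq E) (S T U : {set E}).
Local Notation F := (free_alg rat (ord_pair n)).

Definition edge e := (e.1 < e.2)%N.
Definition offdiag e := e.1 != e.2.

(* The normal monomials of the dual are the products over the star forests
   centred at the least vertices of their trees, one for each set partition. *)
Definition star_rel e f :=
  edge e && ((e == f) || [&& e.2 != f.2, e.2 != f.1 & e.1 != f.2]).

Definition rgp e : F := rgen e.1 e.2.
Definition rprod s : F := \prod_(e <- s) rgp e.

Lemma edge_offdiag e : edge e -> offdiag e.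
Proof. by move=> /ltn_eqF; rewrite /offdiag -val_eqE => ->. Qed.

Lemma rprod_cat s t : rprod (s ++ t) = rprod s * rprod t.
Proof. by rewrite /rprod big_cat. Qed.

Lemma rprod_cons e s : rprod (e :: s) = rgp e * rprod s.
Proof. by rewrite /rprod big_cons. Qed.

Lemma rgp_val (p : ord_pair n) : rgp (val p) = free_gen rat p.
Proof. by rewrite /rgp /rgen -surjective_pairing valK. Qed.

Lemma fword_rprod (w : seq (ord_pair n)) : fword rat w = rprod [seq val p | p <- w].
Proof.
by rewrite -fword_prod /rprod big_map; apply: eq_bigr => p _; rewrite rgp_val.
Qed.

Lemma rprod_fword s : all offdiag s -> exists2 w : seq (ord_pair n),
  [seq val p | p <- w] = s & rprod s = fword rat w.
Proof.
move=> sP; suff [w ws] : exists w : seq (ord_pair n), [seq val p | p <- w] = s.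
  by exists w; rewrite // fword_rprod ws.
elim: s sP => [|e s IH] /= => [_|/andP[eP /IH[w <-]]]; first by exists [::].
by exists ((Sub e eP : ord_pair n) :: w).
Qed.

Lemma homog_rprod s : homog (size s) (rprod s).
Proof.
elim: s => [|e s IH]; first by rewrite /rprod big_nil; exact: homog1.
by rewrite rprod_cons; apply: (homogM (k := 1)) => //; exact: homog_rgen.
Qed.

Section Functional.
Context (H : seq E -> rat).

Definition rlin : F -> rat := flin (fun w : seq (ord_pair n) => H [seq val p | p <- w]).

Lemma rlinD x y : rlin (x + y) = rlin x + rlin y.
Proof. exact: flinD. Qed.

Lemma rlinB x y : rlin (x - y) = rlin x - rlin y.
Proof. exact: flinB. Qed.

Lemma rlinZ a x : rlin (a *: x) = a * rlin x.
Proof. exact: flinZ. Qed.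

Lemma rlin0 : rlin 0 = 0.
Proof. exact: flin0. Qed.

Lemma rlin_rprod s : all offdiag s -> rlin (rprod s) = H s.
Proof. by move=> /rprod_fword[w <- ->]; rewrite /rlin flin_word. Qed.

Lemma rlin_mid s t u : all offdiag s -> all offdiag t -> all offdiag u ->
  rlin (rprod s * rprod t * rprod u) = H (s ++ t ++ u).
Proof. by move=> sP tP uP; rewrite -!rprod_cat -catA rlin_rprod // !all_cat sP tP uP. Qed.

(** The relations [v * v] run over all elements of degree one. Antisymmetry in two adjacent
    generators extends bilinearly to such elements and gives twice the value at [v * v] equal to 0,
    which suffices over the rationals. *)
Lemma rlin_dual_ideal :
  (forall s t e, H (s ++ e :: t) + H (s ++ (e.2, e.1) :: t) = 0) ->
  (forall s t e f, H (s ++ e :: f :: t) = - H (s ++ f :: e :: t)) ->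
  (forall s t (i j k : 'I_n), (i < j)%N -> (j < k)%N ->
    H (s ++ (i, j) :: (i, k) :: t) = H (s ++ (i, j) :: (j, k) :: t)) ->
  (forall s t (i j k : 'I_n), (i < j)%N -> (j < k)%N ->
    H (s ++ (i, k) :: (j, k) :: t) = H (s ++ (i, j) :: (j, k) :: t)) ->
  forall x, ideal_gen (pfb_dual_rel (@rgen n) (homog 1)) x -> rlin x = 0.
Proof.
move=> Hsym Hanti H1 H2; apply: flin_ideal => x u v; rewrite -[flin _ _]/(rlin _) !fword_rprod.
have uP (w : seq (ord_pair n)) : all offdiag [seq val p | p <- w].
  by apply/allP => _ /mapP[p _ ->]; exact: (valP p).
have lt_off (i j : 'I_n) : (i < j)%N -> offdiag (i, j) by exact: (@edge_offdiag (i, j)).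
have r1 e : rgp e = rprod [:: e] by rewrite /rprod big_seq1.
have r2 e f : rgp e * rgp f = rprod [:: e; f] by rewrite /rprod big_cons big_seq1.
set s := map _ u; set t := map _ v.
have sP : all offdiag s by exact: uP.
have tP : all offdiag t by exact: uP.
have m1 e : offdiag e -> rlin (rprod s * rgp e * rprod t) = H (s ++ e :: t).
  by move=> eP; rewrite r1 rlin_mid //= eP.
have m2 e f : offdiag e -> offdiag f ->
    rlin (rprod s * (rgp e * rgp f) * rprod t) = H (s ++ e :: f :: t).
  by move=> eP fP; rewrite r2 rlin_mid //= eP fP.
case=> [i j ij|z zP|i j k ij jk|i j k ij jk].
- have ji : offdiag (j, i) by rewrite /offdiag eq_sym.
  rewrite mulrDr mulrDl rlinD; apply: etrans (Hsym s t (i, j)).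
  by congr (_ + _); [exact: (m1 (i, j))|exact: (m1 (j, i))].
- rewrite -/s -/t; pose G a b := rlin (rprod s * (a * b) * rprod t).
  have GDl a a' b : G (a + a') b = G a b + G a' b.
    by rewrite /G mulrDl mulrDr mulrDl rlinD.
  have GDr a b b' : G a (b + b') = G a b + G a b'.
    by rewrite /G !mulrDr mulrDl rlinD.
  have GZl c a b : G (c *: a) b = c * G a b.
    by rewrite /G -scalerAl -scalerAr -scalerAl rlinZ.
  have GZr c a b : G a (c *: b) = c * G a b.
    by rewrite /G -!scalerAr -scalerAl rlinZ.
  have G0l b : G 0 b = 0 by rewrite /G mul0r mulr0 mul0r rlin0.
  have G0r a : G a 0 = 0 by rewrite /G !mulr0 mul0r rlin0.
  have Gw w w' : size w = 1%N -> size w' = 1%N -> G (fword rat w) (fword rat w') = - G (fword rat w') (fword rat w).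
    case: w w' => [|p []] // [|p' []] // _ _.
    have pP := valP p; have pP' := valP p'.
    rewrite /G !fword_rprod -!rprod_cat -!catA !rlin_rprod; first exact: Hanti.
      by rewrite !all_cat sP tP /= /offdiag pP pP'.
    by rewrite !all_cat sP tP /= /offdiag pP pP'.
  have Gw' w a : size w = 1%N -> homog 1 a -> G (fword rat w) a = - G a (fword rat w).
    move=> w1 ha; move: a ha; apply: homog_ind => [|a b ha hb|c r rr].
    - by rewrite G0l G0r oppr0.
    - by rewrite GDl GDr [in LHS]ha [in LHS]hb opprD.
    - by rewrite GZl GZr Gw // mulrN.
  have Ganti a b : homog 1 a -> homog 1 b -> G a b = - G b a.
    move=> ha hb; move: a ha; apply: homog_ind => [|a a' h1 h2|c r rr].
    - by rewrite G0l G0r oppr0.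
    - by rewrite GDl GDr [in LHS]h1 [in LHS]h2 opprD.
    - by rewrite GZl GZr Gw' // mulrN.
  have := Ganti _ _ zP zP; rewrite -/(G z z) => e.
  have : G z z *+ 2 == 0 by rewrite mulr2n {1}e addNr.
  by rewrite -mulr_natl mulf_eq0 /= => /eqP.
- have ik := ltn_trans ij jk.
  rewrite mulrBr mulrBl rlinB; apply/eqP; rewrite subr_eq0; apply/eqP.
  apply: (etrans (m2 (i, j) (i, k) (lt_off _ _ ij) (lt_off _ _ ik))).
  by rewrite H1 //; apply/esym/(m2 (i, j) (j, k)); exact: lt_off.
- have ik := ltn_trans ij jk.
  rewrite mulrBr mulrBl rlinB; apply/eqP; rewrite subr_eq0; apply/eqP.
  apply: (etrans (m2 (i, k) (j, k) (lt_off _ _ ik) (lt_off _ _ jk))).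
  by rewrite H2 //; apply/esym/(m2 (i, j) (j, k)); exact: lt_off.
Qed.

End Functional.
End FlatBraid.

(** * Star monomials *)

Section Straightening.
Context (n : nat).
Local Notation E := ('I_n * 'I_n)%type.
Implicit Types (e f : E) (s t : seq E) (S T U : {set E}).
Local Notation star := (clique (@star_rel n)).

Lemma starP S : reflect
  ((forall e, e \in S -> edge e) /\ (forall e f, e \in S -> f \in S -> e != f ->
     [/\ e.2 != f.2, e.2 != f.1 & e.1 != f.2])) (star S).
Proof.
apply: (iffP (cliqueP _ _)) => [h|[h1 h2] e f eS fS].
  split=> [e eS|e f eS fS ef]; first by have := h e e eS eS; rewrite /star_rel => /andP[].
  by have := h e f eS fS; rewrite /star_rel (negPf ef) /= => /and4P[].
rewrite /star_rel h1 //=; have [//|ef] := eqVneq e f.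
by have [-> -> ->] := h2 _ _ eS fS ef.
Qed.

Context (B : pzRingType) (r : E -> B).
Hypothesis r_sq : forall e, r e * r e = 0.
Hypothesis r_anti : forall e f, r f * r e = - (r e * r f).
Hypothesis r_tri : forall i j k : 'I_n, (i < j)%N -> (j < k)%N ->
  r (i, j) * r (j, k) = r (i, j) * r (i, k) /\
  r (i, k) * r (j, k) = r (i, j) * r (i, k).

Definition edge_prod s : B := \prod_(e <- s) r e.
Definition star_mon S : B := edge_prod (enum S).

Lemma edge_prod_cat s t : edge_prod (s ++ t) = edge_prod s * edge_prod t.
Proof. by rewrite /edge_prod big_cat. Qed.

Lemma edge_prod_cons e s : edge_prod (e :: s) = r e * edge_prod s.
Proof. by rewrite /edge_prod big_cons. Qed.

Definition pm (x y : B) := x = y \/ x = - y.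

Lemma pm_refl x : pm x x. Proof. by left. Qed.

Lemma pm_sym x y : pm x y -> pm y x.
Proof. by case=> ->; [left|right; rewrite opprK]. Qed.

Lemma pm_trans x y z : pm x y -> pm y z -> pm x z.
Proof. by move=> [->|->] [->|->]; rewrite ?opprK; [left|right|right|left]. Qed.

Lemma pm_mul x y z z1 : pm x y -> pm z z1 -> pm (x * z) (y * z1).
Proof.
by move=> [->|->] [->|->]; rewrite ?mulrNN ?mulrN ?mulNr; [left|right|right|left].
Qed.

Lemma edge_prod_perm s t : perm_eq s t -> pm (edge_prod s) (edge_prod t).
Proof.
have comm1 e v : pm (edge_prod v * r e) (r e * edge_prod v).
  elim: v => [|f v IH]; first by rewrite /edge_prod big_nil mulr1 mul1r; left.
  rewrite !edge_prod_cons -mulrA; apply: pm_trans (pm_mul (pm_refl _) IH) _.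
  by rewrite !mulrA r_anti mulNr; right.
have comm u v : pm (edge_prod u * edge_prod v) (edge_prod v * edge_prod u).
  elim: u => [|e u IH]; first by rewrite {1 4}/edge_prod big_nil mulr1 mul1r; left.
  rewrite edge_prod_cons -mulrA; apply: pm_trans (pm_mul (pm_refl _) IH) _.
  by rewrite !mulrA; apply: pm_mul (pm_refl _); exact/pm_sym/comm1.
move=> st; apply: (catCA_perm_ind (P := fun u => pm (edge_prod s) (edge_prod u)) _ st (pm_refl _)).
move=> u v w h; apply: pm_trans h _; rewrite !edge_prod_cat !mulrA.
exact: pm_mul (comm _ _) (pm_refl _).
Qed.

(** The weight behind the filtration: replacing a path by the star at its least vertex lowers the
    sum of the lower ends. *)
Definition height e := (n - e.1)%N.

Lemma wt_enum S : wt height S = sumn [seq height e | e <- enum S].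
Proof. by rewrite /wt sumnE big_map big_enum. Qed.

(* Two edges that cannot belong to a common star forest span a path; the
   product over it equals, up to sign, the product over the star at its least
   vertex. *)
Lemma r_step e f : edge e -> edge f -> e != f -> ~~ star_rel e f ->
  exists e' f', [/\ edge e', edge f', (height e + height f < height e' + height f')%N
    & pm (r e * r f) (r e' * r f')].
Proof.
have path (i j k : 'I_n) : (i < j)%N -> (j < k)%N ->
    [/\ edge (i, j), edge (i, k), (n - i + (n - j) < n - i + (n - i))%N,
     r (i, j) * r (j, k) = r (i, j) * r (i, k) &
     r (i, k) * r (j, k) = r (i, j) * r (i, k)].
  move=> ij jk; have [-> ->] := r_tri ij jk; split=> //.
    by rewrite /edge /=; exact: ltn_trans ij jk.
  by have := ltn_ord k; lia.
move: e f => [i j] [k l]; rewrite /star_rel {1 2 3}/edge /= => ij kl ef.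
rewrite ij (negPf ef) /= !negb_and !negbK => /or3P[] /eqP e; subst.
- have : i != k by apply: contraNneq ef => ->.
  rewrite neq_ltn => /orP[ik|ki].
    have [h1 h2 h3 h4 h5] := path _ _ _ ik kl.
    by exists (i, k), (i, l); rewrite h5; split=> //; left.
  have [h1 h2 h3 h4 h5] := path _ _ _ ki ij.
  exists (k, i), (k, l); rewrite r_anti h5; split=> //; last by right.
  by rewrite /height /= addnC.
- have [h1 h2 h3 h4 h5] := path _ _ _ ij kl.
  by exists (i, k), (i, l); rewrite h4; split=> //; left.
- have [h1 h2 h3 h4 h5] := path _ _ _ kl ij.
  exists (k, l), (k, j); rewrite r_anti h4; split=> //; last by right.
  by rewrite /height /= addnC.
Qed.

Lemma nuniq_perm s : ~~ uniq s -> exists e t, perm_eq s (e :: e :: t).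
Proof.
elim: s => //= e s IH; rewrite negb_and negbK => /orP[/perm_to_rem se|/IH[f [t h]]].
  by exists e, (rem e s); rewrite perm_cons.
exists f, (e :: t); rewrite (perm_trans (y := [:: e, f, f & t])) ?perm_cons //.
by rewrite (perm_catCA [:: e] [:: f; f] t).
Qed.

Lemma straighten s : all (@edge n) s -> edge_prod s = 0 \/
  exists U, [/\ star U, #|U| = size s, pm (edge_prod s) (star_mon U) &
    perm_eq (enum U) s \/ (sumn [seq height e | e <- s] < wt height U)%N].
Proof.
pose h s := sumn [seq height e | e <- s].
have perm_h u v : perm_eq u v -> h u = h v.
  by move=> uv; apply/perm_sumn/perm_map.
have h_le u : (h u <= size u * n)%N.
  elim: u => //= e u IH; rewrite /h /= -/(h u) mulSn leq_add //.
  by rewrite /height leq_subr.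
(* Termination: rewriting preserves the length, and the total height is at most [size s * n]. *)
move mE : (size s * n - h s)%N => m; elim/ltn_ind: m s mE => m IH s mE sP.
have [us|] := boolP (uniq s); last first.
  move=> /nuniq_perm[e [t st]]; left.
  case: (edge_prod_perm st) => ->; rewrite !edge_prod_cons mulrA r_sq mul0r ?oppr0 //.
have [cs|ncs] := boolP (star [set e in s]).
  have p : perm_eq (enum [set e in s]) s.
    by apply: uniq_perm => //; [exact: enum_uniq|move=> e; rewrite mem_enum inE].
  right; exists [set e in s]; split=> //; last by left.
    by rewrite cardE (perm_size p).
  exact/pm_sym/edge_prod_perm.
have [e [f [es fs ef]]] : exists e f, [/\ e \in s, f \in s & ~~ star_rel e f].
  move: ncs; rewrite /clique => /forall_inPn[e]; rewrite inE => es /forall_inPn[f].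
  by rewrite inE => fs ef; exists e, f.
have eP := allP sP _ es; have fP := allP sP _ fs.
have enf : e != f.
  by apply: contraNneq ef => <-; rewrite /star_rel eP eqxx.
have [t st] : exists t, perm_eq s [:: e, f & t].
  exists (rem f (rem e s)); apply: perm_trans (perm_to_rem es) _.
  rewrite perm_cons; apply: perm_to_rem.
  by rewrite mem_rem_uniq // inE eq_sym enf.
have tP : all (@edge n) t by move: sP; rewrite (perm_all _ st) /= => /and3P[].
have [e' [f' [eP' fP' hh pp]]] := r_step eP fP enf ef.
have ht : (h s < h [:: e', f' & t])%N.
  by rewrite (perm_h _ _ st) /h /= !addnA ltn_add2r.
have sz : size s = size [:: e', f' & t] by rewrite (perm_size st).
have spm : pm (edge_prod s) (edge_prod [:: e', f' & t]).
  apply: pm_trans (edge_prod_perm st) _; rewrite !edge_prod_cons !mulrA.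
  exact: pm_mul pp (pm_refl _).
have [||t0|[U [sU cU pU hU]]] := IH _ _ [:: e', f' & t] erefl.
- rewrite -mE -sz; apply: ltn_sub2l (ht).
  by apply: leq_trans ht _; rewrite sz; exact: h_le.
- by rewrite /= eP' fP'.
- by left; case: spm => ->; rewrite t0 ?oppr0.
right; exists U; split=> //; [by rewrite sz|exact: pm_trans spm pU|right].
rewrite -/(h s); case: hU => [pU'|]; last exact: ltn_trans.
by rewrite wt_enum -/(h _) (perm_h _ _ pU').
Qed.

End Straightening.

(** * Algebras with a basis of star monomials and coordinates dual to it *)

Section StarAlgebra.
Context (n : nat).
Local Notation E := ('I_n * 'I_n)%type.
Implicit Types (e f : E) (s t : seq E) (S T U V : {set E}).
Local Notation star := (clique (@star_rel n)).
Local Notation good := (nclique (@star_rel n)).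

Context (B : algType rat) (r : E -> B).
Hypothesis r_sq : forall e, r e * r e = 0.
Hypothesis r_anti : forall e f, r f * r e = - (r e * r f).
Hypothesis r_tri : forall i j k : 'I_n, (i < j)%N -> (j < k)%N ->
  r (i, j) * r (j, k) = r (i, j) * r (i, k) /\
  r (i, k) * r (j, k) = r (i, j) * r (i, k).
Hypothesis r_swap : forall i j : 'I_n, i != j -> r (j, i) = - r (i, j).

Context (coord : {set E} -> B -> rat).
Hypothesis coordD : forall U x y, coord U (x + y) = coord U x + coord U y.
Hypothesis coordZ : forall U a x, coord U (a *: x) = a * coord U x.

Local Notation dprod := (edge_prod r).
Local Notation mon := (star_mon r).

Hypothesis coord_mon : forall U S, star U -> star S -> coord U (mon S) = (S == U)%:R.

Let coord0 U : coord U 0 = 0.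
Proof. by rewrite -(scale0r 0) coordZ mul0r. Qed.

Let coordN U x : coord U (- x) = - coord U x.
Proof. by rewrite -scaleN1r coordZ mulN1r. Qed.

Let coord_sum U I (l : seq I) (F : I -> B) :
  coord U (\sum_(i <- l) F i) = \sum_(i <- l) coord U (F i).
Proof. exact: (big_morph _ (coordD U) (coord0 U)). Qed.

Lemma coord_pm U V x : star U -> star V -> pm x (mon V) -> coord U x != 0 -> V = U.
Proof.
move=> sU sV xV; have : coord U x = (V == U)%:R \/ coord U x = - (V == U)%:R.
  by case: xV => ->; rewrite ?coordN coord_mon //; [left|right].
by case: eqP => // _ [] ->; rewrite ?oppr0 eqxx.
Qed.

Lemma mon_expand V x : star V -> pm x (mon V) -> x = coord V x *: mon V.
Proof.
by move=> sV [] ->; rewrite ?coordN coord_mon // eqxx ?scaleNr scale1r.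
Qed.

Lemma star_edge S e : star S -> e \in S -> edge e.
Proof. by move=> /starP[h _]; exact: h. Qed.

Lemma good_star S : good S -> star S.
Proof. by case/andP. Qed.

Lemma card_good S : good S -> (0 < #|S|)%N.
Proof. by rewrite card_gt0 => /andP[]. Qed.

Lemma monM S T : mon S * mon T = dprod (enum S ++ enum T).
Proof. by rewrite /star_mon edge_prod_cat. Qed.

Lemma mon_mul S T : star S -> star T -> mon S * mon T = 0 \/
  exists V, [/\ star V, #|V| = (#|S| + #|T|)%N, pm (mon S * mon T) (mon V) &
    V = S :|: T /\ [disjoint S & T] \/ (wt (@height n) S + wt (@height n) T < wt (@height n) V)%N].
Proof.
move=> sS sT; rewrite monM.
have [||[V [sV cV pV hV]]] := straighten r_sq r_anti r_tri (s := enum S ++ enum T).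
- rewrite all_cat; apply/andP; split; apply/allP => e; rewrite mem_enum;
  exact: star_edge.
- by left.
right; exists V; split=> //; first by rewrite cV size_cat !cardE.
case: hV => [pV'|]; last by rewrite map_cat sumn_cat -!wt_enum; right.
left; split; first by apply/setP => e; rewrite -mem_enum (perm_mem pV') mem_cat !mem_enum inE.
have := perm_uniq pV'; rewrite enum_uniq cat_uniq => /esym/and3P[_ /hasPn h _].
by rewrite disjoint_sym disjoint_subset; apply/subsetP => e eT; have := h e; rewrite !mem_enum; apply.
Qed.

(** Restricted to good [U]: the cobar complex is built on the augmentation ideal, whose basis leaves
    out the empty forest. *)
Definition dual_coef S T U : rat :=
  if good U then coord U (mon S * mon T) else 0.

(** For disjoint [S] and [T] whose union is a star forest, the sign of the shuffle that sorts the
    two enumerations into one. *)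
Definition dual_eps S T : rat := coord (S :|: T) (mon S * mon T).

Lemma dual_coef_sum S T : good S -> good T -> mon S * mon T = \sum_U dual_coef S T U *: mon U.
Proof.
move=> gS gT; have [e0|[V [sV cV pV _]]] := mon_mul (good_star gS) (good_star gT).
  by rewrite e0 big1 // => U _; rewrite /dual_coef e0 coord0 if_same scale0r.
have gV : good V by rewrite /nclique sV -card_gt0 cV addn_gt0 card_good.
rewrite (bigD1 V) //= {1}/dual_coef gV -mon_expand // big1 ?addr0 // => U UV.
rewrite /dual_coef; case: ifP => [/good_star sU|]; last by rewrite scale0r.
have [->|/(coord_pm sU sV pV) e] := eqVneq (coord U (mon S * mon T)) 0; first by rewrite scale0r.
by rewrite e eqxx in UV.
Qed.

(** Both sides are the coordinate at [V] of the product of the three monomials. *)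
Lemma dual_coefA S T U V : good S -> good T -> good U ->
  \sum_X dual_coef S T X * dual_coef X U V = \sum_X dual_coef T U X * dual_coef S X V.
Proof.
move=> gS gT gU.
have cV X Y : dual_coef X Y V = if good V then coord V (mon X * mon Y) else 0 by [].
case gV: (good V); last by rewrite !big1 // => X _; rewrite cV gV mulr0.
transitivity (coord V (mon S * mon T * mon U)).
  rewrite [in RHS](dual_coef_sum gS gT) mulr_suml coord_sum; apply: eq_bigr => X _.
  by rewrite -scalerAl coordZ cV gV.
rewrite -mulrA (dual_coef_sum gT gU) mulr_sumr coord_sum; apply: eq_bigr => X _.
by rewrite -scalerAr coordZ cV gV.
Qed.

Lemma mon0 : mon set0 = 1.
Proof. by rewrite /star_mon /dprod enum_set0 big_nil. Qed.

Lemma mon_disjoint S T : star (S :|: T) -> [disjoint S & T] ->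
  pm (mon S * mon T) (mon (S :|: T)).
Proof.
move=> sST dST; rewrite monM; apply: (edge_prod_perm r_anti).
apply: uniq_perm; rewrite ?enum_uniq //.
  rewrite cat_uniq !enum_uniq andbT; apply/hasPn => e; rewrite !mem_enum => eT.
  by rewrite (disjointFl dST).
by move=> e; rewrite mem_cat !mem_enum inE.
Qed.

Lemma mon_eps S T : star (S :|: T) -> [disjoint S & T] ->
  mon S * mon T = dual_eps S T *: mon (S :|: T).
Proof. by move=> sST dST; apply: mon_expand => //; exact: mon_disjoint. Qed.

Lemma dual_eps0 T : star T -> dual_eps set0 T = 1.
Proof. by move=> sT; rewrite /dual_eps mon0 mul1r set0U coord_mon // eqxx. Qed.

Lemma dual_eps_neq0 S T : star (S :|: T) -> [disjoint S & T] -> dual_eps S T != 0.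
Proof.
move=> sST dST; rewrite /dual_eps; case: (mon_disjoint sST dST) => ->;
by rewrite ?coordN coord_mon // eqxx.
Qed.

(** The cocycle identity is associativity of the algebra, read off at the monomial of the triple
    union. *)
Lemma dual_epsA S T U : star (S :|: T :|: U) ->
  [disjoint S & T] -> [disjoint S :|: T & U] ->
  dual_eps S T * dual_eps (S :|: T) U = dual_eps T U * dual_eps S (T :|: U).
Proof.
move=> sV dST dSTU.
have dTU : [disjoint T & U] by apply: disjointWl dSTU; exact: subsetUr.
have dS : [disjoint S & T :|: U].
  rewrite -setI_eq0 setIUr setU_eq0 !setI_eq0 dST /=.
  by apply: disjointWl dSTU; exact: subsetUl.
have sV' : star (S :|: (T :|: U)) by rewrite setUA.
have sST := clique_sub (subsetUl _ _) sV; have sTU := clique_sub (subsetUr _ _) sV'.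
have := mulrA (mon S) (mon T) (mon U).
rewrite (mon_eps sST dST) (mon_eps sTU dTU) -scalerAr -scalerAl.
rewrite (mon_eps sV dSTU) (mon_eps sV' dS) !scalerA setUA => /(congr1 (coord (S :|: T :|: U))).
by rewrite !coordZ coord_mon // eqxx !mulr1.
Qed.

Lemma dual_coef_flag S T U : good S -> good T ->
  dual_coef S T U != flag_coef (@star_rel n) dual_eps S T U ->
  [/\ good U, #|U| = (#|S| + #|T|)%N & (wt (@height n) S + wt (@height n) T < wt (@height n) U)%N].
Proof.
move=> gS gT; rewrite /flag_coef; case: ifP => [/and3P[/eqP-> dST sU]|nf].
  rewrite /dual_coef /nclique sU -card_gt0.
  by rewrite (leq_trans (card_good gS)) ?subset_leq_card ?subsetUl ?eqxx.
rewrite /dual_coef; case: ifP => [gU|_]; last by rewrite eqxx.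
have [->|[V [sV cV pV hV]]] := mon_mul (good_star gS) (good_star gT); first by rewrite coord0 eqxx.
move=> /(coord_pm (good_star gU) sV pV) VU; rewrite -VU cV.
split=> //.
by case: hV => // -[eV dST]; move: nf; rewrite -VU eV eqxx dST -eV sV.
Qed.

Lemma star1 e : star [set e] = edge e.
Proof.
apply/idP/idP => [h|eP]; first by apply: (star_edge h); rewrite inE.
apply/starP; split=> [f|f g]; rewrite !inE => /eqP->//.
by move=> /eqP->; rewrite eqxx.
Qed.

Lemma good1 e : good [set e] = edge e.
Proof. by rewrite /nclique star1 -card_gt0 cards1 andbT. Qed.

Lemma mon1 e : mon [set e] = r e.
Proof. by rewrite /star_mon enum_set1 /edge_prod big_seq1. Qed.

Lemma star2 e f : edge e -> edge f -> star_rel e f -> star_rel f e -> star [set e; f].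
Proof.
move=> eP fP ef fe; apply/cliqueP => x y; rewrite !inE.
by move=> /orP[] /eqP-> /orP[] /eqP->; rewrite // /star_rel eqxx ?eP ?fP.
Qed.

Lemma star_relC e f : edge e -> edge f -> star_rel e f = star_rel f e.
Proof.
move=> eP fP; rewrite /star_rel eP fP /= eq_sym; congr (_ || _).
rewrite [e.2 == _]eq_sym; congr (_ && _).
by rewrite [f.2 == e.1]eq_sym [f.1 == e.2]eq_sym andbC.
Qed.

Lemma mon2 e f : e != f -> star [set e; f] -> pm (r e * r f) (mon [set e; f]).
Proof.
by move=> ef sef; rewrite -!mon1; apply: mon_disjoint => //; rewrite disjoints1 inE.
Qed.

Lemma nonstar_path e f : edge e -> edge f -> e != f -> ~~ star_rel e f ->
  exists i j k : 'I_n, [/\ (i < j)%N, (j < k)%N &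
    (e, f) \in [:: ((i, j), (j, k)); ((j, k), (i, j)); ((i, k), (j, k)); ((j, k), (i, k))]].
Proof.
move: e f => [i j] [k l]; rewrite /star_rel {1 2 3}/edge /= => ij kl ef.
rewrite ij (negPf ef) /= !negb_and !negbK => /or3P[] /eqP e; subst.
- have : i != k by apply: contraNneq ef => ->.
  rewrite neq_ltn => /orP[ik|ki].
    by exists i, k, l; split=> //; rewrite !inE eqxx !orbT.
  by exists k, i, l; split=> //; rewrite !inE eqxx !orbT.
- by exists i, k, l; split=> //; rewrite !inE eqxx.
- by exists k, l, j; split=> //; rewrite !inE eqxx !orbT.
Qed.

Section Pairs.
Context (M : lmodType rat) (G : E -> E -> M).

(** [G] stands both for the product of two generators in [pfb] and for the values of a functional on
    words with two adjacent letters left open. *)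
Definition pair_comm e f := G e f - G f e.

Let pairs U := \sum_(e | edge e) \sum_(f | edge f) dual_coef [set e] [set f] U *: G e f.

Lemma dual_coef_edge e f U : dual_coef [set e] [set f] U = if good U then coord U (r e * r f) else 0.
Proof. by rewrite /dual_coef !mon1. Qed.

Lemma pairs_list U (l : seq (E * E)) : uniq l -> all (fun p => edge p.1 && edge p.2) l ->
  (forall e f, edge e -> edge f -> dual_coef [set e] [set f] U != 0 -> (e, f) \in l) ->
  pairs U = \sum_(p <- l) dual_coef [set p.1] [set p.2] U *: G p.1 p.2.
Proof.
move=> ul /allP el h; rewrite /pairs pair_big /= (bigID (mem l)) /=.
rewrite [X in _ + X]big1 ?addr0; last first.
  move=> [e f] /andP[/andP[eP fP] ef].
  have [->|cn] := eqVneq (dual_coef [set e] [set f] U) 0; first by rewrite scale0r.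
  by case/negP: ef; exact: h.
rewrite [RHS]big_uniq //; apply: eq_bigl => p; apply/andP/idP => [[]//|pl]; split=> //.
exact: el.
Qed.

Lemma star_pair (i j k : 'I_n) : (i < j)%N -> (j < k)%N ->
  [/\ (i, j) != (i, k) :> E, edge ((i, j) : E), edge ((i, k) : E), edge ((j, k) : E) &
  star [set (i, j); (i, k)]].
Proof.
move=> ij jk; have ik := ltn_trans ij jk.
have neq (a b : 'I_n) : (a < b)%N -> (a == b = false) * (b == a = false).
  by move=> ab; split; apply/negP => /eqP e; rewrite e ltnn in ab.
split=> //; first by rewrite xpair_eqE eqxx neq.
by apply: star2 => //; rewrite /star_rel /edge /= ?ij ?ik ?(neq _ _ jk) ?(neq _ _ ij) ?(neq _ _ ik) ?orbT.
Qed.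

Lemma coord_self U x : star U -> pm x (mon U) -> coord U x != 0.
Proof. by move=> sU [] ->; rewrite ?coordN coord_mon // eqxx. Qed.

(** All products of two distinct edges of a triangle equal one star monomial up to sign, and no
    other pair of edges reaches it. The signs assemble the six pairs into the triple relation of
    [pfb]: this is quadratic duality made explicit. *)
Lemma pairs_triple (i j k : 'I_n) : (i < j)%N -> (j < k)%N ->
  exists2 a : rat, a != 0 & pairs [set (i, j); (i, k)] =
    a *: (pair_comm (i, j) (i, k) + pair_comm (i, j) (j, k) + pair_comm (i, k) (j, k)).
Proof.
move=> ij jk; have [nij eij eik ejk sU] := star_pair ij jk.
set U := [set (i, j); (i, k)] in sU *.
have gU : good U by rewrite /nclique sU; apply/set0Pn; exists (i, j); rewrite !inE eqxx.
exists (coord U (r (i, j) * r (i, k))); first by apply: coord_self => //; exact: mon2.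
have neq (a b : 'I_n) : (a < b)%N -> (a == b = false) * (b == a = false).
  by move=> ab; split; apply/negP => /eqP e; rewrite e ltnn in ab.
pose l : seq (E * E) := [:: ((i, j), (i, k)); ((i, k), (i, j)); ((i, j), (j, k));
  ((j, k), (i, j)); ((i, k), (j, k)); ((j, k), (i, k))].
have ik := ltn_trans ij jk.
rewrite (@pairs_list U l).
- rewrite !big_cons big_nil !dual_coef_edge gU /=.
  have [t1 t2] := r_tri ij jk.
  rewrite (r_anti (i, j) (i, k)) (r_anti (i, j) (j, k)) (r_anti (i, k) (j, k)) t1 t2 coordN.
  rewrite /pair_comm !scaleNr !scalerDr !scalerN addr0 !addrA.
  by [].
- by rewrite /= !inE !xpair_eqE !eqxx ?(neq _ _ ij) ?(neq _ _ jk) ?(neq _ _ ik) ?andbF.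
- by rewrite /= eij eik ejk.
move=> e f eP fP; rewrite dual_coef_edge gU => cn.
have ef : e != f by apply: contraNneq cn => ->; rewrite r_sq coord0.
have [se|nse] := boolP (star_rel e f).
  have sef : star [set e; f] by apply: star2; rewrite // star_relC.
  have /setP eU := coord_pm sU sef (mon2 ef sef) cn.
  have := eU e; have := eU f; rewrite !inE !eqxx orbT /= => /esym/orP[]/eqP fE /esym/orP[]/eqP eE;
    move: ef; rewrite ?fE ?eE ?eqxx ?orbT //.
have [i' [j' [k' [ij' jk' mem]]]] := nonstar_path eP fP ef nse.
have [nij' _ _ _ sU'] := star_pair ij' jk'; have [t1 t2] := r_tri ij' jk'.
have p : pm (r e * r f) (mon [set (i', j'); (i', k')]).
  apply: pm_trans (mon2 nij' sU'); move: mem; rewrite !inE => /or4P[]/eqP[-> ->].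
  - by rewrite t1; left.
  - by rewrite r_anti t1; right.
  - by rewrite t2; left.
  - by rewrite r_anti t2; right.
have /setP eU := coord_pm sU sU' p cn.
have [ei ej ek] : [/\ i' = i, j' = j & k' = k].
  have := eU (i, j); have := eU (i, k); rewrite !inE !eqxx orbT /=.
  move=> /orP[]/eqP[e1 e2] /orP[]/eqP[e3 e4]; subst => //.
  - by rewrite ltnn in jk.
  - by have := ltn_trans jk jk'; rewrite ltnn.
  - by rewrite ltnn in jk.
by move: mem; rewrite ei ej ek !inE => /or4P[]/eqP->; rewrite eqxx ?orbT.
Qed.

(** Only the two orders of [a] and [b] produce this forest, with opposite signs; the result is the
    commutation relation of [pfb]. *)
Lemma pairs_far (a b : E) : edge a -> edge b -> uniq [:: a.1; a.2; b.1; b.2] ->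
  exists2 x : rat, x != 0 & pairs [set a; b] = x *: pair_comm a b.
Proof.
move=> aP bP; rewrite /= !inE !negb_or => /and4P[/and3P[h1 h2 h3] /andP[h4 h5] h6 _].
have sab : star_rel a b by rewrite /star_rel aP h5 h4 h3 !orbT.
have nab : a != b by apply: contraNneq h2 => ->.
have sU : star [set a; b] by apply: star2; rewrite // star_relC.
set U := [set a; b] in sU *.
have gU : good U by rewrite /nclique sU; apply/set0Pn; exists a; rewrite !inE eqxx.
exists (coord U (r a * r b)); first by apply: coord_self => //; exact: mon2.
rewrite (@pairs_list U [:: (a, b); (b, a)]).
- rewrite !big_cons big_nil !dual_coef_edge gU /= (r_anti a b) coordN.
  by rewrite /pair_comm scaleNr scalerBr addr0.
- by rewrite /= inE xpair_eqE negb_and nab.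
- by rewrite /= aP bP.
move=> e f eP fP; rewrite dual_coef_edge gU => cn.
have ef : e != f by apply: contraNneq cn => ->; rewrite r_sq coord0.
have [se|nse] := boolP (star_rel e f).
  have sef : star [set e; f] by apply: star2; rewrite // star_relC.
  have /setP eU := coord_pm sU sef (mon2 ef sef) cn.
  have := eU e; have := eU f; rewrite !inE !eqxx orbT /= => /esym/orP[]/eqP fE /esym/orP[]/eqP eE;
    move: ef; rewrite ?fE ?eE ?eqxx ?orbT //.
have [i' [j' [k' [ij' jk' mem]]]] := nonstar_path eP fP ef nse.
have [nij' _ _ _ sU'] := star_pair ij' jk'; have [t1 t2] := r_tri ij' jk'.
have p : pm (r e * r f) (mon [set (i', j'); (i', k')]).
  apply: pm_trans (mon2 nij' sU'); move: mem; rewrite !inE => /or4P[]/eqP[-> ->].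
  - by rewrite t1; left.
  - by rewrite r_anti t1; right.
  - by rewrite t2; left.
  - by rewrite r_anti t2; right.
have /setP eU := coord_pm sU sU' p cn.
have := eU a; have := eU b; rewrite !inE !eqxx orbT /=.
by move=> /orP[]/eqP eb /orP[]/eqP ea; move: h2; rewrite ea eb eqxx.
Qed.

End Pairs.

(** Forests with two edges match the two kinds of quadratic relations of [pfb]: two leaves at one
    centre, or two disjoint edges. *)
Lemma good2 U : good U -> #|U| = 2 ->
  (exists i j k : 'I_n, [/\ (i < j)%N, (j < k)%N & U = [set (i, j); (i, k)]]) \/
  (exists a b, [/\ edge a, edge b, uniq [:: a.1; a.2; b.1; b.2] & U = [set a; b]]).
Proof.
move=> /good_star sU /eqP/cards2P[a [b [ab eU]]]; subst U.
have /starP[h1 h2] := sU.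
have aU : a \in [set a; b] by rewrite !inE eqxx.
have bU : b \in [set a; b] by rewrite !inE eqxx orbT.
have [aP bP] := (h1 _ aU, h1 _ bU); have [n22 n21 n12] := h2 _ _ aU bU ab.
have [e1|n11] := eqVneq a.1 b.1; last first.
  have oa : a.1 != a.2 := edge_offdiag aP; have ob : b.1 != b.2 := edge_offdiag bP.
  by right; exists a, b; split=> //=; rewrite !inE !negb_or n11 n12 n22 n21 oa ob.
left; case: a b ab aP bP e1 n22 {sU h1 h2 aU bU n21 n12} => [i j] [k l] /= _ ij il ik; subst k.
rewrite neq_ltn => /orP[jl|lj]; first by exists i, j, l.
by exists i, l, j; split; [exact: il|exact: lj|exact: setUC].
Qed.

Definition norm_edge e : E := if edge e then e else (e.2, e.1).
Definition edge_sign e : rat := if edge e then 1 else -1.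

Lemma norm_edgeP e : offdiag e -> edge (norm_edge e).
Proof.
rewrite /norm_edge /offdiag; case: ifP => //; rewrite /edge /= => /negbT.
by rewrite -leqNgt leq_eqVlt => /orP[/eqP/val_inj->|//]; rewrite eqxx.
Qed.

Lemma r_norm e : offdiag e -> r e = edge_sign e *: r (norm_edge e).
Proof.
rewrite /norm_edge /edge_sign; case: ifP => [_ _|_ eP]; first by rewrite scale1r.
by rewrite r_swap // -surjective_pairing scalerN scaleN1r opprK.
Qed.

Lemma edge_prod_norm s : all (@offdiag n) s -> pm (dprod s) (dprod [seq norm_edge e | e <- s]).
Proof.
elim: s => [_|e s IH /= /andP[eP sP]]; first by left.
rewrite !edge_prod_cons; apply: pm_mul (IH sP); rewrite (r_norm eP) /edge_sign.
by case: ifP => _; rewrite ?scale1r ?scaleN1r; [left|right].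
Qed.

Lemma edge_prod_monomial s : all (@offdiag n) s -> dprod s = 0 \/
  exists V, [/\ star V, #|V| = size s & pm (dprod s) (mon V)].
Proof.
move=> sP; have [||[V [sV cV pV _]]] := straighten r_sq r_anti r_tri (s := [seq norm_edge e | e <- s]).
- by apply/allP => _ /mapP[e es ->]; apply: norm_edgeP; exact: (allP sP).
- by move=> e0; left; case: (edge_prod_norm sP) => ->; rewrite e0 ?oppr0.
right; exists V; split=> //; first by rewrite cV size_map.
exact: pm_trans (edge_prod_norm sP) pV.
Qed.

Section Action.
Context (sigma : 'S_n) (phi : B -> B).
Hypothesis phiD : forall x y, phi (x + y) = phi x + phi y.
Hypothesis phiZ : forall a x, phi (a *: x) = a *: phi x.
Hypothesis phiM : forall x y, phi (x * y) = phi x * phi y.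
Hypothesis phi1 : phi 1 = 1.
Hypothesis phi_r : forall e, offdiag e -> phi (r e) = r (sigma e.1, sigma e.2).

Definition perm_pair e : E := (sigma e.1, sigma e.2).

Lemma perm_pair_offdiag e : offdiag e -> offdiag (perm_pair e).
Proof. by rewrite /offdiag /= (inj_eq perm_inj). Qed.

Lemma phi_edge_prod s : all (@offdiag n) s -> phi (dprod s) = dprod [seq perm_pair e | e <- s].
Proof.
elim: s => [_|e s IH /= /andP[eP sP]]; first by rewrite /edge_prod !big_nil.
by rewrite !edge_prod_cons phiM phi_r // IH.
Qed.

Lemma phi_mon S : star S -> phi (mon S) = 0 \/
  exists V, [/\ star V, #|V| = #|S| & pm (phi (mon S)) (mon V)].
Proof.
move=> sS; have oS : all (@offdiag n) (enum S).
  by apply/allP => e; rewrite mem_enum => /(star_edge sS)/edge_offdiag.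
rewrite /star_mon phi_edge_prod //.
have [||[V [sV cV pV]]] := @edge_prod_monomial [seq perm_pair e | e <- enum S].
- by apply/allP => _ /mapP[e es ->]; apply: perm_pair_offdiag; exact: (allP oS).
- by left.
by right; exists V; split=> //; rewrite cV size_map cardE.
Qed.

Definition act_coef S T : rat := if good S && good T then coord S (phi (mon T)) else 0.

Lemma act_coef_graded S T : good T -> act_coef S T != 0 -> good S /\ #|S| = #|T|.
Proof.
rewrite /act_coef => gT; case: ifP => [/andP[gS _]|_]; last by rewrite eqxx.
case: (phi_mon (good_star gT)) => [->|[V [sV cV pV]]]; first by rewrite coord0 eqxx.
by move=> /(coord_pm (good_star gS) sV pV) VS; rewrite -cV VS.
Qed.

Lemma phi_sum I (l : seq I) (F : I -> B) : phi (\sum_(i <- l) F i) = \sum_(i <- l) phi (F i).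
Proof.
have phi0 : phi 0 = 0 by have := phiZ 0 0; rewrite !scale0r.
exact: (big_morph _ phiD phi0).
Qed.

Lemma phi_mon_sum T : good T -> phi (mon T) = \sum_S act_coef S T *: mon S.
Proof.
move=> gT; have [e0|[V [sV cV pV]]] := phi_mon (good_star gT).
  by rewrite e0 big1 // => S _; rewrite /act_coef e0 coord0 if_same scale0r.
have gV : good V by rewrite /nclique sV -card_gt0 cV card_good.
rewrite (bigD1 V) //= {1}/act_coef gV gT -mon_expand // big1 ?addr0 // => S SV.
have [->|cn] := eqVneq (act_coef S T) 0; first by rewrite scale0r.
have [gS _] := act_coef_graded gT cn; move: cn; rewrite /act_coef gS gT.
by move=> /(coord_pm (good_star gS) sV pV) e; rewrite e eqxx in SV.
Qed.

(** Both sides are the coordinate at [U] of the image under [phi] of [mon S * mon T]. *)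
Lemma act_coef_mul S T U : good S -> good T ->
  \sum_X dual_coef S T X * act_coef U X =
  \sum_X \sum_Y act_coef X S * act_coef Y T * dual_coef X Y U.
Proof.
move=> gS gT; case gU: (good U); last first.
  rewrite !big1 // => X _; last by rewrite /act_coef gU mulr0.
  by rewrite big1 // => Y _; rewrite /dual_coef gU mulr0.
transitivity (coord U (phi (mon S * mon T))).
  rewrite (dual_coef_sum gS gT) phi_sum coord_sum; apply: eq_bigr => X _.
  rewrite phiZ coordZ /act_coef gU /=; case: ifP => // gX.
  by rewrite /dual_coef gX !mul0r.
rewrite phiM (phi_mon_sum gS) (phi_mon_sum gT) mulr_suml coord_sum.
apply: eq_bigr => X _; rewrite mulr_sumr coord_sum; apply: eq_bigr => Y _.
by rewrite -scalerAl -scalerAr scalerA coordZ /dual_coef gU.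
Qed.

End Action.

(** For maps that send monomials to monomials up to sign, a nonzero diagonal entry makes [mon S] an
    eigenvector with eigenvalue 1 or -1, and the inverse map has the same eigenvalue there. If
    neither entry is nonzero, both are 0. *)
Lemma act_diag S phi psi : star S ->
  (forall a x, phi (a *: x) = a *: phi x) -> (forall a x, psi (a *: x) = a *: psi x) ->
  cancel phi psi -> cancel psi phi ->
  (forall chi, chi = phi \/ chi = psi -> chi (mon S) = 0 \/
    exists V, [/\ star V, #|V| = #|S| & pm (chi (mon S)) (mon V)]) ->
  coord S (phi (mon S)) = coord S (psi (mon S)).
Proof.
move=> sS; wlog suff main : phi psi / coord S (phi (mon S)) != 0 -> (forall a x, phi (a *: x) = a *: phi x) -> (forall a x, psi (a *: x) = a *: psi x) ->
  cancel phi psi -> cancel psi phi ->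
  (forall chi, chi = phi \/ chi = psi -> chi (mon S) = 0 \/
    exists V, [/\ star V, #|V| = #|S| & pm (chi (mon S)) (mon V)]) ->
  coord S (phi (mon S)) = coord S (psi (mon S)).
  move=> fZ gZ fK gK h.
  have [f0|fn] := eqVneq (coord S (phi (mon S))) 0; last exact: main.
  have [g0|gn] := eqVneq (coord S (psi (mon S))) 0; first by rewrite f0 g0.
  by apply/esym/main => // chi [->|->]; apply: h; [right|left].
move=> fn fZ gZ fK gK h.
have [e0|[V [sV _ pV]]] := h phi (or_introl erefl); first by rewrite e0 coord0 eqxx in fn.
have VS := coord_pm sS sV pV fn; rewrite VS in pV.
case: pV => e.
  by rewrite -{2}e fK e coord_mon.
have fN : phi (- mon S) = mon S by rewrite -scaleN1r fZ e scaleN1r opprK.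
by rewrite e -{2}fN fK.
Qed.

End StarAlgebra.

Lemma alg_commDr (A : pzRingType) (x y z : A) :
  alg_comm x (y + z) = alg_comm x y + alg_comm x z.
Proof. by rewrite /alg_comm mulrDr mulrDl opprD addrACA. Qed.

(** * Functionals on the free algebra that vanish on the relations of [pfb] *)

Section FlatRelations.
Context (n : nat).
Local Notation E := ('I_n * 'I_n)%type.
Implicit Types (e f : E) (s t : seq E).

(** The two adjacent transpositions generate all orders of three vertices. *)
Lemma distinct_triple_ind (Q : 'I_n -> 'I_n -> 'I_n -> Prop) :
  (forall i j k : 'I_n, (i < j)%N -> (j < k)%N -> Q i j k) ->
  (forall i j k, Q i j k -> Q j i k) -> (forall i j k, Q i j k -> Q i k j) ->
  forall i j k, uniq [:: i; j; k] -> Q i j k.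
Proof.
move=> Qlt Q12 Q23 i j k; rewrite /= !inE negb_or andbT => /andP[/andP[ij ik] jk].
move: ij ik jk; rewrite -!val_eqE /= !neq_ltn.
move=> /orP[ij|ji] /orP[ik|ki] /orP[jk|kj].
- exact: Qlt.
- by apply/Q23; exact: Qlt.
- by have := ltn_trans (ltn_trans ij jk) ki; rewrite ltnn.
- by apply/Q23/Q12; exact: Qlt.
- by apply/Q12; exact: Qlt.
- by have := ltn_trans (ltn_trans ji ik) kj; rewrite ltnn.
- by apply/Q12/Q23; exact: Qlt.
- by apply/Q23/Q12/Q23; exact: Qlt.
Qed.

Context (H : seq E -> rat).

(** Antisymmetry of [H] in each letter makes the triple relation alternating in its three vertices
    and the commutator odd in each edge. So increasing triples and edges written in increasing order
    suffice. *)
Lemma rlin_ideal :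
  (forall s t e, H (s ++ (e.2, e.1) :: t) = - H (s ++ e :: t)) ->
  (forall s t (i j k : 'I_n), (i < j)%N -> (j < k)%N -> all (@offdiag n) s -> all (@offdiag n) t ->
    let G e f := H (s ++ e :: f :: t) in
    pair_comm (M := rat^o) G (i, j) (i, k) + pair_comm (M := rat^o) G (i, j) (j, k)
      + pair_comm (M := rat^o) G (i, k) (j, k) = 0) ->
  (forall s t e f, edge e -> edge f -> uniq [:: e.1; e.2; f.1; f.2] ->
    all (@offdiag n) s -> all (@offdiag n) t ->
    H (s ++ e :: f :: t) = H (s ++ f :: e :: t)) ->
  forall x, ideal_gen (pfb_rel (@rgen n)) x -> rlin H x = 0.
Proof.
move=> Hswap H3 H4; apply: flin_ideal => x u v; rewrite -[flin _ _]/(rlin _ _) !fword_rprod.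
have uP (w : seq (ord_pair n)) : all (@offdiag n) [seq val p | p <- w].
  by apply/allP => _ /mapP[p _ ->]; exact: (valP p).
have r1 e : rgp e = rprod [:: e] by rewrite /rprod big_seq1.
have r2 e f : rgp e * rgp f = rprod [:: e; f] by rewrite /rprod big_cons big_seq1.
set s := map _ u; set t := map _ v.
have sP : all (@offdiag n) s by exact: uP.
have tP : all (@offdiag n) t by exact: uP.
have m1 e : offdiag e -> rlin H (rprod s * rgp e * rprod t) = H (s ++ e :: t).
  by move=> eP; rewrite r1 rlin_mid //= eP.
pose G e f := H (s ++ e :: f :: t).
have m2 e f : offdiag e -> offdiag f ->
    rlin H (rprod s * (rgp e * rgp f) * rprod t) = G e f.
  by move=> eP fP; rewrite r2 rlin_mid //= eP fP.
pose T x y := rlin H (rprod s * alg_comm x y * rprod t).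
have TD a b c : T a (b + c) = T a b + T a c.
  by rewrite /T alg_commDr mulrDr mulrDl rlinD.
have TE e f : offdiag e -> offdiag f -> T (rgp e) (rgp f) = pair_comm (M := rat^o) G e f.
  move=> eP fP; rewrite /T /alg_comm mulrBr mulrBl rlinB.
  by congr (_ - _); exact: m2.
have Gl e f : G (e.2, e.1) f = - G e f by rewrite /G Hswap.
have Gr e f : G e (f.2, f.1) = - G e f.
  by have := Hswap (rcons s e) t f; rewrite !cat_rcons.
have swapl e f : pair_comm (M := rat^o) G (e.2, e.1) f = - pair_comm (M := rat^o) G e f.
  by rewrite /pair_comm Gl Gr opprB opprK addrC.
have swapr e f : pair_comm (M := rat^o) G e (f.2, f.1) = - pair_comm (M := rat^o) G e f.
  by rewrite /pair_comm Gl Gr opprB opprK addrC.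
have anti e f : pair_comm (M := rat^o) G f e = - pair_comm (M := rat^o) G e f.
  by rewrite /pair_comm opprB.
case=> [i j ij|i j k U|i j k l U].
- have ji : offdiag (j, i) by rewrite /offdiag eq_sym.
  rewrite mulrDr mulrDl rlinD; have := Hswap s t (i, j) => /= e.
  rewrite [X in X + _](m1 (i, j) ij) [X in _ + X](m1 (j, i) ji) e.
  exact: addrN.
- pose C (i j k : 'I_n) := pair_comm (M := rat^o) G (i, j) (i, k) + pair_comm (M := rat^o) G (i, j) (j, k)
      + pair_comm (M := rat^o) G (i, k) (j, k).
  have C12 a b c : C b a c = - C a b c.
    rewrite /C (swapl (a, b)) (swapl (a, b)) (anti (a, c) (b, c)) /=.
    by rewrite !opprD; congr (_ + _); rewrite addrC.
  have C23 a b c : C a c b = - C a b c.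
    rewrite /C (anti (a, b) (a, c)) (swapr (a, c) (b, c)) (swapr (a, b) (b, c)) /=.
    by rewrite !opprD addrAC.
  have Clt (a b c : 'I_n) : (a < b)%N -> (b < c)%N -> C a b c = 0 by move=> ab bc; exact: H3.
  have C0 : C i j k = 0.
    move: i j k U; apply: distinct_triple_ind => // a b c h; first by rewrite C12 h oppr0.
    by rewrite C23 h oppr0.
  move: U; rewrite /= !inE negb_or andbT => /andP[/andP[ij ik] jk].
  rewrite mulrDr mulrDl rlinD -[X in X + _]/(T (rgp (i, j)) (rgp (i, k) + rgp (j, k))).
  rewrite -[X in _ + X]/(T (rgp (i, k)) (rgp (j, k))) TD.
  by rewrite (TE (i, j) (i, k)) // (TE (i, j) (j, k)) // (TE (i, k) (j, k)).
- move: U; rewrite /= !inE !negb_or andbT => /and3P[/and3P[ij ik il] /andP[jk jl] kl].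
  rewrite -[LHS]/(T (rgp (i, j)) (rgp (k, l))) TE //.
  have far e f : edge e -> edge f -> uniq [:: e.1; e.2; f.1; f.2] ->
      pair_comm (M := rat^o) G e f = 0.
    by move=> eP fP U; apply/eqP; rewrite subr_eq0; apply/eqP; exact: H4.
  have lt (a b : 'I_n) : a != b -> (a < b)%N || (b < a)%N by rewrite -neq_ltn.
  have [/orP[lij|lji] /orP[lkl|llk]] := (lt _ _ ij, lt _ _ kl).
  + by apply: far; rewrite //= !inE !negb_or ij ik il jk jl kl.
  + rewrite -[(k, l)]/((l, k).2, (l, k).1) swapr far ?oppr0 //.
    by rewrite /= !inE !negb_or ij ik il jk jl eq_sym kl.
  + rewrite -[(i, j)]/((j, i).2, (j, i).1) swapl far ?oppr0 //.
    by rewrite /= !inE !negb_or eq_sym ij ik il jk jl kl.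
  + rewrite -[(i, j)]/((j, i).2, (j, i).1) swapl -[(k, l)]/((l, k).2, (l, k).1) swapr far ?oppr0 //.
    by rewrite /= !inE !negb_or eq_sym ij ik il jk jl eq_sym kl.
Qed.

End FlatRelations.

(** * Diagonal words: words of single edges *)

Section EdgeWords.
Context (n : nat).
Local Notation E := ('I_n * 'I_n)%type.
Implicit Types (e f : E) (s t v : seq E) (S T U V : {set E}).
Local Notation good := (nclique (@star_rel n)).
Local Notation deg := (fun S : {set E} => #|S|).
Local Notation W k := (words good deg k k).

Definition singles s : seq {set E} := [seq [set e] | e <- s].

Fixpoint ewords m : seq (seq E) :=
  if m is m'.+1 then [seq e :: t | e <- [seq e <- enum {: E} | edge e], t <- ewords m']
  else [:: [::]].

Lemma big_ewords (M : nmodType) m (F : seq E -> M) :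
  \sum_(t <- ewords m.+1) F t = \sum_(e | edge e) \sum_(t <- ewords m) F (e :: t).
Proof. by rewrite /= big_allpairs_dep big_filter big_enum_cond. Qed.

Lemma mem_ewords m t : (t \in ewords m) = (size t == m) && all (@edge n) t.
Proof.
elim: m t => [|m IH] t; first by rewrite inE; case: t.
apply/allpairsP/idP => [[[e v] /= [+ + ->]]|].
  by rewrite mem_filter IH /= eqSS => /andP[-> _] /andP[-> ->].
case: t => // e v; rewrite /= eqSS => /and3P[sv eP vP]; exists (e, v) => /=.
by rewrite mem_filter eP mem_enum IH sv vP.
Qed.

Lemma uniq_ewords m : uniq (ewords m).
Proof.
elim: m => //= m IH; apply: allpairs_uniq => //; first exact/filter_uniq/enum_uniq.
by move=> [e v] [f u] _ _ /= [-> ->].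
Qed.

Lemma singles_inj : injective singles.
Proof. exact/inj_map/set1_inj. Qed.

Lemma good_singles s : all good (singles s) = all (@edge n) s.
Proof. by rewrite all_map; apply: eq_all => e; rewrite /= good1. Qed.

Lemma degw_singles s : degw deg (singles s) = size s.
Proof. by elim: s => //= e s IH; rewrite /degw /= -/(degw deg (singles s)) IH cards1. Qed.

Lemma good_gt0 S : good S -> (0 < #|S|)%N.
Proof. by case/andP => _; rewrite card_gt0. Qed.

(** Each letter has degree at least one, so a word with as many letters as its degree consists of
    singletons. *)
Lemma words_singles k w : w \in W k -> size w = k -> exists2 t, t \in ewords k & w = singles t.
Proof.
rewrite mem_words //; last exact: good_gt0.
move=> /andP[gw /eqP dw] sw; move: dw; rewrite -{}sw.
elim: w gw => [_ _|S w IH gSw]; first by exists [::]; rewrite ?mem_ewords.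
have /andP[gS gw] : good S && all good w := gSw.
move=> dSw; have dw : (#|S| + degw deg w = (size w).+1)%N := dSw.
have := size_degw good_gt0 gw; have S0 := good_gt0 gS => sw.
have S1 : #|S| == 1%N by rewrite eqn_leq S0 andbT -(leq_add2r (degw deg w)) dw add1n ltnS.
case/cards1P: S1 gS dw => e -> gS; rewrite cards1 add1n => -[dw].
have [t tw ->] := IH gw dw; exists (e :: t); last by [].
move: tw gS; rewrite mem_ewords good1 => /andP[_ tP] eP.
by rewrite mem_ewords /= size_map eqxx eP.
Qed.

Lemma singles_words k t : t \in ewords k -> (singles t \in W k) && (size (singles t) == k).
Proof.
rewrite mem_ewords => /andP[/eqP<- tP]; rewrite mem_words //; last exact: good_gt0.
by rewrite good_singles tP degw_singles eqxx size_map eqxx.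
Qed.

Lemma big_words_singles (M : nmodType) k (F : seq {set E} -> M) :
  \sum_(w <- W k | size w == k) F w = \sum_(t <- ewords k) F (singles t).
Proof.
rewrite -big_filter -(big_map singles xpredT F); apply: perm_big.
apply: uniq_perm; first exact/filter_uniq/uniq_words.
  by rewrite map_inj_uniq ?uniq_ewords //; exact: singles_inj.
move=> w; rewrite mem_filter; apply/andP/mapP => [[/eqP sw /words_singles]|[t tk ->]].
  by move=> /(_ sw)[t tk ->]; exists t.
by have /andP[-> ->] := singles_words tk.
Qed.

Context (c : {set E} -> {set E} -> {set E} -> rat).
Hypothesis c_graded : forall S T U, good S -> good T -> c S T U != 0 ->
  good U /\ #|U| = (#|S| + #|T|)%N.

Let delta (w v : seq {set E}) : rat := (v == w)%:R.

Section Evaluation.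
Context (A : algType rat) (x : E -> A).
Hypothesis x_rel : forall U,
  \sum_(e | edge e) \sum_(f | edge f) c [set e] [set f] U *: (x e * x f) = 0.

(** The coboundary is a signed sum over the place of the merger; at a fixed place, summing over the
    two merged edges gives [x_rel] multiplied by the remaining letters on both sides. *)
Lemma big_cobar_ewords m (F : seq {set E} -> rat) :
  \sum_(t <- ewords m) cobar c F (singles t) *: \prod_(e <- t) x e = 0.
Proof.
elim: m F => [|[|m] IH] F; first by rewrite big_seq1 scale0r.
  by rewrite big_ewords big1 // => e _; rewrite big_seq1 scale0r.
pose F1 e u := F ([set e] :: u); pose F2 U u := F (U :: u).
pose mu t : A := \prod_(e <- t) x e.
have mu_cons e t : mu (e :: t) = x e * mu t by rewrite /mu big_cons.
have {}IH e : \sum_(f | edge f) \sum_(t <- ewords m) cobar c (F1 e) (singles (f :: t)) *: mu (f :: t) = 0.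
  by have := IH (F1 e); rewrite big_ewords.
(* Separates the merger of the first two letters from the others, which leave the first letter alone
   and vanish by induction. *)
transitivity (\sum_(e | edge e) \sum_(f | edge f) \sum_(t <- ewords m)
   ((\sum_U c [set e] [set f] U * F2 U (singles t)) *: (x e * x f * mu t)
    - x e * (cobar c (F1 e) (singles (f :: t)) *: mu (f :: t)))).
  rewrite big_ewords; apply: eq_bigr => e _; rewrite big_ewords; apply: eq_bigr => f _.
  apply: eq_bigr => t _.
  rewrite -[singles _]/[:: [set e], [set f] & singles t] cobar_cons scalerBl !big_cons.
  by rewrite -scalerAr !mulrA mu_cons mulrA.
transitivity (\sum_(t <- ewords m) \sum_U F2 U (singles t) *:
  ((\sum_(e | edge e) \sum_(f | edge f) c [set e] [set f] U *: (x e * x f)) * mu t)).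
  transitivity (\sum_(e | edge e) \sum_(f | edge f) \sum_(t <- ewords m)
     (\sum_U c [set e] [set f] U * F2 U (singles t)) *: (x e * x f * mu t)).
    have IH0 e : \sum_(f | edge f) \sum_(t <- ewords m)
        x e * (cobar c (F1 e) (singles (f :: t)) *: mu (f :: t)) = 0.
      rewrite -[RHS](mulr0 (x e)) -[X in _ = _ * X](IH e) mulr_sumr.
      by apply: eq_bigr => f _; rewrite mulr_sumr.
    apply: eq_bigr => e _; rewrite -[RHS]subr0 -[X in _ = _ - X](IH0 e) -sumrB.
    by apply: eq_bigr => f _; rewrite sumrB.
  under eq_bigr do rewrite exchange_big.
  rewrite exchange_big; apply: eq_bigr => t _.
  under eq_bigr do (under eq_bigr do rewrite scaler_suml; rewrite exchange_big).
  rewrite exchange_big; apply: eq_bigr => U _.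
  rewrite mulr_suml scaler_sumr; apply: eq_bigr => e _.
  rewrite mulr_suml scaler_sumr; apply: eq_bigr => f _.
  by rewrite -scalerAl scalerA mulrC.
by rewrite big1 // => t _; rewrite big1 // => U _; rewrite x_rel mul0r scaler0.
Qed.

End Evaluation.

(** Merging two single edges gives degree two and never the letter [e], so the differential can only
    step over the leading letter, whence the sign. *)
Lemma cobar_delta_cons e w y v : all good w -> all (@edge n) (y :: v) -> edge e ->
  cobar c (delta ([set e] :: w)) ([set y] :: singles v) =
  - ((y == e)%:R * cobar c (delta w) (singles v)).
Proof.
move=> gw /= /andP[yP vP] eP.
case: v vP => [|z v] vP; first by rewrite /= mulr0 oppr0.
have zP : edge z by case/andP: vP.
change (cobar c (delta ([set e] :: w)) [:: [set y], [set z] & singles v] =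
  - ((y == e)%:R * cobar c (delta w) ([set z] :: singles v))).
rewrite cobar_cons big1 ?sub0r => [|U _].
  congr (- _); rewrite -cobarZ; apply: eq_cobar => u.
  by rewrite /delta eqseq_cons (inj_eq set1_inj) -natrM mulnb.
have [->|cn] := eqVneq (c [set y] [set z] U) 0; first by rewrite mul0r.
have [] := c_graded _ _ cn; rewrite ?good1 // !cards1 /delta eqseq_cons => _ U2.
have [Ue|] := eqVneq U [set e]; last by rewrite mulr0.
by rewrite Ue cards1 in U2.
Qed.

(** In a word one letter short of the diagonal, only the letter [U] of degree two can come from a
    merger. The sign counts the letters before it. *)
Lemma big_cobar_delta s U t (phi : seq {set E} -> rat) :
  all (@edge n) s -> all (@edge n) t -> good U -> #|U| = 2 ->
  \sum_(v <- ewords (size s + size t).+2)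
      cobar c (delta (singles s ++ U :: singles t)) (singles v) * phi (singles v) =
  (-1) ^+ size s * \sum_(e | edge e) \sum_(f | edge f)
      c [set e] [set f] U * phi (singles s ++ [:: [set e], [set f] & singles t]).
Proof.
move=> sP tP gU U2; have base e f v : edge e -> cobar c (delta (U :: singles t)) (singles [:: e, f & v]) =
    c [set e] [set f] U * (v == t)%:R.
  move=> eP; have Ue : [set e] == U = false.
    by apply/negP => /eqP eU; rewrite -eU cards1 in U2.
  change (cobar c (delta (U :: singles t)) [:: [set e], [set f] & singles v] =
    c [set e] [set f] U * (v == t)%:R).
  rewrite cobar_cons (bigD1 U) // big1 => [|S /negPf SU]; last first.
    by rewrite /delta eqseq_cons SU mulr0.
  rewrite (eq_cobar _ (g := fun=> 0)) => [|u]; last by rewrite /delta eqseq_cons Ue.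
  by rewrite cobar0 subr0 /= addr0 /delta eqseq_cons eqxx (inj_eq singles_inj).
elim: s sP phi => [_|e s IH esP] phi.
  rewrite expr0 mul1r add0n big_ewords; apply: eq_bigr => e eP.
  rewrite big_ewords; apply: eq_bigr => f fP.
  rewrite (bigD1_seq t) ?uniq_ewords ?mem_ewords ?eqxx // big1 => [|v /negPf vt].
    by rewrite base // eqxx mulr1; exact: addr0.
  by rewrite base // vt mulr0 mul0r.
have /andP[eP sP] : edge e && all (@edge n) s := esP.
have -> : (size (e :: s) + size t)%N = (size s + size t).+1 by [].
set w := singles s ++ U :: singles t.
have gw : all good w by rewrite all_cat /= gU !good_singles sP.
have {IH sP esP} := IH sP (fun u => phi ([set e] :: u)); rewrite -/w.
set m := (size s + size t).+2 => IH.
transitivity (\sum_(y | edge y) \sum_(v <- ewords m)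
    - ((y == e)%:R * cobar c (delta w) (singles v) * phi ([set y] :: singles v))).
  rewrite big_ewords; apply: eq_bigr => y yP; apply: eq_big_seq => v.
  rewrite mem_ewords => /andP[_ vP].
  change (cobar c (delta ([set e] :: w)) ([set y] :: singles v) * phi ([set y] :: singles v) =
    - ((y == e)%:R * cobar c (delta w) (singles v) * phi ([set y] :: singles v))).
  by rewrite cobar_delta_cons //= ?yP // mulNr.
rewrite (bigD1 e) //= [X in _ + X]big1 ?addr0 => [|y /andP[_ /negPf ye]]; last first.
  by rewrite big1 // => v _; rewrite ye !mul0r oppr0.
under eq_bigr do rewrite eqxx mul1r.
by rewrite sumrN IH exprS mulN1r mulNr.
Qed.

Section ActDelta.
Context (q : {set E} -> {set E} -> rat) (theta : E -> E) (sg : E -> rat).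
Hypothesis q_graded : forall S T, good T -> q S T != 0 -> good S /\ #|S| = #|T|.
Hypothesis q1 : forall e f, edge e -> edge f -> q [set e] [set f] = sg e * (f == theta e)%:R.

(** By [q1] the matrix has one entry per row on single edges, so an indicator function goes to a
    multiple of an indicator function. *)
Lemma cobar_act_singles s t : all (@edge n) s -> all (@edge n) t ->
  cobar_act q (delta (singles s)) (singles t) = \prod_(e <- s) sg e * (t == map theta s)%:R.
Proof.
elim: t s => [|f t IH] [|e s].
- by rewrite big_nil mul1r /delta.
- by rewrite /= /delta mulr0.
- move=> _ _; rewrite [RHS]mulr0 /= big1 // => S _.
  by rewrite (eq_cobar_act _ (g := fun=> 0)) ?cobar_act0 ?mulr0.
rewrite /= => sP tP.
case/andP: sP => eP sP; case/andP: tP => fP tP.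
rewrite (bigD1 [set e]) //= [X in _ + X]big1 ?addr0 => [|S /negPf Se]; last first.
  rewrite (eq_cobar_act _ (g := fun=> 0)) ?cobar_act0 ?mulr0 // => v.
  by rewrite /delta eqseq_cons Se.
rewrite (eq_cobar_act _ (g := delta (singles s))) => [|v]; last first.
  by rewrite /delta eqseq_cons eqxx.
rewrite IH // q1 // big_cons [_ :: _ == _ :: _]eqseq_cons -mulnb natrM.
by ring.
Qed.

End ActDelta.
End EdgeWords.

Lemma rmorph_mulB (R R' : pzRingType) (f : {rmorphism R -> R'}) (a b c d : R) :
  f (a * b - c * d) = 0 -> f a * f b = f c * f d.
Proof. by rewrite rmorphB !rmorphM => /eqP; rewrite subr_eq0 => /eqP. Qed.

(** * The dual algebra *)

Section DualBasis.
Context (n : nat).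
Local Notation E := ('I_n * 'I_n)%type.
Implicit Types (e f : E) (s t : seq E) (S T U : {set E}).
Local Notation F := (free_alg rat (ord_pair n)).
Local Notation B := (pfb_dual n).
Local Notation star := (clique (@star_rel n)).

(* The least vertex of the block of v in the set partition of the forest U. *)
Definition block_min U v : 'I_n := if [pick e in U | e.2 == v] is Some e then e.1 else v.

Lemma block_min_edge U e : star U -> e \in U -> block_min U e.2 = e.1.
Proof.
move=> /starP[_ h] eU; rewrite /block_min; case: pickP => [f /andP[fU /eqP fe]|/(_ e)].
  have [->//|ef] := eqVneq e f; have [] := h _ _ eU fU ef.
  by rewrite fe eqxx.
by rewrite eU eqxx.
Qed.

Lemma block_min_notin U v : (forall e, e \in U -> e.2 != v) -> block_min U v = v.
Proof.
move=> h; rewrite /block_min; case: pickP => // f /andP[fU /eqP fe].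
by have := h _ fU; rewrite fe eqxx.
Qed.

Lemma block_min_center U e : star U -> e \in U -> block_min U e.1 = e.1.
Proof.
move=> /starP[h1 h] eU; apply: block_min_notin => f fU.
have [<-|ef] := eqVneq e f; first by rewrite neq_ltn; have := h1 _ eU; rewrite /edge => ->; rewrite orbT.
by have [_ _] := h _ _ eU fU ef; rewrite eq_sym.
Qed.

Lemma block_min_le U v : star U -> (block_min U v <= v)%N.
Proof.
move=> /starP[h1 _]; rewrite /block_min; case: pickP => // f /andP[fU /eqP <-].
by apply: ltnW; exact: h1.
Qed.

(* Setting to 0 the generators that join different blocks of U, and r_ij to
   x_i - x_j modulo the least vertices otherwise, is a morphism from the dual to
   an exterior algebra in #|U| variables. *)
Definition star_row U e : 'rV[rat]_#|U| :=
  \row_l ((block_min U e.1 == block_min U e.2)%:R *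
    ((e.1 == (enum_val l).2)%:R - (e.2 == (enum_val l).2)%:R)).

Lemma star_row_swap U e : star_row U (e.2, e.1) = - star_row U e.
Proof. by apply/rowP => l; rewrite !mxE /= eq_sym -mulrN opprB. Qed.

Lemma star_row0 U e : block_min U e.1 != block_min U e.2 -> star_row U e = 0.
Proof. by move=> /negPf h; apply/rowP => l; rewrite !mxE h mul0r. Qed.

(** Within a block this is [x_i - x_k = (x_i - x_j) + (x_j - x_k)]; if [k] lies in another block,
    both rows that involve [k] vanish. *)
Lemma star_row_l U (i j k : 'I_n) : block_min U i = block_min U j ->
  star_row U (i, k) = (block_min U i == block_min U k)%:R *: star_row U (i, j) + star_row U (j, k).
Proof. by move=> h; apply/rowP => l; rewrite !mxE /= h eqxx mul1r; ring. Qed.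

Lemma star_row_r U (i j k : 'I_n) : block_min U j = block_min U k ->
  star_row U (i, k) = (block_min U i == block_min U k)%:R *: star_row U (j, k) + star_row U (i, j).
Proof. by move=> h; apply/rowP => l; rewrite !mxE /= h eqxx mul1r; ring. Qed.

Definition star_det U s : rat := rowdet [seq star_row U e | e <- s].

(** If the edge common to both products joins different blocks, its row is 0. Otherwise the two
    other rows differ by a multiple of its row, which an alternating function does not see. *)
Lemma star_det_ideal U x :
  ideal_gen (pfb_dual_rel (@rgen n) (homog 1)) x -> rlin (star_det U) x = 0.
Proof.
apply: rlin_dual_ideal => [s t e|s t e f|s t i j k _ _|s t i j k _ _]; rewrite /star_det !map_cat /=.
- by rewrite star_row_swap rowdetN addrN.
- exact: rowdet_anti.
- have [h|h] := eqVneq (block_min U i) (block_min U j).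
    set u := map _ s; set v := map _ t; set a := star_row U (i, j).
    have := rowdet_linear (u ++ [:: a]) v (block_min U i == block_min U k)%:R a (star_row U (j, k)).
    by rewrite -(star_row_l _ h) -!catA rowdet_alt mulr0 add0r.
  by rewrite (star_row0 (e := (i, j))) // !rowdet0.
- have [h|h] := eqVneq (block_min U j) (block_min U k).
    by rewrite (star_row_r _ h) rowdet_linear rowdet_alt mulr0 add0r.
  rewrite (star_row0 (e := (j, k))) //; set u := map _ s; set v := map _ t.
  by rewrite -[u ++ _ :: _]cat_rcons -[u ++ star_row U (i, j) :: _]cat_rcons !rowdet0.
Qed.

(* The sign makes the coordinate of star_mon U equal to 1. *)
Definition star_coord U (x : B) : rat := (-1) ^+ #|U| * rlin (star_det U) (quot_repr x).

Lemma star_coord_pi U v : star_coord U (pfb_dual_pi v) = (-1) ^+ #|U| * rlin (star_det U) v.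
Proof.
congr (_ * _); apply/eqP; rewrite -subr_eq0 -rlinB; apply/eqP.
exact/star_det_ideal/ideal_gen_repr.
Qed.

Lemma star_coordD U x y : star_coord U (x + y) = star_coord U x + star_coord U y.
Proof.
elim/quot_piW: x => x; elim/quot_piW: y => y.
change (star_coord U (pfb_dual_pi x + pfb_dual_pi y) = star_coord U (pfb_dual_pi x) + star_coord U (pfb_dual_pi y)).
by rewrite -(raddfD (@pfb_dual_pi n)) !star_coord_pi rlinD mulrDr.
Qed.

Lemma star_coordZ U a x : star_coord U (a *: x) = a * star_coord U x.
Proof.
elim/quot_piW: x => x.
change (star_coord U (a *: pfb_dual_pi x) = a * star_coord U (pfb_dual_pi x)).
have <- : pfb_dual_pi (a *: x) = a *: pfb_dual_pi x by exact: (linearZ_LR (@pfb_dual_pi n)).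
by rewrite !star_coord_pi rlinZ mulrCA.
Qed.

Definition rdual e : B := pfb_dual_pi (rgp e).

Lemma edge_prodE s : edge_prod rdual s = pfb_dual_pi (rprod s).
Proof. by rewrite /rprod rmorph_prod. Qed.

Lemma star_coord_edge_prod U s : all (@offdiag n) s ->
  star_coord U (edge_prod rdual s) = (-1) ^+ #|U| * star_det U s.
Proof. by move=> sP; rewrite edge_prodE star_coord_pi rlin_rprod. Qed.

(** For [S = U] the rows are the negatives of the unit vectors. For another forest of the same size,
    some edge joins different blocks of [U] and its row is 0. *)
Lemma star_coord_mon U S : star U -> star S -> star_coord U (star_mon rdual S) = (S == U)%:R.
Proof.
move=> sU sS; have [hS1 hS2] := starP _ sS; have [hU1 hU2] := starP _ sU.
rewrite star_coord_edge_prod; last by apply/allP => e; rewrite mem_enum => /hS1/edge_offdiag.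
rewrite /star_det; case: (eqVneq S U) => [->|SU].
  rewrite /rowdet size_map -cardE eqxx.
  have -> : (\matrix_(i < #|U|) nth 0 [seq star_row U e | e <- enum U] i) = (-1)%:M.
    apply/matrixP => i l; rewrite !mxE.
    have [e0 _] : exists e, e \in U by exists (enum_val i); exact: enum_valP.
    rewrite (nth_map e0) -?cardE // -(enum_val_nth e0) !mxE.
    rewrite block_min_edge ?enum_valP // block_min_center ?enum_valP // eqxx mul1r.
    have [->|il] := eqVneq i l.
      rewrite eqxx (_ : _ == _ = false) ?sub0r ?mulr1n //.
      by have := edge_offdiag (hU1 _ (enum_valP l)); rewrite /offdiag => /negPf.
    have [] := hU2 _ _ (enum_valP i) (enum_valP l); first by apply: contraNneq il => /enum_val_inj ->.
    by move=> /negPf-> _ /negPf->; rewrite subrr mulr0n.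
  by rewrite det_scalar -exprMn mulrNN mulr1 expr1n.
have [SUc|/negPf SUc] := eqVneq #|S| #|U|; last first.
  by rewrite /rowdet size_map -cardE SUc mulr0.
(* If all edges of [S] stayed inside blocks of [U], the two forests would coincide: [J] collects the
   leaves, and the centre of a leaf is recovered as the least vertex of its block. *)
have [/allP h|/allPn[e eS he]] := boolP (all (fun e => block_min U e.1 == block_min U e.2) (enum S)).
  case/eqP: SU; apply/eqP; rewrite eqEcard SUc leqnn andbT.
  pose J (A : {set E}) := [set e.2 | e in A].
  have cJ A : star A -> #|J A| = #|A|.
    move=> /starP[_ hA]; rewrite card_in_imset // => e f eA fA ef.
    by apply: contra_eq ef => /(hA _ _ eA fA)[].
  have JP A e : star A -> e \in A -> e.1 \notin J A.
    move=> /starP[hA1 hA2] eA; apply/imsetP => -[f fA ef].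
    have [fe|] := eqVneq e f; last by move=> /(hA2 _ _ eA fA)[_ _]; rewrite ef eqxx.
    by have := edge_offdiag (hA1 _ eA); rewrite /offdiag ef fe eqxx.
  have JU v : v \notin J U -> block_min U v = v.
    move=> vJ; apply: block_min_notin => e eU; apply: contraNneq vJ => <-.
    exact: imset_f.
  (* A leaf of [S] that is not a leaf of [U] is the least vertex of its block in [U], but its
     smaller centre in [S] lies in the same block. Equality follows by counting. *)
  have JSU : J S = J U.
    apply/eqP; rewrite eqEcard !cJ // SUc leqnn andbT; apply/subsetP => _ /imsetP[e eS ->].
    apply: contraT => /JU eU; have := h e; rewrite mem_enum eS eU => /(_ isT)/eqP eE.
    by have := block_min_le e.1 sU; rewrite eE leqNgt; have := hS1 _ eS; rewrite /edge => ->.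
  apply/subsetP => e eS; have := h e; rewrite mem_enum eS => /(_ isT)/eqP.
  rewrite JU; last by rewrite -JSU JP.
  have : e.2 \in J U by rewrite -JSU; exact: imset_f.
  case/imsetP => f fU ef; rewrite ef block_min_edge // => ef1.
  by rewrite [e]surjective_pairing ef ef1 -surjective_pairing.
have [s [t ->]] : exists s t, enum S = s ++ e :: t.
  by case/splitPr: eS => s t; exists s, t.
by rewrite map_cat /= star_row0 // rowdet0 mulr0.
Qed.

Lemma dual_relE x : pfb_dual_rel (@rgen n) (homog 1) x -> pfb_dual_pi x = 0.
Proof. exact: quot_pi_rel. Qed.

Lemma rdualN (i j : 'I_n) : i != j -> rdual (j, i) = - rdual (i, j).
Proof.
move=> ij; apply/eqP; rewrite -addr_eq0 addrC -(raddfD (@pfb_dual_pi n)).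
by apply/eqP/dual_relE; exact: pfb_dual_rel_antisym.
Qed.

Lemma homog_sq v : homog 1 v -> pfb_dual_pi v * pfb_dual_pi v = 0 :> B.
Proof.
by move=> hv; rewrite -(rmorphM (@pfb_dual_pi n)); apply: dual_relE; exact: pfb_dual_rel_ext.
Qed.

Lemma rdual_sq e : rdual e * rdual e = 0.
Proof. exact/homog_sq/homog_rgen. Qed.

Lemma rdual_anti e f : rdual f * rdual e = - (rdual e * rdual f).
Proof.
have anti (R : pzRingType) (x y : R) : x * x = 0 -> y * y = 0 -> (x + y) * (x + y) = 0 ->
    y * x = - (x * y).
  move=> xx yy; rewrite mulrDl !mulrDr xx yy add0r addr0 => /eqP.
  by rewrite addrC addr_eq0 => /eqP.
apply: anti; try exact: rdual_sq.
have <- : pfb_dual_pi (rgp e + rgp f) = rdual e + rdual f by exact: (raddfD (@pfb_dual_pi n)).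
by apply: homog_sq; apply: homogD; exact: homog_rgen.
Qed.

Lemma rdual_ij (i j k : 'I_n) : (i < j)%N -> (j < k)%N ->
  rdual (i, j) * rdual (j, k) = rdual (i, j) * rdual (i, k).
Proof.
move=> ij jk; have e := dual_relE (pfb_dual_rel_ij (@rgen n) (homog 1) ij jk).
exact/esym/(rmorph_mulB e).
Qed.

Lemma rdual_ik (i j k : 'I_n) : (i < j)%N -> (j < k)%N ->
  rdual (i, k) * rdual (j, k) = rdual (i, j) * rdual (j, k).
Proof.
move=> ij jk; have e := dual_relE (pfb_dual_rel_ik (@rgen n) (homog 1) ij jk).
exact: (rmorph_mulB e).
Qed.

End DualBasis.

(** * The action of permutations on the dual *)

Section DualAction.
Context (n : nat).
Local Notation E := ('I_n * 'I_n)%type.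
Implicit Types (e f : E) (s t : seq E) (S T U : {set E}).
Local Notation F := (free_alg rat (ord_pair n)).
Local Notation B := (pfb_dual n).
Local Notation rdual := (@rdual n).
Local Notation star := (clique (@star_rel n)).

(** The defining relations solved for the normal form, the star at the least vertex. *)
Lemma rdual_tri (i j k : 'I_n) : (i < j)%N -> (j < k)%N ->
  rdual (i, j) * rdual (j, k) = rdual (i, j) * rdual (i, k) /\
  rdual (i, k) * rdual (j, k) = rdual (i, j) * rdual (i, k).
Proof.
move=> ij jk; have h1 := rdual_ik ij jk; have h2 := rdual_ij ij jk.
by split; [exact h2|rewrite h1; exact h2].
Qed.

Lemma dual_act_rdual (sigma : 'S_n) e : offdiag e ->
  pfb_dual_act sigma (rdual e) = rdual (sigma e.1, sigma e.2).
Proof. exact: pfb_dual_act_rgen. Qed.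

Lemma dual_actD (sigma : 'S_n) (x y : B) :
  pfb_dual_act sigma (x + y) = pfb_dual_act sigma x + pfb_dual_act sigma y.
Proof.
have [h _ _] := pfb_dual_act_morphism sigma.
have h0 : pfb_dual_act sigma 0 = 0 by have := h 0 0; rewrite !subrr.
have hN z : pfb_dual_act sigma (- z) = - pfb_dual_act sigma z by have := h 0 z; rewrite h0 !sub0r.
by have := h x (- y); rewrite opprK hN opprK.
Qed.

Lemma dual_actM (sigma : 'S_n) (x y : B) :
  pfb_dual_act sigma (x * y) = pfb_dual_act sigma x * pfb_dual_act sigma y.
Proof. by have [_ [_ ->] _] := pfb_dual_act_morphism sigma. Qed.

Lemma dual_act1 (sigma : 'S_n) : pfb_dual_act sigma 1 = 1 :> B.
Proof. by have [_ [-> _] _] := pfb_dual_act_morphism sigma. Qed.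

Lemma dual_actZ (sigma : 'S_n) a (x : B) :
  pfb_dual_act sigma (a *: x) = a *: pfb_dual_act sigma x.
Proof. by have [_ _ ->] := pfb_dual_act_morphism sigma. Qed.

Lemma dual_span_ind (P : B -> Prop) :
  P 0 -> (forall x y, P x -> P y -> P (x + y)) -> (forall a x, P x -> P (a *: x)) ->
  (forall s, all (@offdiag n) s -> P (edge_prod rdual s)) -> forall x, P x.
Proof.
move=> P0 PD PZ Ps; elim/quot_piW => x; change (P (pfb_dual_pi x)).
elim/fword_ind: x => [|x y hx hy|a w].
- by rewrite (raddf0 (@pfb_dual_pi n)).
- by rewrite (raddfD (@pfb_dual_pi n)); exact: PD.
have -> : pfb_dual_pi (a *: fword rat w) = a *: pfb_dual_pi (fword rat w) by exact: (linearZ_LR (@pfb_dual_pi n)).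
apply: PZ; rewrite fword_rprod -edge_prodE; apply: Ps.
by apply/allP => _ /mapP[p _ ->]; exact: (valP p).
Qed.

Lemma dual_act_edge_prod (sigma : 'S_n) s : all (@offdiag n) s ->
  pfb_dual_act sigma (edge_prod rdual s) = edge_prod rdual [seq perm_pair sigma e | e <- s].
Proof.
apply: phi_edge_prod; [exact: dual_actM|exact: dual_act1|exact: dual_act_rdual].
Qed.

Lemma dual_actK (sigma : 'S_n) : cancel (@pfb_dual_act n sigma) (pfb_dual_act sigma^-1).
Proof.
apply: dual_span_ind => [|x y hx hy|a x hx|s sP].
- have z (tau : 'S_n) : pfb_dual_act tau 0 = 0 :> B.
    by have := dual_actZ tau 0 0; rewrite !scale0r.
  by rewrite !z.
- rewrite (dual_actD sigma x y) (dual_actD sigma^-1); exact (congr2 +%R hx hy).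
- rewrite (dual_actZ sigma a x) (dual_actZ sigma^-1); exact (congr1 ( *:%R a) hx).
rewrite dual_act_edge_prod // dual_act_edge_prod.
  rewrite -map_comp; congr edge_prod; apply: map_id_in => -[i j] _.
  by rewrite /perm_pair /= !permK.
by apply/allP => _ /mapP[e es ->]; apply: perm_pair_offdiag; exact: (allP sP).
Qed.

End DualAction.

(** * Traces computed in a dual basis *)

Section DualTrace.
Context (K : fieldType) (V : lmodType K) (I : finType) (P : pred I) (b : I -> V).
Context (coef : I -> V -> K) (U : set V) (act : V -> V).
Hypothesis coefD : forall i x y, coef i (x + y) = coef i x + coef i y.
Hypothesis coefZ : forall i a x, coef i (a *: x) = a * coef i x.
Hypothesis coef_b : forall i j, P i -> P j -> coef i (b j) = (j == i)%:R.
Hypothesis U_b : forall i, P i -> U (b i).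
Hypothesis U_act : forall i, P i -> U (act (b i)).
Hypothesis U_span : forall u, U u -> u = \sum_(i | P i) coef i u *: b i.

Lemma trace_dual_basis : is_trace_on U act (\sum_(i | P i) coef i (act (b i))).
Proof.
pose d := #|P|; pose e (i : 'I_d) : I := enum_val i.
have eP i : P (e i) by exact: (enum_valP i).
have big_e (M : nmodType) (F : I -> M) : \sum_(i | P i) F i = \sum_i F (e i).
  exact: (big_enum_val (A := P)).
have coef0 i : coef i 0 = 0 by rewrite -(scale0r 0) coefZ mul0r.
exists d, (fun i => b (e i)), (\matrix_(i, j) coef (e j) (act (b (e i)))); split.
- split=> [i|c c0 i|u /U_span uE]; first exact: U_b.
    have := congr1 (coef (e i)) c0; rewrite coef0 (big_morph _ (coefD _) (coef0 _)).
    rewrite (bigD1 i) //= big1 => [|j ji]; last first.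
      by rewrite coefZ coef_b // (inj_eq enum_val_inj) (negPf ji) mulr0.
    by rewrite addr0 coefZ coef_b // eqxx mulr1.
  by exists (fun i => coef (e i) u); rewrite {1}uE big_e.
- move=> i; rewrite {1}(U_span (U_act (eP i))) big_e.
  by apply: eq_bigr => j _; rewrite mxE.
by rewrite big_e /mxtrace; apply: eq_bigr => i _; rewrite mxE.
Qed.

End DualTrace.

Section StarSpan.
Context (n : nat).
Local Notation E := ('I_n * 'I_n)%type.
Implicit Types (S T U : {set E}).
Local Notation star := (clique (@star_rel n)).
Context (B : algType rat) (r : E -> B) (coord : {set E} -> B -> rat).
Hypothesis coordD : forall U x y, coord U (x + y) = coord U x + coord U y.
Hypothesis coordZ : forall U a x, coord U (a *: x) = a * coord U x.
Local Notation mon := (star_mon r).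
Hypothesis coord_mon : forall U S, star U -> star S -> coord U (mon S) = (S == U)%:R.

(** Membership in the span of the monomials of degree [k], with the coordinate functionals as
    canonical coefficients. *)
Definition star_span k x := x = \sum_(S | star S && (#|S| == k)) coord S x *: mon S.

Lemma star_span0 k : star_span k 0.
Proof.
rewrite /star_span big1 // => S _.
by rewrite -[X in coord S X](scale0r (0 : B)) coordZ mul0r scale0r.
Qed.

Lemma star_spanD k x y : star_span k x -> star_span k y -> star_span k (x + y).
Proof.
rewrite /star_span => hx hy; rewrite {1}hx {1}hy -big_split.
by apply: eq_bigr => S _; rewrite coordD scalerDl.
Qed.

Lemma star_spanZ k a x : star_span k x -> star_span k (a *: x).
Proof.
rewrite /star_span => hx; rewrite {1}hx scaler_sumr.
by apply: eq_bigr => S _; rewrite coordZ scalerA.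
Qed.

Lemma star_span_pm k x :
  (x = 0 \/ exists V, [/\ star V, #|V| = k & pm x (mon V)]) -> star_span k x.
Proof.
case=> [->|[V [sV cV xV]]]; first exact: star_span0.
have mV : star_span k (mon V).
  rewrite /star_span (bigD1 V) ?sV ?cV //= coord_mon // eqxx scale1r big1 ?addr0 //.
  by move=> S /andP[/andP[sS _] SV]; rewrite coord_mon // eq_sym (negPf SV) scale0r.
by case: xV => -> //; rewrite -scaleN1r; exact: star_spanZ.
Qed.

End StarSpan.

(** * The character of the dual as a sum over star forests *)

Section DualCharacter.
Context (n : nat).
Local Notation E := ('I_n * 'I_n)%type.
Implicit Types (e f : E) (s t : seq E) (S T U : {set E}).
Local Notation B := (pfb_dual n).
Local Notation rdual := (@rdual n).
Local Notation star := (clique (@star_rel n)).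
Local Notation coord := (@star_coord n).

Lemma star_offdiag S : star S -> all (@offdiag n) (enum S).
Proof. by case/starP => h _; apply/allP => e; rewrite mem_enum => /h/edge_offdiag. Qed.

Lemma dual_monomial s : all (@offdiag n) s -> edge_prod rdual s = 0 \/
  exists V, [/\ star V, #|V| = size s & pm (edge_prod rdual s) (star_mon rdual V)].
Proof.
exact: (edge_prod_monomial (@rdual_sq n) (@rdual_anti n) (@rdual_tri n) (@rdualN n)).
Qed.

Lemma dual_component_edge_prod s : all (@offdiag n) s -> @pfb_dual_component n (size s) (edge_prod rdual s).
Proof. by move=> _; rewrite edge_prodE; exists (rprod s) => //; exact: homog_rprod. Qed.

Lemma dual_component_span k x : @pfb_dual_component n k x -> star_span rdual coord k x.
Proof.
case=> v hv <-; elim/homog_ind: v / hv => [|x1 y hx hy|a w wk].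
- rewrite (raddf0 (@pfb_dual_pi n)); apply: star_span0; exact: star_coordZ.
- rewrite (raddfD (@pfb_dual_pi n)); exact: star_spanD (@star_coordD n) _ _ _ hx hy.
have -> : pfb_dual_pi (a *: fword rat w) = a *: pfb_dual_pi (fword rat w) by exact: (linearZ_LR (@pfb_dual_pi n)).
apply: star_spanZ; first exact: star_coordZ.
apply: (star_span_pm (@star_coordZ n) (@star_coord_mon n)); rewrite fword_rprod -edge_prodE -wk.
have := @dual_monomial [seq val p | p <- w]; rewrite size_map; apply.
by apply/allP => _ /mapP[p _ ->]; exact: (valP p).
Qed.

Lemma dual_phi_mon (sigma : 'S_n) S : star S -> pfb_dual_act sigma (star_mon rdual S) = 0 \/
  exists V, [/\ star V, #|V| = #|S| & pm (pfb_dual_act sigma (star_mon rdual S)) (star_mon rdual V)].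
Proof.
exact: (phi_mon (@rdual_sq n) (@rdual_anti n) (@rdual_tri n) (@rdualN n)
  (dual_actM sigma) (dual_act1 sigma) (@dual_act_rdual n sigma)).
Qed.

Lemma dual_diag (sigma : 'S_n) S : star S ->
  coord S (pfb_dual_act sigma^-1 (star_mon rdual S)) = coord S (pfb_dual_act sigma (star_mon rdual S)).
Proof.
move=> sS; apply: (act_diag (@star_coordZ n) (@star_coord_mon n)) => //.
- exact: dual_actZ.
- exact: dual_actZ.
- by have := @dual_actK n sigma^-1; rewrite invgK.
- exact: dual_actK.
by move=> chi [->|->]; exact: dual_phi_mon.
Qed.

Lemma pfb_dual_charE (sigma : 'S_n) k : pfb_dual_char sigma k =
  \sum_(S | star S && (#|S| == k)) coord S (pfb_dual_act sigma (star_mon rdual S)).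
Proof.
have [_ _ hZ] := pfb_dual_act_morphism sigma.
apply: (is_trace_on_uniq _ (pfb_dual_charP sigma k)).
  by move=> a x y; rewrite dual_actD hZ.
have cE S : star S && (#|S| == k) -> @pfb_dual_component n k (star_mon rdual S).
  case/andP=> sS /eqP <-; rewrite cardE; apply: dual_component_edge_prod; exact: star_offdiag.
apply: trace_dual_basis => //.
- exact: star_coordD.
- exact: star_coordZ.
- by move=> S T /andP[sS _] /andP[sT _]; exact: star_coord_mon.
- move=> S /andP[sS /eqP <-]; rewrite cardE dual_act_edge_prod; last exact: star_offdiag.
  rewrite -(size_map (perm_pair sigma)); apply: dual_component_edge_prod.
  by apply/allP => _ /mapP[e es ->]; apply: perm_pair_offdiag; exact: (allP (star_offdiag sS)).
- exact: dual_component_span.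
Qed.

Lemma pfb_dual_char0 (sigma : 'S_n) : pfb_dual_char sigma 0 = 1.
Proof.
rewrite pfb_dual_charE (big_pred1 set0) => [|S]; last first.
  by rewrite cards_eq0 /=; case: eqP => [->|_]; rewrite ?andbF ?clique0.
have -> : star_mon rdual set0 = 1 by rewrite /star_mon /edge_prod enum_set0 big_nil.
rewrite dual_act1; have := @star_coord_mon n set0 set0 (clique0 _) (clique0 _).
by rewrite eqxx /star_mon /edge_prod enum_set0 big_nil.
Qed.

End DualCharacter.

(** * The flat braid algebra *)

Section DualCobar.
Context (n : nat).
Local Notation E := ('I_n * 'I_n)%type.
Implicit Types (e f : E) (s t : seq E) (S T U : {set E}).
Local Notation rdual := (@rdual n).
Local Notation good := (nclique (@star_rel n)).
Local Notation coord := (@star_coord n).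
Local Notation c := (dual_coef rdual coord).
Local Notation deg := (fun S : {set E} => #|S|).

Lemma dual_c_flag S T U : good S -> good T ->
  c S T U != flag_coef (@star_rel n) (dual_eps rdual coord) S T U ->
  [/\ good U, #|U| = (#|S| + #|T|)%N & (wt (@height n) S + wt (@height n) T < wt (@height n) U)%N].
Proof.
exact: (dual_coef_flag (@rdual_sq n) (@rdual_anti n) (@rdual_tri n) (@star_coordZ n) (@star_coord_mon n)).
Qed.

Lemma dual_c_graded S T U : good S -> good T -> c S T U != 0 ->
  good U /\ #|U| = (#|S| + #|T|)%N.
Proof. exact: (c_graded dual_c_flag). Qed.

Lemma dual_cA S T U V : good S -> good T -> good U ->
  \sum_X c S T X * c X U V = \sum_X c T U X * c S X V.
Proof.
exact: (dual_coefA (@rdual_sq n) (@rdual_anti n) (@rdual_tri n) (@star_coordD n) (@star_coordZ n) (@star_coord_mon n)).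
Qed.

Lemma dual_exact k (F : seq {set E} -> rat) :
  (forall w, all good w -> F w != 0 -> degw deg w = k /\ (size w < k)%N) ->
  (forall w, all good w -> cobar c F w = 0) ->
  exists G, forall w, all good w -> cobar c G w = F w.
Proof.
move=> hF F0; have [||||G _ GF] := cobar_exact (r := @star_rel n) (eps := dual_eps rdual coord)
  _ _ _ dual_c_flag dual_cA (k := k) (f := F) _ F0.
- exact: dual_eps0 (@star_coord_mon n).
- exact: (dual_eps_neq0 (@rdual_anti n) (@star_coordZ n) (@star_coord_mon n)).
- exact: (dual_epsA (@rdual_anti n) (@star_coordZ n) (@star_coord_mon n)).
- by move=> w gw Fw; rewrite addn0; exact: hF.
by exists G.
Qed.

Section Triple.
Context (M : lmodType rat) (G : E -> E -> M).
Local Notation pairs U := (\sum_(e | edge e) \sum_(f | edge f) c [set e] [set f] U *: G e f).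

Lemma dual_pairs_triple (i j k : 'I_n) : (i < j)%N -> (j < k)%N ->
  exists2 a : rat, a != 0 & pairs [set (i, j); (i, k)] =
    a *: (pair_comm G (i, j) (i, k) + pair_comm G (i, j) (j, k) + pair_comm G (i, k) (j, k)).
Proof.
exact: (pairs_triple (@rdual_sq n) (@rdual_anti n) (@rdual_tri n) (@star_coordZ n) (@star_coord_mon n)).
Qed.

Lemma dual_pairs_far (a b : E) : edge a -> edge b -> uniq [:: a.1; a.2; b.1; b.2] ->
  exists2 x : rat, x != 0 & pairs [set a; b] = x *: pair_comm G a b.
Proof.
exact: (pairs_far (@rdual_sq n) (@rdual_anti n) (@rdual_tri n) (@star_coordZ n) (@star_coord_mon n)).
Qed.

(** By [good2] the forests with two edges give only the two kinds of relations assumed; for any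
    other [U] the structure constants vanish by degree. *)
Lemma dual_pairs0 :
  (forall i j k : 'I_n, (i < j)%N -> (j < k)%N ->
    pair_comm G (i, j) (i, k) + pair_comm G (i, j) (j, k) + pair_comm G (i, k) (j, k) = 0) ->
  (forall a b, edge a -> edge b -> uniq [:: a.1; a.2; b.1; b.2] -> pair_comm G a b = 0) ->
  forall U, pairs U = 0.
Proof.
move=> h3 h4 U; have [/andP[gU /eqP U2]|nU] := boolP (good U && (#|U| == 2%N)).
  have [[i [j [k [ij jk ->]]]]|[a [b [aP bP ab ->]]]] := good2 gU U2.
    by have [a _ ->] := dual_pairs_triple ij jk; rewrite h3 ?scaler0.
  by have [x _ ->] := dual_pairs_far aP bP ab; rewrite h4 ?scaler0.
rewrite big1 // => e eP; rewrite big1 // => f fP.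
have [->|cn] := eqVneq (c [set e] [set f] U) 0; first by rewrite scale0r.
have [||gU U2] := dual_c_graded _ _ cn; rewrite ?good1 //.
by rewrite gU U2 !cards1 in nU.
Qed.

End Triple.

(** On increasing edges a permutation has a signed permutation matrix, whose inverse is its
    transpose. *)
Lemma perm_pair_swap (sigma : 'S_n) e f : edge e -> edge f ->
  edge_sign (perm_pair sigma^-1 f) * (norm_edge (perm_pair sigma^-1 f) == e)%:R =
  edge_sign (perm_pair sigma e) * (f == norm_edge (perm_pair sigma e))%:R.
Proof.
have ppE a b : (perm_pair sigma^-1 a == b) = (a == perm_pair sigma b).
  by case: a b => [i j] [k l]; rewrite !xpair_eqE /= !(canF_eq (permKV sigma)).
have swE a b : ((perm_pair sigma^-1 a).2, (perm_pair sigma^-1 a).1) == b =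
    (a == ((perm_pair sigma b).2, (perm_pair sigma b).1)).
  case: a b => [i j] [k l]; rewrite !xpair_eqE /= !(canF_eq (permKV sigma)).
  by rewrite andbC.
have lt (a : E) : edge a -> edge (a.2, a.1) = false.
  by rewrite /edge /= => /ltnW; rewrite leqNgt => /negPf.
move=> eP fP; rewrite /norm_edge /edge_sign.
have [p|p] := boolP (edge (perm_pair sigma^-1 f)); have [g|g] := boolP (edge (perm_pair sigma e)).
- by rewrite ppE.
- have -> : (perm_pair sigma^-1 f == e) = false.
    by rewrite ppE; apply/negP => /eqP h; rewrite -h fP in g.
  rewrite -swE; case: eqP => [h|_]; last by rewrite !mulr0.
  by have := lt _ p; rewrite h eP.
- rewrite -ppE swE; case: eqP => [h|_].
    by have := lt _ g; rewrite -h fP.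
  case: eqP => [h|_]; last by rewrite !mulr0.
  by rewrite h eP in p.
- by rewrite swE.
Qed.

(** So the contragredient of the inverse permutation, taken on generators of the dual, is the
    permutation itself on generators of [pfb]. *)
Lemma dual_act_edge (sigma : 'S_n) e f : edge e -> edge f ->
  act_coef rdual coord (pfb_dual_act sigma^-1) [set e] [set f] =
  edge_sign (perm_pair sigma e) * (f == norm_edge (perm_pair sigma e))%:R.
Proof.
move=> eP fP; rewrite -perm_pair_swap // /act_coef !good1 eP fP /=.
have fo := edge_offdiag fP; have po := perm_pair_offdiag sigma^-1 fo.
rewrite mon1 dual_act_rdual // -/(perm_pair _ f) (r_norm (@rdualN n) po) star_coordZ -mon1.
have nP := norm_edgeP po; rewrite star_coord_mon ?star1 //.
by rewrite (inj_eq set1_inj).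
Qed.

End DualCobar.

(** * Products rewritten over increasing edges *)

Section SignedProducts.
Context (n : nat) (A : algType rat) (x : 'I_n * 'I_n -> A).
Hypothesis x_swap : forall i j : 'I_n, i != j -> x (j, i) = - x (i, j).
Implicit Types (s t : seq ('I_n * 'I_n)).

Lemma edge_prod_sign s : all (@offdiag n) s ->
  edge_prod x s = (\prod_(e <- s) edge_sign e) *: edge_prod x [seq norm_edge e | e <- s].
Proof.
elim: s => [_|e s IH /= /andP[eP sP]]; first by rewrite /edge_prod !big_nil scale1r.
by rewrite !edge_prod_cons big_cons IH // (r_norm x_swap eP) -scalerAl -scalerAr scalerA.
Qed.

Lemma ewords_pick k (a : rat) t : t \in ewords n k ->
  \sum_(v <- ewords n k) (a * (v == t)%:R) *: edge_prod x v = a *: edge_prod x t.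
Proof.
move=> tk; rewrite (bigD1_seq t) ?uniq_ewords //= eqxx mulr1 big1 ?addr0 // => v /negPf->.
by rewrite mulr0 scale0r.
Qed.

Lemma norm_ewords s : all (@offdiag n) s -> [seq norm_edge e | e <- s] \in ewords n (size s).
Proof.
move=> /allP sP; rewrite mem_ewords size_map eqxx; apply/allP => _ /mapP[e es ->].
exact/norm_edgeP/sP.
Qed.

End SignedProducts.

(** * Components of [pfb] as diagonal cohomology *)

Section FlatBraidTrace.
Context (n : nat).
Local Notation E := ('I_n * 'I_n)%type.
Implicit Types (e f : E) (s t : seq E) (S T U : {set E}).
Local Notation A := (pfb n).
Local Notation rdual := (@rdual n).
Local Notation good := (nclique (@star_rel n)).
Local Notation coord := (@star_coord n).
Local Notation c := (dual_coef rdual coord).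
Local Notation deg := (fun S : {set E} => #|S|).
Local Notation W k := (words good deg k k).

Definition rflat e : A := pfb_pi (rgp e).

Lemma rflatE s : edge_prod rflat s = pfb_pi (rprod s).
Proof. by rewrite /rprod rmorph_prod. Qed.

Lemma rflat_swap (i j : 'I_n) : i != j -> rflat (j, i) = - rflat (i, j).
Proof.
move=> ij; apply/eqP; rewrite -addr_eq0 addrC -(raddfD (@pfb_pi n)).
by apply/eqP/quot_pi_rel; exact: pfb_rel_antisym.
Qed.

Lemma rmorph_comm (R R' : pzRingType) (f : {rmorphism R -> R'}) (a b : R) :
  f (alg_comm a b) = f a * f b - f b * f a.
Proof. by rewrite rmorphB !rmorphM. Qed.

Lemma rmorph_comm3 (R R' : pzRingType) (f : {rmorphism R -> R'}) (a b d : R) :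
  f (alg_comm a (b + d) + alg_comm b d) = 0 ->
  (f a * f b - f b * f a) + (f a * f d - f d * f a) + (f b * f d - f d * f b) = 0.
Proof. by rewrite rmorphD alg_commDr rmorphD !rmorph_comm. Qed.

Lemma rflat_rel U :
  \sum_(e | edge e) \sum_(f | edge f) c [set e] [set f] U *: (rflat e * rflat f) = 0.
Proof.
apply: (dual_pairs0 (G := fun e f => rflat e * rflat f)) => [i j k ij jk|a b aP bP ab].
  have U3 : uniq [:: i; j; k].
    by rewrite /= !inE -!val_eqE /= !ltn_eqF // (ltn_trans ij).
  exact: (rmorph_comm3 (f := @pfb_pi n) (quot_pi_rel (pfb_rel_triple (@rgen n) U3))).
exact: etrans (esym (rmorph_comm (@pfb_pi n) (rgp a) (rgp b))) (quot_pi_rel (pfb_rel_far (@rgen n) ab)).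
Qed.

Lemma flat_act_rflat (sigma : 'S_n) e : offdiag e ->
  pfb_act sigma (rflat e) = rflat (sigma e.1, sigma e.2).
Proof. exact: pfb_act_rgen. Qed.

Lemma flat_act_edge_prod (sigma : 'S_n) s : all (@offdiag n) s ->
  pfb_act sigma (edge_prod rflat s) = edge_prod rflat [seq perm_pair sigma e | e <- s].
Proof.
have [_ [h1 hM] _] := pfb_act_morphism sigma.
apply: phi_edge_prod; [exact: hM|exact: h1|exact: flat_act_rflat].
Qed.

(** The sum lets a singleton letter yield its generator without extracting the edge; the intended
    arguments are words of singletons. *)
Definition edge_value (w : seq {set E}) : A := \prod_(S <- w) \sum_(e in S) rflat e.

Lemma edge_value_singles t : edge_value (singles t) = edge_prod rflat t.
Proof. by rewrite /edge_value /singles big_map; apply: eq_bigr => e _; rewrite big_set1. Qed.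

Lemma ewords_offdiag k t : t \in ewords n k -> all (@offdiag n) t.
Proof. by rewrite mem_ewords => /andP[_]; apply: sub_all; exact: edge_offdiag. Qed.

Lemma flat_span k u : pfb_component k u -> exists y : seq {set E} -> rat,
  u = \sum_(w <- W k | size w == k) y w *: edge_value w.
Proof.
pose Q (u : A) := exists y : seq {set E} -> rat, u = \sum_(t <- ewords n k) y (singles t) *: edge_prod rflat t.
suff main : pfb_component k u -> Q u.
  move=> /main[y uE]; exists y; rewrite big_words_singles uE.
  by apply: eq_bigr => t _; rewrite edge_value_singles.
case=> v hv <-; elim/homog_ind: v / hv => [|x1 y1 [y hx] [z hy]|a w wk].
- by exists (fun=> 0); rewrite (raddf0 (@pfb_pi n)) big1 // => t _; rewrite scale0r.
- exists (fun w => y w + z w); rewrite (raddfD (@pfb_pi n)).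
  apply: etrans (congr2 +%R hx hy) _; rewrite -big_split.
  by apply: eq_bigr => t _; rewrite scalerDl.
have -> : pfb_pi (a *: fword rat w) = a *: pfb_pi (fword rat w) by exact: (linearZ_LR (@pfb_pi n)).
have sP : all (@offdiag n) [seq val p | p <- w] by apply/allP => _ /mapP[p _ ->]; exact: (valP p).
rewrite fword_rprod -rflatE (edge_prod_sign rflat_swap sP) scalerA.
have := norm_ewords sP; rewrite size_map wk; set t := map _ _; set b := _ * _ => tk.
exists (fun w => b * (w == singles t)%:R); rewrite -(ewords_pick _ _ tk).
by apply: eq_bigr => v _; rewrite (inj_eq (@singles_inj n)).
Qed.

Section Kernel.
Context (k : nat) (phi : seq {set E} -> rat).
Let delta (w v : seq {set E}) : rat := (v == w)%:R.
Hypothesis phi_cocycle : forall w, w \in W k -> (size w).+1 = k ->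
  \sum_(v <- W k | size v == k) cobar c (delta w) v * phi v = 0.

(* The functional on words of the free algebra that induces phi on the degree k
   component of pfb. *)
Definition flat_ext s : rat :=
  if (size s == k) && all (@offdiag n) s
  then \prod_(e <- s) edge_sign e * phi (singles [seq norm_edge e | e <- s]) else 0.

Lemma flat_ext_swap s t e : flat_ext (s ++ (e.2, e.1) :: t) = - flat_ext (s ++ e :: t).
Proof.
rewrite /flat_ext !size_cat !all_cat /= /offdiag /= [e.2 == _]eq_sym.
case: ifP => [/and4P[_ _ eo _]|]; last by rewrite oppr0.
have hn : norm_edge (e.2, e.1) = norm_edge e.
  move: eo; rewrite /norm_edge /edge /= neq_ltn; case: ltngtP => //= _ _.
  by rewrite -surjective_pairing.
have hs : edge_sign (e.2, e.1) = - edge_sign e.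
  by move: eo; rewrite /edge_sign /edge /= neq_ltn; case: ltngtP => //=; rewrite opprK.
rewrite !map_cat !map_cons hn !big_cat !big_cons hs /=; ring.
Qed.

(** This is the cocycle condition for [phi] at the word with [U] placed between the normalised edges
    of [s] and [t], multiplied by the signs of those edges. *)
Lemma flat_ext_rel s t U : all (@offdiag n) s -> all (@offdiag n) t -> good U -> #|U| = 2 ->
  \sum_(e | edge e) \sum_(f | edge f) c [set e] [set f] U *: (flat_ext (s ++ e :: f :: t) : rat^o) = 0.
Proof.
move=> sP tP gU U2; set s1 := [seq norm_edge e | e <- s]; set t1 := [seq norm_edge e | e <- t].
have n1 u : all (@offdiag n) u -> all (@edge n) [seq norm_edge e | e <- u].
  by move=> /norm_ewords; rewrite mem_ewords => /andP[].
have [sk|sk] := eqVneq (size s1 + size t1).+2 k; last first.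
  rewrite big1 // => e _; rewrite big1 // => f _; rewrite /flat_ext size_cat /= !addnS.
  by rewrite !size_map in sk; rewrite (negPf sk) scaler0.
have dE u : sumn [seq #|X| | X : {set E} <- singles u] = size u := degw_singles u.
have W1 : singles s1 ++ U :: singles t1 \in W k.
  rewrite mem_words //; last exact: good_gt0.
  rewrite all_cat /= gU !good_singles !n1 //= /degw map_cat sumn_cat /= !dE U2 -sk.
  by rewrite add2n !addnS.
have szw : (size (singles s1 ++ U :: singles t1)).+1 = k.
  by rewrite size_cat /= ![size (singles _)]size_map addnS.
have h0 := big_cobar_delta (@dual_c_graded n) phi (n1 _ sP) (n1 _ tP) gU U2.
rewrite sk in h0.
have h1 := phi_cocycle W1 szw; rewrite big_words_singles in h1.
have /eqP := etrans (esym h0) h1; rewrite mulf_eq0 signr_eq0 /= => /eqP h.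
rewrite -[RHS](mulr0 (\prod_(e <- s) edge_sign e * \prod_(e <- t) edge_sign e)) -[X in _ = _ * X]h.
rewrite mulr_sumr; apply: eq_bigr => e eP; rewrite mulr_sumr; apply: eq_bigr => f fP.
rewrite /flat_ext size_cat /= !addnS; move: sk; rewrite !size_map => ->; rewrite eqxx all_cat sP /= !edge_offdiag // tP /=.
rewrite big_cat !big_cons map_cat /= /singles map_cat /=.
have ne g : edge g -> norm_edge g = g by rewrite /norm_edge => ->.
have se g : edge g -> edge_sign g = 1 by rewrite /edge_sign => ->.
rewrite !ne // !se // !mul1r.
rewrite /GRing.scale /=; ring.
Qed.

(** The factors in [dual_pairs_triple] and [dual_pairs_far] are nonzero, so a vanishing coboundary
    pairing gives back the relation itself. This is the converse of the use made of them in
    [rflat_rel]. *)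
Lemma flat_ext_ideal x : ideal_gen (pfb_rel (@rgen n)) x -> rlin flat_ext x = 0.
Proof.
apply: rlin_ideal => [s t e|s t i j k' ij jk sP tP G|s t e f eP fP U sP tP].
- exact: flat_ext_swap.
- have [a a0 h] := dual_pairs_triple (G : E -> E -> rat^o) ij jk.
  have [_ eij eik _ sU] := star_pair ij jk.
  have gU : good [set (i, j); (i, k')].
    by rewrite /nclique sU; apply/set0Pn; exists (i, j); rewrite !inE eqxx.
  have U2 : #|[set (i, j); (i, k')]| = 2%N.
    by rewrite cards2 xpair_eqE eqxx /= (_ : j != k') // neq_ltn jk.
  have := flat_ext_rel sP tP gU U2; rewrite h => /eqP.
  by rewrite scaler_eq0 (negPf a0) => /eqP.
- have [a a0 h] := dual_pairs_far ((fun e f => flat_ext (s ++ e :: f :: t)) : E -> E -> rat^o) eP fP U.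
  have [sU ef] : star_rel e f /\ e != f.
    move: U; rewrite /= !inE !negb_or => /and4P[/and3P[h1 h2 h3] /andP[h4 h5] h6 _].
    by split; [rewrite /star_rel eP h5 h4 h3 orbT|apply: contraNneq h2 => ->].
  have gU : good [set e; f].
    have sU' : star_rel f e by rewrite -star_relC.
    by rewrite /nclique star2 //; apply/set0Pn; exists e; rewrite !inE eqxx.
  have U2 : #|[set e; f]| = 2%N by rewrite cards2 ef.
  have := flat_ext_rel sP tP gU U2; rewrite h => /eqP.
  by rewrite scaler_eq0 (negPf a0) subr_eq0 => /eqP.
Qed.

(** There are no relations between words of single edges in [pfb] besides coboundaries: a functional
    on words that kills those descends to the quotient algebra. *)
Lemma flat_kernel : exists F : A -> rat,
  [/\ forall u v, F (u + v) = F u + F v, forall a u, F (a *: u) = a * F u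
    & forall w, w \in W k -> size w = k -> F (edge_value w) = phi w].
Proof.
exists (fun u => rlin flat_ext (quot_repr u)).
have FE v : rlin flat_ext (quot_repr (pfb_pi v)) = rlin flat_ext v.
  by apply/eqP; rewrite -subr_eq0 -rlinB; apply/eqP/flat_ext_ideal/ideal_gen_repr.
split=> [|a|w wW wk].
- elim/quot_piW => u; elim/quot_piW => v.
  change (rlin flat_ext (quot_repr (pfb_pi u + pfb_pi v)) =
    rlin flat_ext (quot_repr (pfb_pi u)) + rlin flat_ext (quot_repr (pfb_pi v))).
  by rewrite -(raddfD (@pfb_pi n)) !FE rlinD.
- elim/quot_piW => u.
  change (rlin flat_ext (quot_repr (a *: pfb_pi u)) = a * rlin flat_ext (quot_repr (pfb_pi u))).
  have <- : pfb_pi (a *: u) = a *: pfb_pi u by exact: (linearZ_LR (@pfb_pi n)).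
  by rewrite !FE rlinZ.
have [t tk ->] := words_singles wW wk.
rewrite edge_value_singles rflatE FE rlin_rprod ?(ewords_offdiag tk) // /flat_ext.
rewrite (ewords_offdiag tk) andbT; move: (tk); rewrite mem_ewords => /andP[-> /allP tP].
rewrite big_seq big1 => [|e et]; last by rewrite /edge_sign tP.
by rewrite mul1r; congr (phi (singles _)); apply: map_id_in => e et; rewrite /norm_edge tP.
Qed.

End Kernel.

End FlatBraidTrace.

Lemma additive_scalable_linear (K : pzRingType) (V1 V2 : lmodType K) (f : V1 -> V2) :
  zmod_morphism f -> scalable f -> linear f.
Proof.
move=> fB fZ a x y; have f0 : f 0 = 0 by have := fB 0 0; rewrite !subrr.
have fN z : f (- z) = - f z by have := fB 0 z; rewrite f0 !sub0r.
by have := fB (a *: x) (- y); rewrite fN !opprK fZ.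
Qed.

(** * The Koszul formula for characters *)

Section Koszul.
Context (n : nat) (sigma : 'S_n).
Local Notation E := ('I_n * 'I_n)%type.
Implicit Types (e f : E) (s t : seq E) (S T U : {set E}).
Local Notation rdual := (@rdual n).
Local Notation rflat := (@rflat n).
Local Notation good := (nclique (@star_rel n)).
Local Notation coord := (@star_coord n).
Local Notation c := (dual_coef rdual coord).
Local Notation q := (act_coef rdual coord (pfb_dual_act sigma^-1)).
Local Notation deg := (fun S : {set E} => #|S|).
Local Notation W k := (words good deg k k).

Lemma dual_q_graded S T : good T -> q S T != 0 -> good S /\ #|S| = #|T|.
Proof.
exact: (act_coef_graded (@rdual_sq n) (@rdual_anti n) (@rdual_tri n) (@rdualN n)
  (@star_coordZ n) (@star_coord_mon n) (dual_actM sigma^-1) (dual_act1 sigma^-1) (@dual_act_rdual n sigma^-1)).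
Qed.

Lemma dual_cq S T U : good S -> good T ->
  \sum_X c S T X * q U X = \sum_X \sum_Y q X S * q Y T * c X Y U.
Proof.
exact: (act_coef_mul (@rdual_sq n) (@rdual_anti n) (@rdual_tri n) (@rdualN n)
  (@star_coordD n) (@star_coordZ n) (@star_coord_mon n) (dual_actD sigma^-1) (dual_actZ sigma^-1)
  (dual_actM sigma^-1) (dual_act1 sigma^-1) (@dual_act_rdual n sigma^-1)).
Qed.

(** Both sides are a signed product of the permuted edges; the signs from reordering their ends
    agree by [dual_act_edge]. *)
Lemma flat_act_word k w : w \in W k -> size w = k -> pfb_act sigma (edge_value w) =
  \sum_(v <- W k | size v == k) cobar_act q (fun u => (u == w)%:R) v *: edge_value v.
Proof.
move=> wW wk; have [t tk ->] := words_singles wW wk.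
have tP := ewords_offdiag tk.
have pP : all (@offdiag n) [seq perm_pair sigma e | e <- t].
  by apply/allP => _ /mapP[e et ->]; apply: perm_pair_offdiag; exact: (allP tP).
have /andP[/eqP tk' tE] : (size t == k) && all (@edge n) t by rewrite -mem_ewords.
have := norm_ewords pP; rewrite size_map tk' -map_comp => nk.
rewrite edge_value_singles (flat_act_edge_prod sigma tP) (edge_prod_sign (@rflat_swap n) pP) big_map -map_comp.
rewrite -(ewords_pick _ _ nk) big_words_singles; apply: eq_big_seq => v.
rewrite mem_ewords => /andP[_ vE]; rewrite edge_value_singles.
by rewrite (cobar_act_singles (@dual_act_edge n sigma) tE vE).
Qed.

Lemma pfb_char_supertr k : pfb_char sigma k = supertr good deg (fun S => q S S) k.
Proof.
have [hB _ hZ] := pfb_act_morphism sigma.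
apply: (cobar_trace (@good_gt0 n) (@dual_c_graded n) (@dual_cA n) dual_q_graded dual_cq
  (@dual_exact n k) (R := @edge_value n) (U := @pfb_component n k) (act := pfb_act sigma)).
- exact: additive_scalable_linear hB hZ.
- move=> w wW wk; have [t tk ->] := words_singles wW wk.
  rewrite edge_value_singles rflatE; exists (rprod t) => //.
  by move: tk; rewrite mem_ewords => /andP[/eqP <- _]; exact: homog_rprod.
- exact: flat_span.
- exact: flat_act_word.
- move=> w _ _; rewrite big_words_singles.
  under eq_bigr do rewrite edge_value_singles.
  exact: (big_cobar_ewords (@rflat_rel n)).
- exact: flat_kernel.
- exact: pfb_charP.
Qed.

Lemma flat_char_inv : fps_mul (pfb_char sigma) (fps_subN (pfb_dual_char sigma)) = @fps_one rat.
Proof.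
apply/funext => k; rewrite /fps_mul /fps_one /fps_subN.
under eq_bigr do rewrite pfb_char_supertr.
apply: (supertr_inv (@good_gt0 n)) => [|j j0]; first exact: pfb_dual_char0.
rewrite pfb_dual_charE; apply: eq_big => S.
  by rewrite /nclique -card_gt0; case: eqP => [->|_]; rewrite ?j0 ?andbT ?andbF.
move=> /andP[sS /eqP Sj]; have gS : good S by rewrite /nclique sS -card_gt0 Sj.
have -> : q S S = coord S (pfb_dual_act sigma^-1 (star_mon rdual S)) by rewrite /act_coef gS.
(* The supertrace carries the inverse permutation on the dual, whose diagonal entries are those of
   the permutation. *)
exact/esym/dual_diag.
Qed.

End Koszul.

(** The product with [f] determines each coefficient from the earlier ones, as [f 0] is
    invertible. *)
Lemma fps_inv_uniq (K : fieldType) (f g : nat -> K) : f 0%N != 0 ->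
  fps_mul g f = fps_one K -> g = fps_inv f.
Proof.
move=> f0 gf; have fV := fps_mulVf f0; apply/funext => k.
elim/ltn_ind: k => k IH; have := congr1 (fun h => h k) (etrans gf (esym fV)).
rewrite /fps_mul !big_ord_recr /= subnn (eq_bigr (fun i : 'I_k => fps_inv f i * f (k - i)%N)).
  by move/addrI/(mulIf f0).
by move=> i _; rewrite IH.
Qed.

Theorem corollary6 (n : nat) (hn : (1 <= n)%N) (s : 'S_n) :
  pfb_char s = fps_inv (fps_subN (pfb_dual_char s)).
Proof.
apply: fps_inv_uniq; last exact: flat_char_inv.
by rewrite /fps_subN pfb_dual_char0 expr0 mulr1 oner_neq0.
Qed.
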